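(* Let $k>4$ and let $\Sigma^k$ be one of the standard totally umbilical submanifolds of $(\mathbb HP^m,g_0)$ listed below, with second fundamental form $\sigma$, and let $L=\Delta+|\sigma|^2+k$. Then: (1) if $\Sigma=\mathbb HP^\ell\subset\mathbb HP^m$ (totally geodesic quaternionic projective subspace), $k=4\ell$, then $\lambda_2(L)=k+8$; (2) if $\Sigma=\mathbb CP^\ell\subset\mathbb HP^m$ (totally geodesic complex projective subspace), $k=2\ell$, then $\lambda_2(L)=k+4$; (3) if $\Sigma=\mathbb RP^k\subset\mathbb HP^m$ (totally geodesic totally real projective subspace), then $\lambda_2(L)=k+2$; (4) if the immersion is the double covering $S^k\to\mathbb RP^k\subset\mathbb HP^m$, then $\lambda_2(L)=0$; (5) if $\Sigma=S^k(r)\subset\mathbb RP^{k+1}\subset\mathbb HP^m$, $0<r<\frac\pi2$ (extrinsic sphere in a totally geodesic totally real projective subspace), then $\lambda_2(L)=0$.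
   Context: $g_0$ is the standard metric on $\mathbb HP^m$, i.e. the quotient metric of the unit sphere $\mathbb S^{4m+3}\subset\mathbb H^{m+1}$ by unit quaternions acting on the right, normalized to have quaternionic sectional curvature $4$ (sectional curvatures in $[1,4]$). The standard totally geodesic subspaces are: $\mathbb HP^\ell$, the lines contained in $\mathbb H^{\ell+1}\times\{0\}$; $\mathbb CP^\ell$, the classes of vectors in $\mathbb C^{\ell+1}\times\{0\}$ for a fixed $\mathbb C\subset\mathbb H$ (induced metric: Fubini–Study of holomorphic sectional curvature $4$); $\mathbb RP^k$, the classes of real vectors in $\mathbb R^{k+1}\times\{0\}$ (induced metric of constant curvature $1$). $S^k\to\mathbb RP^k$ is the antipodal covering from the unit sphere. $S^k(r)\subset\mathbb RP^{k+1}$ is the geodesic sphere of radius $r$, i.e. the set of points at distance $r$ from a fixed point of $\mathbb RP^{k+1}$. Each $\Sigma$ carries the induced metric, and $\Delta=\operatorname{div}\nabla$ is its Laplacian. The eigenvalues of $L$ are the $\lambda$ with $Lu+\lambda u=0$ for some $u\ne0$ (i.e. the eigenvalues of $-L$), enumerated increasingly with multiplicity as $\lambda_1(L),\lambda_2(L),\dots$. *)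

(* Defs.v *)
From HB Require Import structures.
From mathcomp Require Import all_boot all_order all_algebra.
From mathcomp Require Import all_classical all_reals all_analysis.
From mathcomp Require Import ring lra.

Set Implicit Arguments.
Unset Strict Implicit.
Unset Printing Implicit Defensive.

Import Order.TTheory GRing.Theory Num.Theory numFieldNormedType.Exports.

Local Open Scope classical_set_scope.
Local Open Scope ring_scope.

(* A metric on a coordinate space 'rV_n is given by its Gram matrix [g x] in the
   coordinate frame. *)

Section LocalGeometry.
Context {R : realType}.

Definition pd n (f : 'rV[R]_n -> R) (i : 'I_n) : 'rV[R]_n -> R :=
  fun x => 'D_(delta_mx 0 i) f x.

(* C^oo: every iterated partial derivative exists and is continuous. *)
Definition smooth n (f : 'rV[R]_n -> R) : Prop :=
  forall s : seq 'I_n, let h := foldl (@pd n) f s in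
    continuous h /\ forall i x, derivable h x (delta_mx 0 i).

Definition christoffel n (g : 'rV[R]_n -> 'M[R]_n) (l i j : 'I_n)
    (x : 'rV[R]_n) : R :=
  2^-1 * \sum_s invmx (g x) l s *
    (pd (fun y => g y s j) i x + pd (fun y => g y s i) j x
     - pd (fun y => g y i j) s x).

Definition grad n (g : 'rV[R]_n -> 'M[R]_n) (f : 'rV[R]_n -> R)
    (l : 'I_n) (x : 'rV[R]_n) : R :=
  \sum_s invmx (g x) l s * pd f s x.

(* Trace of the Levi-Civita covariant derivative of the vector field [X]. *)
Definition divg n (g : 'rV[R]_n -> 'M[R]_n) (X : 'I_n -> 'rV[R]_n -> R)
    (x : 'rV[R]_n) : R :=
  \sum_i (pd (X i) i x + \sum_j christoffel g i i j x * X j x).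

Definition laplacian n (g : 'rV[R]_n -> 'M[R]_n) (f : 'rV[R]_n -> R) :
  'rV[R]_n -> R := divg g (grad g f).

Definition jac k n (F : 'rV[R]_k -> 'rV[R]_n) (x : 'rV[R]_k) : 'M[R]_(k, n) :=
  \matrix_(i, c) pd (fun y => F y 0 c) i x.

Definition pullback k n (G : 'rV[R]_n -> 'M[R]_n) (F : 'rV[R]_k -> 'rV[R]_n)
    (x : 'rV[R]_k) : 'M[R]_k :=
  jac F x *m G (F x) *m (jac F x)^T.

(* The c-th component of sigma(d_i, d_j), by the Gauss formula: covariant
   derivative of dF(d_j) along d_i in the ambient space, minus the image under
   dF of the covariant derivative for the induced metric. *)
Definition sff k n (G : 'rV[R]_n -> 'M[R]_n) (F : 'rV[R]_k -> 'rV[R]_n)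
    (x : 'rV[R]_k) (i j : 'I_k) (c : 'I_n) : R :=
  pd (pd (fun y => F y 0 c) j) i x
  + \sum_a \sum_b christoffel G c a b (F x) * jac F x i a * jac F x j b
  - \sum_l christoffel (pullback G F) l i j x * jac F x l c.

Definition sff_normsq k n (G : 'rV[R]_n -> 'M[R]_n)
    (F : 'rV[R]_k -> 'rV[R]_n) (x : 'rV[R]_k) : R :=
  let h := invmx (pullback G F x) in
  \sum_i \sum_j \sum_p \sum_q \sum_c \sum_d
    h i p * h j q * G (F x) c d * sff G F x i j c * sff G F x p q d.

End LocalGeometry.

Section QuaternionicProjectiveSpace.
Context {R : realType}.

(* Euclidean inner product of real matrices. *)
Definition dotm p q (x y : 'M[R]_(p, q)) : R := \tr (x *m y^T).

Definition unitize p q (x : 'M[R]_(p, q)) : 'M[R]_(p, q) :=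
  (Num.sqrt (dotm x x))^-1 *: x.

(* A quaternion a + b i + c j + d k is the row vector (a, b, c, d); a vector of
   H^n is a real n x 4 matrix, one quaternion per row. *)
Definition qe (n : nat) : 'rV[R]_4 := delta_mx 0 (inord n).

Definition qmul (p q : 'rV[R]_4) : 'rV[R]_4 :=
  let P n := p 0 (inord n) in let Q n := q 0 (inord n) in
  \row_(i < 4) nth 0
    [:: P 0%N * Q 0%N - P 1%N * Q 1%N - P 2%N * Q 2%N - P 3%N * Q 3%N;
        P 0%N * Q 1%N + P 1%N * Q 0%N + P 2%N * Q 3%N - P 3%N * Q 2%N;
        P 0%N * Q 2%N - P 1%N * Q 3%N + P 2%N * Q 0%N + P 3%N * Q 1%N;
        P 0%N * Q 3%N + P 1%N * Q 2%N - P 2%N * Q 1%N + P 3%N * Q 0%N] i.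

Definition rscale n (x : 'M[R]_(n, 4)) (q : 'rV[R]_4) : 'M[R]_(n, 4) :=
  \matrix_(i, j) qmul (row i x) q 0 j.

(* For a unit vector [x], the point of HP^m it represents: its orbit in the
   unit sphere under right multiplication by unit quaternions. *)
Definition hline n (x : 'M[R]_(n, 4)) : set 'M[R]_(n, 4) :=
  [set y | exists2 q, dotm q q = 1 & y = rscale x q].

Definition HPspace m : set (set 'M[R]_(m.+1, 4)) :=
  [set A | exists2 x : 'M[R]_(m.+1, 4), dotm x x = 1 & A = hline x].

(* The distance of the quotient metric: the smallest great-circle distance
   between representatives. *)
Definition qdist n (A B : set 'M[R]_(n, 4)) : R :=
  inf [set t | exists x y, [/\ A x, B y & t = acos (dotm x y)]].

(* Affine coordinates on HP^m in the homogeneous coordinates attached to a real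
   orthogonal matrix Q: the point with coordinates y in H^m is the class of
   Q (1, y), and [hlift] is its unit representative. *)
Definition hlift m (Q : 'M[R]_m.+1) (y : 'rV[R]_(m * 4)) : 'M[R]_(m.+1, 4) :=
  unitize (Q *m (col_mx (qe 0) (vec_mx y) : 'M[R]_(m.+1, 4))).

Definition hpar m (Q : 'M[R]_m.+1) (y : 'rV[R]_(m * 4)) :
  set 'M[R]_(m.+1, 4) := hline (hlift Q y).

(* Orthogonal projection along the tangent space of the orbit of a unit vector
   [x], of which x i, x j, x k is an orthonormal basis. *)
Definition hor n (x w : 'M[R]_(n, 4)) : 'M[R]_(n, 4) :=
  w - \sum_(1 <= s < 4) dotm w (rscale x (qe s)) *: rscale x (qe s).

(* The quotient metric g_0: the inner product of two tangent vectors of HP^m is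
   that of their horizontal lifts to the unit sphere. *)
Definition hmetric m (Q : 'M[R]_m.+1) (y : 'rV[R]_(m * 4)) : 'M[R]_(m * 4) :=
  \matrix_(a, b)
    dotm (hor (hlift Q y) ('D_(delta_mx 0 a) (hlift Q) y))
         (hor (hlift Q y) ('D_(delta_mx 0 b) (hlift Q) y)).

End QuaternionicProjectiveSpace.

(* The manifold [src] of dimension k has an atlas of parametrizations [par a],
   each defined on the whole of R^k; [loc a] is the expression of the immersion
   [imm] from [par a] to the affine coordinates [hpar (frame a)] of HP^m. A
   function u on [src] is smooth when every [u \o par a] is. *)
Record immersion (R : realType) (m k : nat) := Immersion {
  src : Type;
  idx : Type;
  par : idx -> 'rV[R]_k -> src;
  imm : src -> set 'M[R]_(m.+1, 4);
  frame : idx -> 'M[R]_m.+1;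
  loc : idx -> 'rV[R]_k -> 'rV[R]_(m * 4);
  frame_orth : forall a, (frame a)^T *m frame a = 1%:M;
  par_cover : forall x, exists a v, par a v = x;
  immE : forall a v, imm (par a v) = hpar (frame a) (loc a v)
}.

Section Spectrum.
Context {R : realType} {m k : nat}.
Variable S : immersion R m k.

(* L = Delta + |sigma|^2 + k, in the parametrization [par a]. *)
Definition Lop (a : idx S) (f : 'rV[R]_k -> R) (v : 'rV[R]_k) : R :=
  let G := hmetric (frame a) in let F := loc a in
  laplacian (pullback G F) f v + (sff_normsq G F v + k%:R) * f v.

Definition eigenfunction (mu : R) (u : src S -> R) : Prop :=
  (exists x, u x != 0) /\
  forall a, smooth (u \o par a) /\
    forall v, Lop a (u \o par a) v + mu * u (par a v) = 0.

(* c is the n-th eigenvalue of L (n >= 1), counted with multiplicity: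
   lam 0 <= ... <= lam n.-1 = c lists the first n eigenvalues, i.e. it is
   realized by linearly independent eigenfunctions phi, and an eigenfunction
   that is not in the span of these has an eigenvalue at least c. *)
Definition is_lambda (n : nat) (c : R) : Prop :=
  exists (lam : nat -> R) (phi : nat -> src S -> R),
    [/\ lam n.-1 = c,
        forall i j, (i <= j < n)%N -> lam i <= lam j,
        forall i, (i < n)%N -> eigenfunction (lam i) (phi i),
        forall b : nat -> R, (forall x, \sum_(i < n) b i * phi i x = 0) ->
          forall i, (i < n)%N -> b i = 0
      & forall mu u, eigenfunction mu u ->
          (exists b : nat -> R, forall x, u x = \sum_(i < n) b i * phi i x)
          \/ c <= mu].

End Spectrum.

Section Standard.
Context {R : realType}.

(* Adds zero rows at the bottom (when n <= m). *)
Definition pad n m q (x : 'M[R]_(n, q)) : 'M[R]_(m, q) :=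
  \matrix_(i, j) (if insub (val i) is Some i' then x i' j else 0).

(* Orthogonal matrices that preserve the subspace of R^(m+1) spanned by the
   first n + 1 basis vectors. *)
Definition adapted m n (Q : 'M[R]_m.+1) : Prop :=
  Q^T *m Q = 1%:M /\
  forall i j : 'I_m.+1, (j <= n)%N -> (n < i)%N -> Q i j = 0.

(* The classes of the vectors of K^(n+1) x {0}, where K is the span in H of the
   rows of B. *)
Definition proj_subspace m d (B : 'M[R]_(d, 4)) (n : nat) :
    set (set 'M[R]_(m.+1, 4)) :=
  [set A | exists x : 'M[R]_(m.+1, 4),
     [/\ dotm x x = 1, (x <= B)%MS,
         forall i : 'I_m.+1, (n < i)%N -> row i x = 0
       & A = hline x]].

Definition imaginary_unit (u : 'rV[R]_4) : Prop :=
  u 0 (inord 0) = 0 /\ dotm u u = 1.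

Definition HPset {m} l := @proj_subspace m 4 1%:M l.
(* The copy of C in H is R + R u. *)
Definition CPset {m} l (u : 'rV[R]_4) := @proj_subspace m 2 (col_mx (qe 0) u) l.
Definition RPset {m} k := @proj_subspace m 1 (qe 0) k.

(* Unit sphere of R^(k+1) x {0}. *)
Definition sphere {m} k : set 'cV[R]_m.+1 :=
  [set x | dotm x x = 1 /\ forall i : 'I_m.+1, (k < i)%N -> x i 0 = 0].

Definition geodesic_sphere {m} k (P : set 'M[R]_(m.+1, 4)) (r : R) :
    set (set 'M[R]_(m.+1, 4)) :=
  [set A | RPset k.+1 A /\ qdist A P = r].

Lemma dotmE p q (x y : 'M[R]_(p, q)) : dotm x y = \sum_i \sum_j x i j * y i j.
Proof.
rewrite /dotm /mxtrace; apply: eq_bigr => i _; rewrite mxE.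
by apply: eq_bigr => j _; rewrite mxE.
Qed.

Lemma dotmC p q (x y : 'M[R]_(p, q)) : dotm x y = dotm y x.
Proof. by rewrite /dotm -mxtrace_tr trmx_mul trmxK. Qed.

Lemma dotmZl p q a (x y : 'M[R]_(p, q)) : dotm (a *: x) y = a * dotm x y.
Proof. by rewrite /dotm -scalemxAl mxtraceZ. Qed.

Lemma dotmZr p q a (x y : 'M[R]_(p, q)) : dotm x (a *: y) = a * dotm x y.
Proof. by rewrite dotmC dotmZl dotmC. Qed.

Lemma dotmDl p q (x y z : 'M[R]_(p, q)) :
  dotm (x + y) z = dotm x z + dotm y z.
Proof. by rewrite /dotm mulmxDl mxtraceD. Qed.

Lemma dotmDr p q (x y z : 'M[R]_(p, q)) :
  dotm z (x + y) = dotm z x + dotm z y.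
Proof. by rewrite dotmC dotmDl !(dotmC z). Qed.

Lemma dotmBl p q (x y z : 'M[R]_(p, q)) :
  dotm (x - y) z = dotm x z - dotm y z.
Proof. by rewrite -scaleN1r dotmDl dotmZl mulN1r. Qed.

Lemma dotmBr p q (x y z : 'M[R]_(p, q)) :
  dotm z (x - y) = dotm z x - dotm z y.
Proof. by rewrite dotmC dotmBl !(dotmC z). Qed.

Lemma dotm_ge0 p q (x : 'M[R]_(p, q)) : 0 <= dotm x x.
Proof.
rewrite dotmE; apply: sumr_ge0 => i _; apply: sumr_ge0 => j _.
by rewrite -expr2 sqr_ge0.
Qed.

Lemma dotm_eq0 p q (x : 'M[R]_(p, q)) : (dotm x x == 0) = (x == 0).
Proof.
apply/idP/eqP => [|->]; last by rewrite /dotm mul0mx mxtrace0.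
have h i : 0 <= \sum_j x i j * x i j.
  by apply: sumr_ge0 => j _; rewrite -expr2 sqr_ge0.
rewrite dotmE psumr_eq0; last by move=> i _; exact: h.
move=> /allP H; apply/matrixP => i j; rewrite mxE.
have := H i (mem_index_enum _); rewrite /= psumr_eq0; last first.
  by move=> s _; rewrite -expr2 sqr_ge0.
move=> /allP /(_ j (mem_index_enum _)) /=.
by rewrite mulf_eq0 orbb => /eqP.
Qed.

Lemma dotm_gt0 p q (x : 'M[R]_(p, q)) : x != 0 -> 0 < dotm x x.
Proof. by move=> x0; rewrite lt_neqAle eq_sym dotm_eq0 x0 dotm_ge0. Qed.

Lemma dotm_orth n q (Q : 'M[R]_n) (x y : 'M[R]_(n, q)) :
  Q^T *m Q = 1%:M -> dotm (Q *m x) (Q *m y) = dotm x y.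
Proof.
move=> h; rewrite /dotm trmx_mul mulmxA mxtrace_mulC !mulmxA h mul1mx //.
Qed.

Lemma unitize_norm p q (x : 'M[R]_(p, q)) :
  x != 0 -> dotm (unitize x) (unitize x) = 1.
Proof.
move=> x0; rewrite /unitize dotmZl dotmZr mulrA -invfM -expr2.
by rewrite sqr_sqrtr ?dotm_ge0// mulVf// dotm_eq0.
Qed.

Lemma unitize_id p q (x : 'M[R]_(p, q)) : dotm x x = 1 -> unitize x = x.
Proof. by move=> h; rewrite /unitize h sqrtr1 invr1 scale1r. Qed.


Lemma unitizeZ p q (x : 'M[R]_(p, q)) a :
  0 < a -> unitize (a *: x) = unitize x.
Proof.
move=> a0; rewrite /unitize dotmZl dotmZr mulrA -expr2 sqrtrM ?sqr_ge0//.
rewrite sqrtr_sqr gtr0_norm// invfM scalerA mulrAC mulVf ?mul1r//.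
by rewrite gt_eqF.
Qed.

Lemma inordE n i (h : (i < n.+1)%N) : inord i = Ordinal h.
Proof. by apply: val_inj; rewrite /= inordK. Qed.

Lemma sum4 (F : 'I_4 -> R) :
  \sum_i F i = F (inord 0) + F (inord 1) + F (inord 2) + F (inord 3).
Proof.
rewrite !big_ord_recl big_ord0 addr0 !addrA.
by congr (F _ + F _ + F _ + F _); apply: val_inj; rewrite /= inordK.
Qed.

Lemma quatP (p q : 'rV[R]_4) :
  p 0 (inord 0) = q 0 (inord 0) -> p 0 (inord 1) = q 0 (inord 1) ->
  p 0 (inord 2) = q 0 (inord 2) -> p 0 (inord 3) = q 0 (inord 3) -> p = q.
Proof.
move=> h0 h1 h2 h3; apply/matrixP => i j; rewrite !ord1.
have -> : j = inord (val j) by rewrite inord_val.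
by case: j => [[|[|[|[|j]]]]] //=.
Qed.

Lemma dotm4 (p q : 'rV[R]_4) : dotm p q =
  p 0 (inord 0) * q 0 (inord 0) + p 0 (inord 1) * q 0 (inord 1) +
  p 0 (inord 2) * q 0 (inord 2) + p 0 (inord 3) * q 0 (inord 3).
Proof. by rewrite dotmE big_ord1 sum4. Qed.

Lemma qeE n i : (n < 4)%N -> (i < 4)%N ->
  qe n 0 (inord i) = (i == n)%:R :> R.
Proof.
move=> n4 i4; rewrite mxE eqxx /=; congr (nat_of_bool _)%:R.
by rewrite -val_eqE /= !inordK.
Qed.

Lemma qmulE (p q : 'rV[R]_4) :
  let P n := p 0 (inord n) in let Q n := q 0 (inord n) in
  [/\ qmul p q 0 (inord 0) =
        P 0%N * Q 0%N - P 1%N * Q 1%N - P 2%N * Q 2%N - P 3%N * Q 3%N,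
      qmul p q 0 (inord 1) =
        P 0%N * Q 1%N + P 1%N * Q 0%N + P 2%N * Q 3%N - P 3%N * Q 2%N,
      qmul p q 0 (inord 2) =
        P 0%N * Q 2%N - P 1%N * Q 3%N + P 2%N * Q 0%N + P 3%N * Q 1%N
    & qmul p q 0 (inord 3) =
        P 0%N * Q 3%N + P 1%N * Q 2%N - P 2%N * Q 1%N + P 3%N * Q 0%N].
Proof. by split; rewrite mxE inordK. Qed.

Lemma qmul0E (p q : 'rV[R]_4) : qmul p q 0 (inord 0) =
  p 0 (inord 0) * q 0 (inord 0) - p 0 (inord 1) * q 0 (inord 1) -
  p 0 (inord 2) * q 0 (inord 2) - p 0 (inord 3) * q 0 (inord 3).
Proof. by case: (qmulE p q). Qed.

Lemma qmul1E (p q : 'rV[R]_4) : qmul p q 0 (inord 1) =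
  p 0 (inord 0) * q 0 (inord 1) + p 0 (inord 1) * q 0 (inord 0) +
  p 0 (inord 2) * q 0 (inord 3) - p 0 (inord 3) * q 0 (inord 2).
Proof. by case: (qmulE p q). Qed.

Lemma qmul2E (p q : 'rV[R]_4) : qmul p q 0 (inord 2) =
  p 0 (inord 0) * q 0 (inord 2) - p 0 (inord 1) * q 0 (inord 3) +
  p 0 (inord 2) * q 0 (inord 0) + p 0 (inord 3) * q 0 (inord 1).
Proof. by case: (qmulE p q). Qed.

Lemma qmul3E (p q : 'rV[R]_4) : qmul p q 0 (inord 3) =
  p 0 (inord 0) * q 0 (inord 3) + p 0 (inord 1) * q 0 (inord 2) -
  p 0 (inord 2) * q 0 (inord 1) + p 0 (inord 3) * q 0 (inord 0).
Proof. by case: (qmulE p q). Qed.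

Definition qmulEs := (qmul0E, qmul1E, qmul2E, qmul3E).

Lemma qmulA (p q r : 'rV[R]_4) : qmul (qmul p q) r = qmul p (qmul q r).
Proof. by apply: quatP; rewrite !qmulEs; ring. Qed.

Lemma qmulp1 (p : 'rV[R]_4) : qmul p (qe 0) = p.
Proof. by apply: quatP; rewrite !qmulEs !qeE//=; ring. Qed.

Lemma qmul1p (p : 'rV[R]_4) : qmul (qe 0) p = p.
Proof. by apply: quatP; rewrite !qmulEs !qeE//=; ring. Qed.

Lemma qnormM (p q : 'rV[R]_4) :
  dotm (qmul p q) (qmul p q) = dotm p p * dotm q q.
Proof. by rewrite !dotm4 !qmulEs; ring. Qed.

Lemma qmulZr (p q : 'rV[R]_4) a : qmul p (a *: q) = a *: qmul p q.
Proof. by apply: quatP; rewrite [RHS]mxE !qmulEs !mxE; ring. Qed.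

Definition qconj (q : 'rV[R]_4) : 'rV[R]_4 := (2 * q 0 (inord 0)) *: qe 0 - q.

Lemma qconjE (q : 'rV[R]_4) n : (n < 4)%N -> qconj q 0 (inord n) =
  if n == 0%N then q 0 (inord 0) else - q 0 (inord n).
Proof.
move=> n4; rewrite !mxE eqxx /= -val_eqE /= !inordK//.
by case: eqP => [->|_] /=; ring.
Qed.

Lemma qmul_conj (q : 'rV[R]_4) : qmul q (qconj q) = dotm q q *: qe 0.
Proof.
apply: quatP; rewrite qmulEs !qconjE// mxE qeE// dotm4 /=; ring.
Qed.

Lemma qnorm_conj (q : 'rV[R]_4) : dotm (qconj q) (qconj q) = dotm q q.
Proof. by rewrite !dotm4 !qconjE//=; ring. Qed.

Lemma rscaleE n (x : 'M[R]_(n, 4)) q :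
  rscale x q = x *m (\matrix_i qmul (delta_mx 0 i) q).
Proof.
apply/matrixP => i j; rewrite [LHS]mxE [RHS]mxE sum4.
have rE s : (\matrix_k qmul (delta_mx 0 k) q) (inord s) j
            = qmul (qe s) q 0 j by rewrite mxE.
rewrite !rE; have -> : j = inord (val j) by rewrite inord_val.
by case: j {rE} => [[|[|[|[|j]]]]] //= _; rewrite !qmulEs !qeE//= !mxE; ring.
Qed.

Lemma rscaleMl n p (A : 'M[R]_(p, n)) (x : 'M[R]_(n, 4)) q :
  rscale (A *m x) q = A *m rscale x q.
Proof. by rewrite !rscaleE mulmxA. Qed.

Lemma row_rscale n (x : 'M[R]_(n, 4)) q i :
  row i (rscale x q) = qmul (row i x) q.
Proof. by apply/matrixP => a b; rewrite ord1 !mxE. Qed.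

Lemma rscaleA n (x : 'M[R]_(n, 4)) p q :
  rscale (rscale x p) q = rscale x (qmul p q).
Proof.
by apply/row_matrixP => i; rewrite !row_rscale qmulA.
Qed.

Lemma rscalex1 n (x : 'M[R]_(n, 4)) : rscale x (qe 0) = x.
Proof. by apply/row_matrixP => i; rewrite row_rscale qmulp1. Qed.

Lemma rscaleZr n (x : 'M[R]_(n, 4)) q a : rscale x (a *: q) = a *: rscale x q.
Proof.
by apply/row_matrixP => i; rewrite row_rscale qmulZr linearZ /= row_rscale.
Qed.

Lemma dotm_rows n q (x : 'M[R]_(n, q)) :
  dotm x x = \sum_i dotm (row i x) (row i x).
Proof.
rewrite dotmE; apply: eq_bigr => i _; rewrite dotmE big_ord1.
by apply: eq_bigr => j _; rewrite mxE.
Qed.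

Lemma rscale_norm n (x : 'M[R]_(n, 4)) q :
  dotm (rscale x q) (rscale x q) = dotm x x * dotm q q.
Proof.
rewrite dotm_rows (dotm_rows x) mulr_suml.
by apply: eq_bigr => i _; rewrite row_rscale qnormM.
Qed.

Lemma hline_rscale n (x : 'M[R]_(n, 4)) q :
  dotm q q = 1 -> hline (rscale x q) = hline x.
Proof.
move=> q1; apply/seteqP; split => y [p p1 ->].
  by exists (qmul q p); [rewrite qnormM q1 p1 mulr1|rewrite rscaleA].
exists (qmul (qconj q) p); first by rewrite qnormM qnorm_conj q1 p1 mulr1.
by rewrite rscaleA -qmulA qmul_conj q1 scale1r qmul1p.
Qed.

Lemma dotm_qe0 : dotm (qe 0) (qe 0) = 1 :> R.
Proof. by rewrite dotm4 !qeE//=; ring. Qed.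

Lemma dotm_mul_qe0 n (a b : 'cV[R]_n) p q :
  dotm (a *m p) (b *m q) = dotm a b * dotm (p : 'rV[R]_4) q.
Proof.
rewrite /dotm trmx_mul mulmxA -(mulmxA a).
rewrite (mx11_scalar (p *m q^T)) mul_mx_scalar -scalemxAl mxtraceZ.
by rewrite mxtrace_scalar mulr1n mulrC.
Qed.

Lemma dotm_CS p q (a b : 'M[R]_(p, q)) :
  dotm a a = 1 -> dotm b b = 1 -> -1 <= dotm a b <= 1.
Proof.
move=> a1 b1.
have := dotm_ge0 (a + b); have := dotm_ge0 (a - b).
rewrite !(dotmBl, dotmBr, dotmDl, dotmDr) a1 b1 (dotmC b a).
by move: (dotm a b) => c h1 h2; apply/andP; split; lra.
Qed.

Lemma householder n (a b : 'cV[R]_n) : dotm a a = 1 -> dotm b b = 1 ->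
  exists H : 'M[R]_n, [/\ H^T = H, H *m H = 1%:M, H *m a = b,
    forall c : 'cV[R]_n, dotm c a = dotm c b -> H *m c = c
  & forall i j, i != j -> a i 0 = 0 -> b i 0 = 0 -> H i j = 0].
Proof.
move=> a1 b1; pose d := a - b; pose t := 2 / dotm d d.
pose H := 1%:M - t *: (d *m d^T).
have Hc (c : 'cV_n) : H *m c = c - (t * dotm d c) *: d.
  rewrite mulmxBl mul1mx -scalemxAl -mulmxA (mx11_scalar (d^T *m c)).
  rewrite mul_mx_scalar scalerA; congr (_ - (_ * _) *: _).
  by rewrite dotmC /dotm mxtrace_mulC trace_mx11.
exists H; split.
- by rewrite /H linearB /= trmx1 linearZ /= trmx_mul trmxK.
- have DD : (d *m d^T) *m (d *m d^T) = dotm d d *: (d *m d^T).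
    rewrite -mulmxA (mulmxA d^T) (mx11_scalar (d^T *m d)) mul_scalar_mx.
    by rewrite -scalemxAr -trace_mx11 mxtrace_mulC.
  have ttd : t * (t * dotm d d) = t + t.
    have [d0|d0] := eqVneq (dotm d d) 0; first by rewrite /t d0 invr0 !mulr0 addr0.
    by rewrite [t * dotm d d]divfK// mulr_natr mulr2n.
  rewrite /H mulmxBl mul1mx -scalemxAl mulmxBr mulmx1 -scalemxAr DD !scalerA.
  by rewrite scalerBr scalerA ttd scalerDl opprB addrK subrK.
- rewrite Hc; have [d0|d0] := eqVneq d 0.
    by rewrite d0 scaler0 subr0; apply/eqP; rewrite -subr_eq0 -/d d0.
  have dd : dotm d d = 2 * dotm d a.
    by rewrite !(dotmBl, dotmBr) a1 b1 (dotmC b a); ring.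
  have dd0 : dotm d d != 0 by rewrite dotm_eq0.
  rewrite /t mulrAC -dd divff// scale1r /d opprB addrC subrK //.
- by move=> c h; rewrite Hc dotmC dotmBr h subrr mulr0 scale0r subr0.
- move=> i j ij ai bi; rewrite /H !mxE (negbTE ij) big_ord1 !mxE ai bi.
  by rewrite subrr mul0r mulr0 subrr.
Qed.

End Standard.

Section Charts.
Context {R : realType}.

Lemma row_pad n m q (x : 'M[R]_(n, q)) (i : 'I_m) :
  row i (pad m x) = if insub (val i) is Some i' then row i' x else 0.
Proof.
apply/matrixP => a b; rewrite !mxE; case: insubP => [i' _ _|_] /=; by rewrite mxE.
Qed.

Lemma row_pad0 n m q (x : 'M[R]_(n, q)) (i : 'I_m) :
  (n <= i)%N -> row i (pad m x) = 0.
Proof. by move=> ni; rewrite row_pad insubF // ltnNge ni. Qed.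

Lemma pad0 n m q : pad m (0 : 'M[R]_(n, q)) = 0.
Proof.
by apply/matrixP => i j; rewrite !mxE; case: insub => [k|//]; rewrite mxE.
Qed.

Lemma padM n m q d (x : 'M[R]_(n, d)) (B : 'M[R]_(d, q)) :
  pad m (x *m B) = pad m x *m B.
Proof.
apply/row_matrixP => i; rewrite row_mul !row_pad.
by case: insub => [k|]; rewrite ?row_mul ?mul0mx.
Qed.

Lemma padZ n m q a (x : 'M[R]_(n, q)) : pad m (a *: x) = a *: pad m x.
Proof.
apply/row_matrixP => i; rewrite linearZ /= !row_pad.
by case: insub => [k|]; rewrite ?linearZ ?scaler0.
Qed.

Lemma pad_sub n m q d (x : 'M[R]_(n, q)) (B : 'M[R]_(d, q)) :
  (x <= B)%MS -> (pad m x <= B)%MS.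
Proof.
move=> xB; apply/row_subP => i; rewrite row_pad.
by case: insub => [k|]; rewrite ?sub0mx// (submx_trans (row_sub _ _)).
Qed.

Lemma padK n m q (x : 'M[R]_(m, q)) :
  (forall i : 'I_m, (n <= i)%N -> row i x = 0) -> pad m (pad n x) = x.
Proof.
move=> h; apply/row_matrixP => i; rewrite row_pad.
case: insubP => [k kn ki|]; last by rewrite -leqNgt => /h ->.
by rewrite row_pad ki insubT //= => im; congr row; apply: val_inj.
Qed.

Lemma dotm_col_mx n p q (x y : 'M[R]_(n, q)) (z w : 'M[R]_(p, q)) :
  dotm (col_mx x z) (col_mx y w) = dotm x y + dotm z w.
Proof. by rewrite /dotm tr_col_mx mul_col_row mxtrace_block. Qed.

Lemma dotm_pad n m q (x : 'M[R]_(n, q)) :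
  (n <= m)%N -> dotm (pad m x) (pad m x) = dotm x x.
Proof.
move=> nm; rewrite -(subnKC nm); set p := (m - n)%N.
have -> : pad (n + p) x = col_mx x 0.
  apply/row_matrixP => i; case: (split_ordP i) => j ->.
    by rewrite rowKu row_pad insubT //= => h; congr row; apply: val_inj.
  by rewrite rowKd linear0 row_pad0 //= leq_addr.
by rewrite dotm_col_mx [dotm 0 _]dotmE big1 ?addr0// => i _; rewrite big1// => j _;
  rewrite mxE mul0r.
Qed.

Lemma row0_col_mx n q (a : 'rV[R]_q) (b : 'M[R]_(n, q)) :
  row 0 (col_mx a b : 'M[R]_(n.+1, q)) = a.
Proof.
have -> : (0 : 'I_n.+1) = lshift n (0 : 'I_1) by apply: val_inj.
exact: etrans (@rowKu _ 1 n q 0 a b) (row_id _ _).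
Qed.

Lemma col_mx_neq0 n q (a : 'rV[R]_q) (b : 'M[R]_(n, q)) :
  a != 0 -> (col_mx a b : 'M[R]_(n.+1, q)) != 0.
Proof.
by apply: contra => /eqP h; rewrite -(row0_col_mx a b) h linear0.
Qed.

Lemma qe0_neq0 : (qe 0 : 'rV[R]_4) != 0.
Proof. by rewrite -dotm_eq0 dotm_qe0 oner_eq0. Qed.

Lemma orth_neq0 n q (Q : 'M[R]_n) (x : 'M[R]_(n, q)) :
  Q^T *m Q = 1%:M -> x != 0 -> Q *m x != 0.
Proof. by move=> h; rewrite -!dotm_eq0 dotm_orth. Qed.

Lemma adapted_supp m n q (Q : 'M[R]_m.+1) (x : 'M[R]_(m.+1, q)) :
  adapted n Q -> (forall i : 'I_m.+1, (n < i)%N -> row i x = 0) ->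
  forall i : 'I_m.+1, (n < i)%N -> row i (Q *m x) = 0.
Proof.
move=> [_ h] hx i ni; apply/matrixP => a b; rewrite !mxE big1// => j _.
have [jn|nj] := leqP j n; first by rewrite h// mul0r.
by move/matrixP/(_ 0 b): (hx j nj); rewrite !mxE => ->; rewrite mulr0.
Qed.

Lemma supp_col_mx m n q (a : 'rV[R]_q) (x : 'M[R]_(n, q)) (i : 'I_m.+1) :
  (n < i)%N -> row i (col_mx a (pad m x) : 'M[R]_(m.+1, q)) = 0.
Proof.
case: (unliftP 0 i) => [j ->|->] //; rewrite lift0 ltnS => nj.
have -> : lift 0 j = rshift 1 j :> 'I_(1 + m) by apply: val_inj.
exact: etrans (@rowKd _ 1 m q j a (pad m x)) (row_pad0 _ nj).
Qed.

Lemma unitize_sub p q d (x : 'M[R]_(p, q)) (B : 'M[R]_(d, q)) :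
  (x <= B)%MS -> (unitize x <= B)%MS.
Proof. exact: scalemx_sub. Qed.

Lemma hlift_norm m (Q : 'M[R]_m.+1) y :
  Q^T *m Q = 1%:M -> dotm (hlift Q y) (hlift Q y) = 1.
Proof.
by move=> h; rewrite unitize_norm // orth_neq0 // col_mx_neq0 // qe0_neq0.
Qed.

Lemma proj_par_subproof m d (B : 'M[R]_(d, 4)) n (Q : 'M[R]_m.+1)
    (y : 'M[R]_(n, 4)) :
  (qe 0 <= B)%MS -> adapted n Q -> (y <= B)%MS ->
  proj_subspace B n (hpar Q (mxvec (pad m y))).
Proof.
move=> B1 hQ yB; exists (hlift Q (mxvec (pad m y))); split => //.
- by rewrite hlift_norm//; case: hQ.
- apply/unitize_sub/mulmx_sub; rewrite mxvecK.
  by rewrite (@col_mx_sub _ 1 m) B1 pad_sub.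
- move=> i ni; rewrite /hlift /unitize linearZ /= mxvecK.
  by rewrite (adapted_supp hQ)// ?scaler0// => j nj; rewrite supp_col_mx.
Qed.

Definition qinv (q : 'rV[R]_4) := (dotm q q)^-1 *: qconj q.

Lemma qmulV (q : 'rV[R]_4) : q != 0 -> qmul q (qinv q) = qe 0.
Proof.
by move=> q0; rewrite /qinv qmulZr qmul_conj scalerA mulVf ?scale1r// dotm_eq0.
Qed.

Lemma row_e0 n q (x : 'M[R]_(n, q)) i :
  (delta_mx i 0 : 'cV[R]_n)^T *m x = row i x.
Proof. by rewrite trmx_delta -rowE. Qed.

Lemma dotm_delta n (i j : 'I_n) :
  dotm (delta_mx i 0 : 'cV[R]_n) (delta_mx j 0) = (i == j)%:R.
Proof.
rewrite /dotm trmx_delta mxtrace_mulC trace_mx11 -rowE !mxE eqxx andbT.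
by rewrite eq_sym.
Qed.

Lemma householder_adapted m n (a b : 'cV[R]_m.+1) (H : 'M[R]_m.+1) :
  (forall i j, i != j -> a i 0 = 0 -> b i 0 = 0 -> H i j = 0) ->
  (forall i : 'I_m.+1, (n < i)%N -> a i 0 = 0) ->
  (forall i : 'I_m.+1, (n < i)%N -> b i 0 = 0) ->
  H^T = H -> H *m H = 1%:M -> adapted n H.
Proof.
move=> h ha hb hT hH; split; first by rewrite hT.
move=> i j jn ni; apply: h; [|exact: ha|exact: hb].
by apply: contraTN ni => /eqP ->; rewrite -leqNgt.
Qed.

Lemma delta_supp m n (i j : 'I_m.+1) :
  (j <= n)%N -> (n < i)%N -> (delta_mx j 0 : 'cV[R]_m.+1) i 0 = 0.
Proof.
move=> jn ni; rewrite mxE andbT; case: eqP => // ij.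
by move: ni; rewrite ij ltnNge jn.
Qed.

Lemma qmul0p (q : 'rV[R]_4) : qmul 0 q = 0.
Proof. by apply: quatP; rewrite qmulEs !mxE; ring. Qed.

Lemma proj_cover_subproof m d (B : 'M[R]_(d, 4)) n (A : set 'M[R]_(m.+1, 4)) :
  (forall p q : 'rV[R]_4, (p <= B)%MS -> (q <= B)%MS ->
     (qmul p (qconj q) <= B)%MS) ->
  proj_subspace B n A ->
  exists2 Q : 'M[R]_m.+1, adapted n Q &
  exists2 y : 'M[R]_(n, 4), (y <= B)%MS & A = hpar Q (mxvec (pad m y)).
Proof.
move=> Bdiv [x [x1 xB xs ->]].
have [j xj] : exists j, row j x != 0.
  apply: contrapT => /forallNP h.
  have : x = 0.
    by apply/row_matrixP => i; rewrite linear0; apply/eqP/negPn/negP/h.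
  by move=> x0; move: x1; rewrite x0 /dotm mul0mx mxtrace0 => /eqP; rewrite eq_sym oner_eq0.
have jn : (j <= n)%N by rewrite leqNgt; apply: contra xj => /xs ->.
have [|| H [HT HH He _ H0]] := @householder R _ (delta_mx 0 0) (delta_mx j 0).
- by rewrite dotm_delta eqxx.
- by rewrite dotm_delta eqxx.
have Ha : adapted n H.
  by apply: (householder_adapted H0) => // i; apply: delta_supp.
have w0 : row 0 (H *m x) = row j x.
  by rewrite -(row_e0 (H *m x)) mulmxA -{1}HT -trmx_mul He row_e0.
pose q := qinv (row j x).
have q0 : q != 0.
  apply/eqP => q0; have := qmulV xj; rewrite -/q q0 -[0 : 'rV_4](scale0r (qe 0)).
  by rewrite qmulZr scale0r => /esym/eqP; apply/negP/qe0_neq0.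
pose y := rscale (H *m x) q.
have y0 : row 0 y = qe 0 by rewrite row_rscale w0 qmulV.
have yB : (y <= B)%MS.
  apply/row_subP => i; rewrite row_rscale qmulZr scalemx_sub//.
  by apply: Bdiv; rewrite (submx_trans (row_sub _ _))// mulmx_sub.
pose z := dsubmx (y : 'M[R]_(1 + m, 4)).
have uy : usubmx (y : 'M[R]_(1 + m, 4)) = qe 0.
  rewrite -y0; apply/matrixP => i s; rewrite [LHS]mxE [RHS]mxE ord1.
  by congr (y _ _); apply: val_inj.
have yz : col_mx (qe 0) z = y by rewrite -uy; exact: vsubmxK.
have rz i : row i z = row (lift 0 i) y.
  by apply/rowP => s; rewrite 2![LHS]mxE [RHS]mxE; congr (y _ _); apply: val_inj.
exists H => //; exists (pad n z).
  by apply: pad_sub; apply/row_subP => i; rewrite rz (submx_trans (row_sub _ _)).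
rewrite /hpar /hlift padK; last first.
  move=> i ni; rewrite rz row_rscale (adapted_supp Ha xs); last by rewrite lift0 ltnS.
  exact: qmul0p.
rewrite mxvecK yz -rscaleMl mulmxA HH mul1mx.
rewrite /unitize -rscaleZr hline_rscale//.
have -> : dotm (rscale x q) (rscale x q) = dotm q q by rewrite rscale_norm x1 mul1r.
exact: unitize_norm.
Qed.
Lemma dotm0l p q (x : 'M[R]_(p, q)) : dotm 0 x = 0.
Proof. by rewrite /dotm mul0mx mxtrace0. Qed.

Lemma acos_le (x y : R) : -1 <= x <= 1 -> -1 <= y <= 1 -> x <= y ->
  acos y <= acos x.
Proof.
move=> hx hy; rewrite !leNgt; apply: contra => h.
have I z : -1 <= z <= 1 -> acos z \in `[0, pi].
  by move=> hz; rewrite in_itv /= acos_ge0 ?acos_lepi.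
by move: h; rewrite -ltr_cos ?I// !acosK// in_itv.
Qed.

Lemma rscale_real n (a : 'cV[R]_n) q : rscale (a *m qe 0) q = a *m q.
Proof.
rewrite rscaleMl; congr (_ *m _); apply/row_matrixP => i.
by rewrite row_rscale !ord1 !row_id qmul1p.
Qed.

Lemma qdist_real n (a b : 'cV[R]_n) : dotm a a = 1 -> dotm b b = 1 ->
  qdist (hline (a *m qe 0)) (hline (b *m qe 0)) = acos `|dotm a b|.
Proof.
move=> a1 b1; rewrite /qdist; set E := [set t | _].
have c1 : -1 <= dotm a b <= 1 by exact: dotm_CS.
have lbE : lbound E (acos `|dotm a b|).
  move=> t [x [y [[p p1 ->] [q q1 ->] ->]]].
  rewrite !rscale_real dotm_mul_qe0.
  have pq : -1 <= dotm p q <= 1 by exact: dotm_CS.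
  have cpq : `|dotm a b * dotm p q| <= `|dotm a b|.
    by rewrite normrM ler_piMr// ler_norml.
  have c2 : `|dotm a b| <= 1 by rewrite ler_norml.
  apply: acos_le.
  - by rewrite -ler_norml (le_trans cpq).
  - by rewrite -ler_norml normr_id.
  - exact: le_trans (ler_norm _) cpq.
have inE : E (acos `|dotm a b|).
  exists (a *m qe 0), (b *m ((-1) ^+ (dotm a b < 0)%R *: qe 0)); split.
  - by exists (qe 0); rewrite ?dotm_qe0// rscale_real.
  - exists ((-1) ^+ (dotm a b < 0)%R *: qe 0); last by rewrite rscale_real.
    by rewrite dotmZl dotmZr dotm_qe0 mulr1 -expr2 sqrr_sign.
  - by rewrite dotm_mul_qe0 dotmZr dotm_qe0 mulr1 mulrC -normrEsign.
apply/eqP; rewrite eq_le; apply/andP; split.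
  by apply: ge_inf => //; exists (acos `|dotm a b|).
by apply: lb_le_inf => //; exists (acos `|dotm a b|).
Qed.

Lemma unitize_orth n q (Q : 'M[R]_n) (x : 'M[R]_(n, q)) :
  Q^T *m Q = 1%:M -> unitize (Q *m x) = Q *m unitize x.
Proof. by move=> h; rewrite /unitize dotm_orth// scalemxAr. Qed.

Lemma unitize_real n (x : 'cV[R]_n) :
  unitize (x *m qe 0) = unitize x *m qe 0.
Proof. by rewrite /unitize dotm_mul_qe0 dotm_qe0 mulr1 scalemxAl. Qed.

(* Real affine coordinates (1, c). *)
Definition raff n (c : 'cV[R]_n) : 'cV[R]_n.+1 := col_mx (1%:M : 'M[R]_1) c.

Lemma raff_norm n (c d : 'cV[R]_n) : dotm (raff c) (raff d) = 1 + dotm c d.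
Proof.
transitivity (dotm (1%:M : 'M[R]_1) 1%:M + dotm c d).
  exact: (dotm_col_mx (1%:M : 'M[R]_1) 1%:M c d).
congr (_ + _); by rewrite /dotm trmx1 mulmx1 mxtrace_scalar.
Qed.

Lemma raff_neq0 n (c : 'cV[R]_n) : raff c != 0.
Proof.
by rewrite -dotm_eq0 raff_norm gt_eqF// ltr_pwDl// dotm_ge0.
Qed.

Lemma raffS n (c : 'cV[R]_n) j : raff c (lift 0 j) 0 = c j 0.
Proof.
have -> : lift 0 j = rshift 1 j :> 'I_(1 + n) by apply: val_inj.
exact: (@col_mxEd _ 1 n 1).
Qed.

Lemma raff00 n (c : 'cV[R]_n) : raff c 0 0 = 1.
Proof.
have -> : (0 : 'I_n.+1) = lshift n (0 : 'I_1) by apply: val_inj.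
by apply: etrans (@col_mxEu _ 1 n 1 1%:M c 0 0) _; rewrite mxE.
Qed.

Lemma raff0 n : raff (0 : 'cV[R]_n) = delta_mx 0 0.
Proof.
apply/colP => i; rewrite [RHS]mxE andbT.
by case: (unliftP 0 i) => [j ->|->]; rewrite ?raffS ?raff00 ?mxE.
Qed.

Lemma raffE n (c : 'cV[R]_n) :
  col_mx (qe 0) (c *m qe 0) = raff c *m qe 0 :> 'M[R]_(n.+1, 4).
Proof. by rewrite (@mul_col_mx _ 1 n) mul1mx. Qed.

Lemma hlift_real m (Q : 'M[R]_m.+1) (c : 'cV[R]_m) :
  hlift Q (mxvec (c *m qe 0)) = unitize (Q *m raff c) *m qe 0.
Proof. by rewrite /hlift mxvecK raffE mulmxA unitize_real. Qed.

Lemma sub_qe0 n (y : 'M[R]_(n, 4)) :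
  (y <= (qe 0 : 'rV[R]_4))%MS -> exists a : 'cV[R]_n, y = a *m qe 0.
Proof. by move=> /submxP [a ->]; exists a. Qed.

Lemma real_supp m n (a : 'cV[R]_m.+1) :
  (forall i : 'I_m.+1, (n < i)%N -> row i (a *m qe 0) = 0) ->
  forall i : 'I_m.+1, (n < i)%N -> a i 0 = 0.
Proof.
move=> h i ni; move/rowP/(_ (inord 0)): (h i ni).
by rewrite mxE [LHS]mxE big_ord1 qeE//= mulr1 mxE.
Qed.

Lemma adaptedM m n (P Q : 'M[R]_m.+1) :
  adapted n P -> adapted n Q -> adapted n (P *m Q).
Proof.
move=> [oP hP] [oQ hQ]; split.
  by rewrite trmx_mul mulmxA -(mulmxA Q^T) oP mulmx1.
move=> i j jn ni; rewrite mxE big1// => s _.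
have [sn|ns] := leqP s n; first by rewrite hP// mul0r.
by rewrite hQ// mulr0.
Qed.

Definition sphere_lift m k (Q : 'M[R]_m.+1) (v : 'rV[R]_k) : 'cV[R]_m.+1 :=
  unitize (Q *m raff (pad m v^T)).

Lemma sphere_par_subproof m k (Q : 'M[R]_m.+1) (v : 'rV[R]_k) :
  adapted k Q -> sphere k (sphere_lift Q v).
Proof.
move=> hQ; split; first by rewrite unitize_norm // orth_neq0 ?raff_neq0//; case: hQ.
move=> i ki; rewrite mxE.
have -> : (Q *m raff (pad m v^T)) i 0 = row i (Q *m raff (pad m v^T)) 0 0 by rewrite [RHS]mxE.
rewrite (adapted_supp hQ) ?ki//; last by move=> j kj; exact: supp_col_mx.
by rewrite mxE mulr0.
Qed.

Lemma sphere_cover_subproof m k (x : 'cV[R]_m.+1) : sphere k x ->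
  exists2 Q : 'M[R]_m.+1, adapted k Q & sphere_lift Q (0 : 'rV[R]_k) = x.
Proof.
move=> [x1 xs].
have [|//|H [HT HH He _ H0]] := @householder R _ (delta_mx 0 0) x.
  by rewrite dotm_delta eqxx.
exists H; last by rewrite /sphere_lift trmx0 pad0 raff0 He unitize_id.
by apply: (householder_adapted H0) => // i; apply: delta_supp.
Qed.

Definition geodesic_loc m k (r : R) (v : 'rV[R]_k) : 'rV[R]_(m * 4) :=
  mxvec (pad m ((tan r *: unitize (raff v^T)) *m qe 0)).

Lemma hline_real0 m (Q : 'M[R]_m.+1) : Q^T *m Q = 1%:M ->
  hpar Q 0 = hline ((Q *m delta_mx 0 0) *m qe 0).
Proof.
move=> oQ; have -> : 0 = mxvec ((0 : 'cV_m) *m qe 0) :> 'rV[R]_(m * 4).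
  by rewrite mul0mx linear0.
rewrite /hpar hlift_real raff0 unitize_orth// unitize_id//.
by rewrite dotm_delta eqxx.
Qed.

Lemma geodesic_par_subproof m k (P : set 'M[R]_(m.+1, 4)) r (Q : 'M[R]_m.+1)
    (v : 'rV[R]_k) :
  (k < m)%N -> 0 < r < pi / 2 -> adapted k.+1 Q -> hpar Q 0 = P ->
  geodesic_sphere k P r (hpar Q (geodesic_loc m r v)).
Proof.
move=> km /andP[r0 rpi] hQ <-; have oQ : Q^T *m Q = 1%:M by case: hQ.
split; first by apply: proj_par_subproof => //; apply: submxMl.
have cr : 0 < cos r.
  by rewrite cos_gt0_pihalf// rpi andbT (lt_trans _ r0)// oppr_lt0 divr_gt0// pi_gt0.
rewrite hline_real0// /geodesic_loc padM /hpar hlift_real.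
set c := pad m _.
have c2 : dotm c c = tan r ^+ 2.
  rewrite dotm_pad// dotmZl dotmZr unitize_norm ?raff_neq0// mulr1 -expr2//.
have nc : dotm (raff c) (raff c) = (cos r)^-1 ^+ 2.
  by rewrite raff_norm c2 -cos2_tan2 ?gt_eqF// exprVn.
have sc : Num.sqrt (dotm (raff c) (raff c)) = (cos r)^-1.
  by rewrite nc sqrtr_sqr gtr0_norm// invr_gt0.
rewrite unitize_orth// qdist_real.
- rewrite dotm_orth// /unitize sc invrK.
  rewrite dotmZl -raff0 raff_norm dotmC dotm0l addr0 mulr1 gtr0_norm//.
  rewrite cosK// in_itv /= ltW//= ltW// (lt_le_trans rpi)//.
  by rewrite ler_piMr ?pi_ge0// invf_le1// ler1n.
- by rewrite dotm_orth// unitize_norm ?raff_neq0.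
- by rewrite dotm_orth// dotm_delta eqxx.
Qed.

Lemma geodesic_cover_subproof m k (P A : set 'M[R]_(m.+1, 4)) r :
  (k < m)%N -> 0 < r < pi / 2 -> RPset k.+1 P ->
  geodesic_sphere k P r A ->
  exists2 Q : 'M[R]_m.+1, adapted k.+1 Q /\ hpar Q 0 = P &
    hpar Q (geodesic_loc m r (0 : 'rV[R]_k)) = A.
Proof.
move=> km /andP[r0 rpi] [p [p1 /sub_qe0[b eb] ps ->]].
move=> [[x [x1 /sub_qe0[a ea] xs ->]] d]; subst p x.
have ab0 := real_supp ps; have aa0 := real_supp xs.
have b1 : dotm b b = 1 by rewrite -p1 dotm_mul_qe0 dotm_qe0 mulr1.
have a1 : dotm a a = 1 by rewrite -x1 dotm_mul_qe0 dotm_qe0 mulr1.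
move: d; rewrite qdist_real// => d.
have cab : cos r = `|dotm a b|.
  rewrite -d acosK// in_itv /= -ler_norml normr_id ler_norml; exact: dotm_CS.
have cr : 0 < cos r.
  by rewrite cos_gt0_pihalf// rpi andbT (lt_trans _ r0)// oppr_lt0 divr_gt0// pi_gt0.
have sr : 0 < sin r by rewrite sin_gt0_pihalf// r0.
pose s : R := (-1) ^+ (dotm a b < 0)%R.
have ss : s * s = 1 by rewrite -expr2 sqrr_sign.
pose w := (sin r)^-1 *: (s *: a - cos r *: b).
have sab : s * dotm a b = cos r by rewrite cab normrEsign.
have wb : dotm w b = 0.
  by rewrite dotmZl dotmBl !dotmZl b1 mulr1 sab subrr mulr0.
have w1 : dotm w w = 1.
  have swa : s * dotm w a = sin r.
    rewrite dotmZl dotmBl !dotmZl a1 mulr1 (dotmC b).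
    have -> : s * ((sin r)^-1 * (s - cos r * dotm a b)) =
      (sin r)^-1 * (s * s - cos r * (s * dotm a b)) by ring.
    rewrite ss sab -expr2 -sin2cos2 expr2 mulKf//.
    by rewrite gt_eqF.
  rewrite {2}/w dotmZr dotmBr !dotmZr wb mulr0 subr0 swa mulVf//.
  by rewrite gt_eqF.
have e01 : dotm (delta_mx 0 0 : 'cV[R]_m.+1) (delta_mx 0 0) = 1.
  by rewrite dotm_delta eqxx.
have [//|//|H1 [T1 I1 E1 _ Z1]] := @householder R _ (delta_mx 0 0) b.
have A1 : adapted k.+1 H1.
  by apply: (householder_adapted Z1) => // i; apply: delta_supp.
have O1 : H1^T *m H1 = 1%:M by case: A1.
have m1 : (1 < m.+1)%N by rewrite ltnS (leq_trans _ km).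
pose o1 : 'I_m.+1 := Ordinal m1.
have [||H2 [T2 I2 E2 F2 Z2]] := @householder R _ (delta_mx o1 0) (H1 *m w).
- by rewrite dotm_delta eqxx.
- by rewrite dotm_orth.
have ws : forall i : 'I_m.+1, (k.+1 < i)%N -> row i w = 0.
  move=> i ki; apply/rowP => j; rewrite !ord1 !mxE aa0// ab0//.
  by rewrite !mulr0 subrr mulr0.
have A2 : adapted k.+1 H2.
  apply: (householder_adapted Z2) => // i ki; first by apply: delta_supp ki; rewrite /= ltnS.
  by move/rowP/(_ 0): (adapted_supp A1 ws ki); rewrite mxE [RHS]mxE.
have e0 : H2 *m delta_mx 0 0 = delta_mx 0 0 :> 'cV[R]_m.+1.
  apply: F2; rewrite dotm_delta.
  have -> : (0 == o1) = false by [].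
  have -> : delta_mx 0 0 = H1 *m b :> 'cV[R]_m.+1 by rewrite -E1 mulmxA I1 mul1mx.
  by rewrite dotm_orth// dotmC wb.
have AQ := adaptedM A1 A2; set Q := H1 *m H2 in AQ *.
have oQ : Q^T *m Q = 1%:M by case: AQ.
have Q0 : Q *m delta_mx 0 0 = b by rewrite -mulmxA e0 E1.
have Q1 : Q *m delta_mx o1 0 = w by rewrite -mulmxA E2 mulmxA I1 mul1mx.
exists Q; first by split => //; rewrite hline_real0// Q0.
rewrite /geodesic_loc padM /hpar hlift_real trmx0 raff0.
rewrite (@unitize_id _ _ _ (delta_mx 0 0)); last first.
  by rewrite dotm_delta eqxx.
have -> : raff (pad m (tan r *: (delta_mx 0 0 : 'cV_k.+1))) =
          delta_mx 0 0 + tan r *: delta_mx o1 0.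
  rewrite padZ; apply/colP => i; rewrite [RHS]mxE [X in _ = X + _]mxE.
  rewrite [X in _ = _ + X]mxE andbT.
  case: (unliftP 0 i) => [j ->|->].
    rewrite raffS [LHS]mxE add0r mxE; congr (_ * _).
    rewrite mxE andbT; case: insubP => [j' _ jj|] /=.
      by rewrite mxE andbT -!val_eqE /= /bump /= add1n eqSS jj.
    by rewrite -leqNgt -val_eqE /= /bump /= add1n eqSS; case: (val j).
  by rewrite raff00 mxE mulr0 addr0.
rewrite mulmxDr -scalemxAr Q0 Q1.
have -> : b + tan r *: w = (cos r)^-1 *: (s *: a).
  rewrite /w scalerA /tan mulrAC divff ?gt_eqF// mul1r scalerBr [_ *: (cos r *: b)]scalerA.
  by rewrite mulVf ?gt_eqF// scale1r addrC subrK.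
rewrite unitizeZ ?invr_gt0// unitize_id; last by rewrite dotmZl dotmZr a1 mulr1.
have -> : (s *: a) *m qe 0 = rscale (a *m qe 0) (s *: qe 0).
  by rewrite rscale_real -scalemxAr scalemxAl.
by rewrite hline_rscale// dotmZl dotmZr dotm_qe0 mulr1.
Qed.

End Charts.

Section Immersions.
Context {R : realType}.

Definition proj_immersion m d (B : 'M[R]_(d, 4)) n k
    (C : 'rV[R]_k -> 'M[R]_(n, 4)) (B1 : (qe 0 <= B)%MS)
    (Bdiv : forall p q : 'rV[R]_4, (p <= B)%MS -> (q <= B)%MS ->
      (qmul p (qconj q) <= B)%MS)
    (CB : forall v, (C v <= B)%MS)
    (Csurj : forall y : 'M[R]_(n, 4), (y <= B)%MS -> exists v, C v = y) :
  immersion R m k.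
Proof.
refine (@Immersion R m k {A : set 'M[R]_(m.+1, 4) | proj_subspace B n A}
  {Q : 'M[R]_m.+1 | adapted n Q}
  (fun Q v => exist _ (hpar (sval Q) (mxvec (pad m (C v))))
    (proj_par_subproof B1 (svalP Q) (CB v)))
  sval sval (fun _ v => mxvec (pad m (C v)))
  (fun Q => proj1 (svalP Q)) _ (fun _ _ => erefl)).
abstract (move=> [A hA];
  have [Q hQ [y /Csurj [v Cv] AE]] := proj_cover_subproof Bdiv hA;
  exists (exist _ Q hQ), v; apply: eq_exist => /=; by rewrite Cv).
Defined.

Lemma sub_cplx u (p : 'rV[R]_4) :
  (p <= (col_mx (qe 0) u : 'M[R]_(2, 4)))%MS ->
  exists a b, p = a *: qe 0 + b *: u.
Proof.
move=> /submxP [D ->]; pose D' : 'M[R]_(1, 1 + 1) := D.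
exists (lsubmx D' 0 0), (rsubmx D' 0 0).
transitivity (row_mx (lsubmx D') (rsubmx D') *m col_mx (qe 0) u).
  by rewrite hsubmxK.
by rewrite mul_row_col {1}(mx11_scalar (lsubmx D')) {1}(mx11_scalar (rsubmx D'))
  !mul_scalar_mx.
Qed.

Lemma cplx_sub u a b :
  ((a *: qe 0 + b *: u)%R <= (col_mx (qe 0) u : 'M[R]_(2, 4)))%MS.
Proof.
apply/submxP; exists (row_mx a%:M b%:M : 'M[R]_(1, 1 + 1)).
by rewrite (@mul_row_col _ 1 1 1) !mul_scalar_mx.
Qed.

Lemma cplx_div u (p q : 'rV[R]_4) : imaginary_unit u ->
  (p <= (col_mx (qe 0) u : 'M[R]_(2, 4)))%MS ->
  (q <= (col_mx (qe 0) u : 'M[R]_(2, 4)))%MS ->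
  (qmul p (qconj q) <= (col_mx (qe 0) u : 'M[R]_(2, 4)))%MS.
Proof.
move=> [u0]; rewrite dotm4 u0 => u1 /sub_cplx [a [b ->]] /sub_cplx [c [d ->]].
suff -> : qmul (a *: qe 0 + b *: u) (qconj (c *: qe 0 + d *: u)) =
    (a * c + b * d) *: qe 0 + (b * c - a * d) *: u by exact: cplx_sub.
have E (s t : R) n : (n < 4)%N -> (s *: qe 0 + t *: u) 0 (inord n) =
    s * (n == 0)%:R + t * u 0 (inord n).
  by move=> n4; rewrite mxE [X in X + _]mxE [X in _ + X]mxE qeE.
apply: quatP; rewrite qmulEs !qconjE// !E//= u0; [|ring..].
set U := (X in X = 1) in u1; transitivity (a * c + b * d * U).
  by rewrite /U; ring.
by rewrite u1; ring.
Qed.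

Lemma real_div (p q : 'rV[R]_4) :
  (p <= (qe 0 : 'rV[R]_4))%MS -> (q <= (qe 0 : 'rV[R]_4))%MS ->
  (qmul p (qconj q) <= (qe 0 : 'rV[R]_4))%MS.
Proof.
move=> /sub_rVP [a ->] /sub_rVP [b ->]; apply/sub_rVP; exists (a * b).
have E (s : R) n : (n < 4)%N ->
    (s *: qe 0 : 'rV[R]_4) 0 (inord n) = s * (n == 0)%:R.
  by move=> n4; rewrite mxE qeE.
by apply: quatP; rewrite qmulEs !qconjE// !E//=; ring.
Qed.

Lemma cplx1 u : (qe 0 <= (col_mx (qe 0) u : 'M[R]_(2, 4)))%MS.
Proof. by have := @cplx_sub u 1 0; rewrite scale0r addr0 scale1r. Qed.

(* The affine parametrizations of the three projective spaces are those of HP^m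
   restricted to K^n x {0}, in the orthonormal frames adapted to R^(n+1) x {0},
   so [loc] is a linear inclusion. *)
Definition HP_immersion m l : immersion R m (l * 4) :=
  @proj_immersion m 4 1%:M l (l * 4) (fun v => vec_mx v)
    (submx1 _) (fun _ _ _ _ => submx1 _) (fun _ => submx1 _)
    (fun y _ => ex_intro _ (mxvec y) (mxvecK y)).

Definition CP_immersion m l (u : 'rV[R]_4) (hu : imaginary_unit u) :
    immersion R m (l * 2) :=
  @proj_immersion m 2 (col_mx (qe 0) u) l (l * 2)
    (fun v => vec_mx v *m (col_mx (qe 0) u : 'M[R]_(2, 4)))
    (cplx1 u) (fun _ _ => cplx_div hu) (fun _ => submxMl _ _)
    (fun y hy => let: ex_intro D yD := submxP hy in
       ex_intro _ (mxvec D)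
         (etrans (congr1 (mulmx^~ _) (mxvecK D)) (esym yD))).

Definition RP_immersion m k : immersion R m k :=
  @proj_immersion m 1 (qe 0) k k (fun v => v^T *m qe 0)
    (submx_refl _) real_div (fun _ => submxMl _ _)
    (fun y hy => let: ex_intro a ya := sub_qe0 hy in
       ex_intro _ a^T (etrans (congr1 (mulmx^~ _) (trmxK a)) (esym ya))).

(* The composition of the double covering S^k -> RP^k with the inclusion; the
   parametrizations are the central projections of the open hemispheres. *)
Definition S_immersion m k : immersion R m k.
Proof.
refine (@Immersion R m k {x : 'cV[R]_m.+1 | sphere k x}
  {Q : 'M[R]_m.+1 | adapted k Q}
  (fun Q v => exist _ (sphere_lift (sval Q) v)
     (sphere_par_subproof v (svalP Q)))
  (fun x => hline (sval x *m qe 0))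
  sval (fun _ v => mxvec (pad m (v^T *m qe 0)))
  (fun Q => proj1 (svalP Q)) _ _).
- abstract (move=> [x hx]; have [Q hQ Qx] := sphere_cover_subproof hx;
  exists (exist _ Q hQ), 0; exact: eq_exist).
- abstract (by move=> Q v; rewrite /hpar padM hlift_real).
Defined.

(* S^k(r) about the point P of RP^(k+1). The coordinates are centred at P, where
   the points at distance r are the (1, tan r w), with w in the unit sphere of
   R^(k+1), itself parametrized by central projection of hemispheres. *)
Definition geodesic_sphere_immersion m k (P : set 'M[R]_(m.+1, 4)) (r : R)
    (hk : (k < m)%N) (hr : 0 < r < pi / 2) (hP : RPset k.+1 P) :
  immersion R m k.
Proof.
refine (@Immersion R m k {A : set 'M[R]_(m.+1, 4) | geodesic_sphere k P r A}
  {Q : 'M[R]_m.+1 | adapted k.+1 Q /\ hpar Q 0 = P}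
  (fun Q v => exist _ (hpar (sval Q) (geodesic_loc m r v))
    (geodesic_par_subproof v hk hr (proj1 (svalP Q)) (proj2 (svalP Q))))
  sval sval (fun _ v => geodesic_loc m r v)
  (fun Q => proj1 (proj1 (svalP Q))) _ (fun _ _ => erefl)).
abstract (move=> [A hA];
  have [Q hQ QA] := geodesic_cover_subproof hk hr hP hA;
  exists (exist _ Q hQ), 0; exact: eq_exist).
Defined.

End Immersions.

(* Main.v *)
(* Let p = k + d + 1. A function on a projective space of dimension k over R, C
   or H (d + 1 = 1, 2, 4), or on S^k (d = 0), lifts to a function g on
   R^p minus 0 that is homogeneous of degree 0, and Delta f = - lam f becomes
   lap g = - lam g / |x|^2. If lam < 0, comparing g with a multiple of a power
   of |x| at a maximum on the unit sphere gives g = 0. Otherwise let s >= 0 with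
   s (s + p - 2) = lam: then U = |x|^s g is harmonic and homogeneous of degree s,
   and its partial derivatives of order j are harmonic of degree s - j. By the
   same comparison, a harmonic function of degree t with 2 - p < t < 0 vanishes.
   So U is constant if s < 1. If s < 2 the first derivatives are constant; in the
   projective case U is even, so they are also odd, and U is again constant.
   Hence the first nonzero eigenvalue of - Delta is at least p - 1 = k on S^k
   (s = 1, attained by a linear form) and 2 p on the projective spaces (s = 2,
   attained by the real part of a product of two homogeneous coordinates).
   In the totally geodesic cases sigma = 0, so lambda_2(L) = 2 p - k, or 0 for
   S^k. On S^k(r) the metric is the round one times sin^2 r, and
   |sigma|^2 + k = k / tan^2 r + k = k / sin^2 r, so lambda_2(L) = 0. *)

From HB Require Import structures.
Require Import Defs.
From mathcomp Require Import all_boot all_order all_algebra.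
From mathcomp Require Import all_classical all_reals all_analysis.
From mathcomp Require Import ring lra.

Set Implicit Arguments.
Unset Strict Implicit.
Unset Printing Implicit Defensive.

Import Order.TTheory GRing.Theory Num.Theory numFieldNormedType.Exports.

Local Open Scope classical_set_scope.
Local Open Scope ring_scope.

(** * Differentiation in coordinates *)

Section Calculus.
Context {R : realType}.

(** The metric, sigma and Delta are given only through Gram matrices in coordinates, and the lower
    bounds use pointwise comparison instead of integration by parts. This is the reason for passing
    to the cone: there partial derivatives commute with the Laplacian, which is false on the
    manifold itself. The coordinate computation is made once for R, C and H. The effect of
    noncommutativity is confined to the two quadratic identities [hc_alt] and [hc_norm], which are
    verified over H on a multiplication table. They give the Christoffel symbols, hence both the
    Laplacian and the vanishing of sigma on linear inclusions, and they show that affine coordinates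
    form a Riemannian submersion from the cone up to a factor |x|^2. Charts are indexed by all
    adapted orthogonal frames, so rotated copies of one affine chart cover R^p minus 0 and the lift
    is smooth there by locality. On spheres only positive multiples of a vector represent the same
    point: the lift need not be even, half spaces replace the domain a <> 0, and the bound drops
    from s = 2 to s = 1. The comparison for second derivatives needs 2 - p < -2, that is p > 4. *)

Lemma is_derive_line (V : normedModType R) (f : V -> R) (y e : V) (c : R) :
  derivable f (y + c *: e) e ->
  is_derive c 1 (fun t : R => f (y + t *: e)) ('D_e f (y + c *: e)).
Proof.
have E : (fun h : R => h^-1 *: (f (y + (h *: (1 : R) + c) *: e) - f (y + c *: e)))
  = (fun h : R => h^-1 *: (f (h *: e + (y + c *: e)) - f (y + c *: e))).
  apply/funext => h; rewrite [h *: 1]mulr1 scalerDl.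
  by rewrite addrCA.
move=> fd; apply: DeriveDef.
  by rewrite /derivable /= E.
by rewrite /derive /= E.
Qed.

Lemma mvt_line (V : normedModType R) (f : V -> R) (y e : V) (t : R) :
  (forall c : R, `|c| <= `|t| -> derivable f (y + c *: e) e) ->
  exists2 c, `|c| <= `|t| & f (y + t *: e) - f y = t * 'D_e f (y + c *: e).
Proof.
move=> fd; pose g (s : R) := f (y + s *: e).
have gd (s : R) : `|s| <= `|t| -> is_derive s (1 : R) g ('D_e f (y + s *: e)).
  by move=> st; apply/is_derive_line/fd.
have g0 : g 0 = f y by rewrite /g scale0r addr0.
have gc (a b : R) : (forall s, s \in `[a, b]%R -> `|s| <= `|t|) ->
    {within `[a, b], continuous g}.
  move=> ab; by apply: derivable_within_continuous => s /ab/gd[].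
have [t0|/ltW t0] := leP 0 t.
  have ab s : s \in `[0, t]%R -> `|s| <= `|t|.
    by rewrite in_itv /= => /andP[s0 st]; rewrite !ger0_norm.
  have [|c ct E] := @MVT_segment _ g (fun s => 'D_e f (y + s *: e)) 0 t t0 _ (gc _ _ ab).
    by move=> s st; apply: gd; apply: ab; apply: subset_itv_oo_cc.
  by exists c; [exact: ab|rewrite -g0 E subr0 mulrC].
have ab s : s \in `[t, 0]%R -> `|s| <= `|t|.
  by rewrite in_itv /= => /andP[s0 st]; rewrite !ler0_norm// lerN2.
have [|c ct E] := @MVT_segment _ g (fun s => 'D_e f (y + s *: e)) t 0 t0 _ (gc _ _ ab).
  by move=> s st; apply: gd; apply: ab; apply: subset_itv_oo_cc.
exists c; first exact: ab.
by rewrite -g0; apply/eqP; rewrite -eqr_opp opprB E sub0r mulrN mulrC.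
Qed.

Lemma norm_rVE n (h : 'rV[R]_n) i : `|h 0 i| <= `|h|.
Proof.
rewrite [leRHS]/Num.Def.normr /= mx_normrE.
by apply: le_trans (le_bigmax _ _ (0, i)).
Qed.

Lemma norm_rV_le n (h : 'rV[R]_n) c : 0 <= c -> (forall i, `|h 0 i| <= c) -> `|h| <= c.
Proof.
move=> c0 hc; rewrite [leLHS]/Num.Def.normr /= mx_normrE.
by apply: bigmax_le => // -[i j] _ /=; rewrite ord1.
Qed.

(** [smooth] speaks only of partial derivatives, while the chain rule needs total differentiability.
    The increment is telescoped through the truncations [tr j] of h; each one-coordinate step is a
    mean value of a partial derivative close to its value at x. *)
Lemma C1_differentiable n (f : 'rV[R]_n -> R) x :
  (forall i, \forall y \near x, derivable f y (delta_mx 0 i)) ->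
  (forall i, {for x, continuous (pd f i)}) -> differentiable f x.
Proof.
move=> fd fc.
pose L (h : 'rV[R]_n) := \sum_j h 0 j * pd f j x.
have Llin : linear L.
  move=> a u v; rewrite /L -[a *: (\sum_j _)]/(a * _) mulr_sumr -big_split /=.
  by apply: eq_bigr => j _; rewrite !mxE mulrDl mulrA.
pose Lm := GRing.isLinear.Build _ _ _ _ _ Llin.
pose Ll : {linear 'rV[R]_n -> R} := HB.pack L Lm.
have Lc : continuous L.
  apply: (continuous_big (@add_continuous R^o)) => j _ y.
  apply: (@continuousM _ _ (fun h : 'rV[R]_n => h 0 j) (cst (pd f j x)));
    [exact: coord_continuous|exact: cst_continuous].
suff E : f \o shift x = cst (f x) + L +o_ 0 id.
  have dE : 'd f x = L :> ('rV[R]_n -> R) by apply: (@diff_unique _ _ _ f Ll x Lc E).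
  by apply/diff_locallyP; rewrite dE; split.
apply/eqaddoP => _/posnumP[e].
(* The n coordinate steps share the error e; the successor keeps c positive when n = 0. *)
pose c := e%:num / n.+1%:R.
have c0 : 0 < c by rewrite divr_gt0.
have near1 : \forall y \near x, forall i,
  derivable f y (delta_mx 0 i) /\ `|pd f i x - pd f i y| <= c.
  apply: (@filter_forall _ _ (fun i y => derivable f y (delta_mx 0 i) /\ `|pd f i x - pd f i y|
    <= c) (nbhs x) (nbhs_filter x)) => i; near=> y; split; first by near: y; apply: fd.
  by near: y; move/cvgrPdist_le: (fc i); apply.
have /nbhs_ballP[r /= r0 Hr] := near1.
rewrite nearE /=; apply/nbhs_ballP; exists r => // h; rewrite -ball_normE /= sub0r normrN => hr.
pose tr (j : nat) : 'rV[R]_n := \row_i (if (i < j)%N then h 0 i else 0).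
have trS (j : 'I_n) : tr j.+1 = tr j + h 0 j *: delta_mx 0 j.
  apply/rowP => i; rewrite !mxE eqxx /= ltnS leq_eqVlt -(inj_eq val_inj).
  by case: ltngtP => //= [|_|/val_inj ->]; rewrite ?(mulr0,addr0,add0r,mulr1).
have tr0 : tr 0%N = 0 by apply/rowP => i; rewrite !mxE.
have trn : tr n = h by apply/rowP => i; rewrite !mxE ltn_ord.
have step (j : 'I_n) : exists2 y, `|pd f j x - pd f j y| <= c &
    f (x + tr j.+1) - f (x + tr j) = h 0 j * pd f j y.
  have inb s : `|s| <= `|h 0 j| -> ball x r (x + tr j + s *: delta_mx 0 j).
    move=> sh; rewrite -ball_normE /=; apply: le_lt_trans hr.
    rewrite -addrA opprD addNKr normrN; apply: norm_rV_le => // i.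
    rewrite !mxE eqxx /=; case: eqP => [->|_]; rewrite ?ltnn ?add0r ?mulr1 ?mulr0 ?addr0.
      by apply: le_trans sh _; apply: norm_rVE.
    by case: ifP => _; rewrite ?normr0//; apply: norm_rVE.
  have [|s sh E] := @mvt_line _ f (x + tr j) (delta_mx 0 j) (h 0 j).
    by move=> s sh; have [] := Hr _ (inb s sh) j.
  exists (x + tr j + s *: delta_mx 0 j); first by have [] := Hr _ (inb s sh) j.
  by rewrite trS addrA E.
have tel : f (x + h) - f x = \sum_(j < n) (f (x + tr j.+1) - f (x + tr j)).
  rewrite -(big_mkord xpredT (fun j => f (x + tr j.+1) - f (x + tr j))).
  by rewrite (telescope_sumr (fun j => f (x + tr j)))// trn tr0 addr0.
have -> : (f \o shift x - (cst (f x) + L)) h = \sum_(j < n) (f (x + tr j.+1) - f (x +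
  tr j) - h 0 j * pd f j x).
  rewrite sumrB -tel /GRing.add /GRing.opp /=.
  by rewrite [h + x]addrC opprD addrA.
apply: le_trans (ler_norm_sum _ _ _) _.
apply: (@le_trans _ _ (\sum_(j < n) `|h| * c)).
  apply: ler_sum => j _; have [y yc ->] := step j.
  rewrite -mulrBr normrM distrC; apply: ler_pM => //; exact: norm_rVE.
rewrite sumr_const card_ord -mulr_natr /c -mulrA mulrC.
rewrite ler_wpM2r// -mulrA ler_piMr// mulrC ler_pdivrMr// mul1r ler_nat//.
Unshelve. all: by end_near. Qed.

Lemma pdE n (f : 'rV[R]_n -> R) i x : differentiable f x ->
  pd f i x = 'd f x (delta_mx 0 i).
Proof. by move=> fd; rewrite /pd deriveE. Qed.

Lemma deriveE_pd n (f : 'rV[R]_n -> R) x v : differentiable f x ->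
  'D_v f x = \sum_i v 0 i * pd f i x.
Proof.
move=> fd; rewrite deriveE// {1}(row_sum_delta v) linear_sum.
by apply: eq_bigr => i _; rewrite linearZ pdE.
Qed.

End Calculus.

(** * Functions of class C^n and rules for partial derivatives *)

Section Calculus2.
Context {R : realType}.

Fact dp_key : {g : forall n, ('rV[R]_n -> R) -> 'I_n -> 'rV[R]_n -> R | g = @pd R}.
Proof. by exists (@pd R). Qed.

(* Opaque copy of [pd], which keeps conversion from unfolding derivatives. *)
Definition dp n : ('rV[R]_n -> R) -> 'I_n -> 'rV[R]_n -> R := sval dp_key n.

Lemma dpE n : @dp n = @pd R n.
Proof. by rewrite /dp (svalP dp_key). Qed.

Lemma derive_dp n (f : 'rV[R]_n -> R) i x : 'D_(delta_mx 0 i) f x = dp f i x.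
Proof. by rewrite dpE. Qed.

Lemma diff_dp n (f : 'rV[R]_n -> R) i x : differentiable f x ->
  dp f i x = 'd f x (delta_mx 0 i).
Proof. by move=> fd; rewrite dpE pdE. Qed.

Lemma deriveE_dp n (f : 'rV[R]_n -> R) x v : differentiable f x ->
  'D_v f x = \sum_i v 0 i * dp f i x.
Proof. by rewrite dpE; exact: deriveE_pd. Qed.

(** The difference g - f vanishes near x, so the zero map is its differential. *)
Lemma near_eq_differentiable (V : normedModType R) (f g : V -> R) x :
  (\forall y \near x, f y = g y) -> differentiable f x -> differentiable g x.
Proof.
move=> fg fd; have -> : g = f + (g - f) by apply/funext => y; rewrite addrC subrK.
apply: differentiableD => //; set h := g - f.
have hx : \forall y \near x, h y = 0.
  by near=> y; rewrite /h /GRing.add /GRing.opp /= (near fg y)// subrr.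
have h0 : h x = 0 by exact: nbhs_singleton hx.
have E : h \o shift x = cst (h x) + (\0 : V -> R) +o_ 0 id.
  apply/eqaddoP => _/posnumP[e]; rewrite nearE /=.
  have /nbhs_ballP[r /= r0 Hr] := hx.
  apply/nbhs_ballP; exists r => // y; rewrite -!ball_normE /= sub0r normrN => yr.
  have : ball x r (y + x) by rewrite -ball_normE /= opprD addrCA subrr addr0 normrN.
  move=> /Hr hy; rewrite /GRing.add /GRing.opp /= [h _]hy h0.
  by rewrite addr0 subrr normr0 mulr_ge0.
have c0 : continuous (\0 : {linear V -> R}) by exact: cst_continuous.
have dE := diff_unique c0 E.
by apply/diff_locallyP; rewrite dE; split.
Unshelve. all: by end_near. Qed.

Section Pd.
Context {p : nat}.
Implicit Types (f g : 'rV[R]_p -> R) (x : 'rV[R]_p) (i : 'I_p).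

Lemma pd_near f g i x : (\forall y \near x, f y = g y) -> dp f i x = dp g i x.
Proof. by move=> fg; rewrite dpE; apply: near_eq_derive. Qed.

Lemma pd_cst (c : R) i x : dp (fun=> c) i x = 0.
Proof. by rewrite dpE; exact: derive_cst. Qed.

Lemma pdD f g i x : differentiable f x -> differentiable g x ->
  dp (fun y => f y + g y) i x = dp f i x + dp g i x.
Proof. by move=> fd gd; rewrite dpE /pd -deriveD//; apply: diff_derivable. Qed.

Lemma pdM f g i x : differentiable f x -> differentiable g x ->
  dp (fun y => f y * g y) i x = dp f i x * g x + f x * dp g i x.
Proof.
move=> fd gd; have := deriveM (@diff_derivable _ _ _ _ _ (delta_mx 0 i) fd) (@diff_derivable _ _
  _ _ _ (delta_mx 0 i) gd).
by rewrite dpE /pd => E; rewrite [LHS]E addrC; congr (_ + _); rewrite [LHS]mulrC.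
Qed.

Lemma pdZ f (c : R) i x : differentiable f x ->
  dp (fun y => c * f y) i x = c * dp f i x.
Proof. move=> fd; rewrite dpE; exact: (deriveZ c (@diff_derivable _ _ _ _ _ (delta_mx 0 i) fd)).
  Qed.

Lemma fun_sumE (I : Type) (r : seq I) (P : pred I) (F : I -> 'rV[R]_p -> R) :
  (fun y => \sum_(j <- r | P j) F j y) = \sum_(j <- r | P j) F j.
Proof.
apply/funext => y; elim/big_rec2 : _ => //= k a b _ ->.
by rewrite /GRing.add.
Qed.

Lemma differentiable_fsum (I : Type) (r : seq I) (P : pred I) (F : I -> 'rV[R]_p -> R) x :
  (forall j, P j -> differentiable (F j) x) ->
  differentiable (fun y => \sum_(j <- r | P j) F j y) x.
Proof.
move=> Fd; rewrite fun_sumE; elim/big_ind : _ => // g h gd hd.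
exact: differentiableD.
Qed.

Lemma pd_sum (I : Type) (r : seq I) (P : pred I) (F : I -> 'rV[R]_p -> R) i x :
  (forall j, P j -> differentiable (F j) x) ->
  dp (fun y => \sum_(j <- r | P j) F j y) i x = \sum_(j <- r | P j) dp (F j) i x.
Proof.
move=> Fd; rewrite fun_sumE.
pose K (g : 'rV[R]_p -> R) (v : R) := differentiable g x /\ dp g i x = v.
suff : K (\sum_(j <- r | P j) F j) (\sum_(j <- r | P j) dp (F j) i x) by case.
apply: (@big_ind2 _ _ K) => [|g1 v1 g2 v2 [d1 e1] [d2 e2]|j Pj].
- by split; [exact: differentiable_cst|exact: (@pd_cst 0 i x)].
- by split; [exact: differentiableD|rewrite (pdD i d1 d2) e1 e2].
- by split => //; exact: Fd.
Qed.

Lemma differentiable_coord_rV j x : differentiable (fun y : 'rV[R]_p => y 0 j) x.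
Proof. exact: differentiable_coord. Qed.

Lemma pd_coord j i x : dp (fun y => y 0 j) i x = (i == j)%:R.
Proof.
have L : linear (fun y : 'rV[R]_p => y 0 j) by move=> a u v; rewrite !mxE.
pose Lm := GRing.isLinear.Build _ _ _ _ _ L.
pose Ll : {linear 'rV[R]_p -> R} := HB.pack (fun y : 'rV[R]_p => y 0 j) Lm.
rewrite diff_dp; last exact: differentiable_coord_rV.
rewrite (@diff_lin _ _ _ Ll); last exact: coord_continuous.
by rewrite /= mxE eqxx eq_sym.
Qed.

End Pd.

(** C^n on A. Total differentiability is demanded at every level, so that products and compositions
    can be differentiated directly; the derivatives are those of f on the whole space, only examined
    at points of A. *)
Fixpoint Cr n p (A : set 'rV[R]_p) (f : 'rV[R]_p -> R) : Prop :=
  if n is n'.+1 then (forall x, A x -> differentiable f x) /\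
                     forall i, Cr n' A (dp f i)
  else forall x, A x -> {for x, continuous f}.

Lemma Cr_differentiable n p (A : set 'rV[R]_p) f x : Cr n.+1 A f -> A x -> differentiable f x.
Proof. by case=> + _; exact. Qed.

Lemma Cr_pd n p (A : set 'rV[R]_p) f i : Cr n.+1 A f -> Cr n A (dp f i).
Proof. by case=> _; exact. Qed.

Lemma Cr_continuous n p (A : set 'rV[R]_p) f x : Cr n A f -> A x -> {for x, continuous f}.
Proof. by case: n => [|n]; [exact|move=> [+ _] Ax => /(_ _ Ax)/differentiable_continuous]. Qed.

Lemma CrW n p (A : set 'rV[R]_p) f : Cr n.+1 A f -> Cr n A f.
Proof.
elim: n f => [|n IH] f; first by move=> h x Ax; exact: Cr_continuous h Ax.
by move=> [fd fp]; split => // i; apply: IH; exact: fp.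
Qed.

Lemma CrS n p (A B : set 'rV[R]_p) f : A `<=` B -> Cr n B f -> Cr n A f.
Proof.
move=> AB; elim: n f => [|n IH] f; first by move=> h x /AB; exact: h.
by move=> [fd fp]; split => [x /AB|i]; [exact: fd|apply: IH; exact: fp].
Qed.

Lemma Cr_eq n p (A : set 'rV[R]_p) f g : open A -> (forall x, A x -> f x = g x) ->
  Cr n A f -> Cr n A g.
Proof.
move=> oA; elim: n f g => [|n IH] f g fg.
  move=> fc x Ax; have nx : \forall y \near x, f y = g y.
    by apply: filterS (open_nbhs_nbhs (conj oA Ax)) => y /fg.
  have := fc x Ax; rewrite /prop_for /continuous_at -fg//.
  by move=> fcx; apply: cvg_trans fcx; exact: (@near_eq_cvg _ _ (nbhs x) (nbhs_filter x)  f g nx).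
move=> [fd fp].
have nx x : A x -> \forall y \near x, f y = g y.
  by move=> Ax; apply: filterS (open_nbhs_nbhs (conj oA Ax)) => y /fg.
split=> [x Ax|i]; first by apply: near_eq_differentiable (fd x Ax); exact: nx.
by apply: IH (fp i) => x Ax; apply: pd_near; exact: nx.
Qed.

(** Each level is a condition at single points, so the set B may change with the point. This glues
    regularity over charts. *)
Lemma Cr_local n p (A : set 'rV[R]_p) f :
  (forall x, A x -> exists B, B x /\ Cr n B f) -> Cr n A f.
Proof.
elim: n f => [|n IH] f h; first by move=> x /h [B [Bx]]; exact.
split=> [x /h [B [Bx [+ _]]]|i]; first exact.
by apply: IH => x /h [B [Bx [_ fp]]]; exists B; split => //; exact: fp.
Qed.

Lemma Cr_cst n p (A : set 'rV[R]_p) c : Cr n A (fun=> c).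
Proof.
elim: n c => [|n IH] c; first by move=> x _; exact: cst_continuous.
split=> [x _|i]; first exact: differentiable_cst.
have -> : dp (fun=> c) i = (fun=> 0) by apply/funext => x; exact: (@pd_cst p c i x).
exact: IH.
Qed.

Lemma Cr_coord n p (A : set 'rV[R]_p) j : Cr n A (fun x => x 0 j).
Proof.
case: n => [x _|n]; first exact: coord_continuous.
split=> [x _|i]; first exact: differentiable_coord_rV.
have -> : dp (fun x : 'rV[R]_p => x 0 j) i = (fun=> (i == j)%:R).
  by apply/funext => x; exact: pd_coord.
exact: Cr_cst.
Qed.

Lemma CrD n p (A : set 'rV[R]_p) f g : open A ->
  Cr n A f -> Cr n A g -> Cr n A (fun x => f x + g x).
Proof.
move=> oA; elim: n f g => [|n IH] f g.
  by move=> fc gc x Ax; apply: continuousD; [exact: fc|exact: gc].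
move=> [fd fp] [gd gp]; split=> [x Ax|i].
  by apply: differentiableD; [exact: fd|exact: gd].
apply: (@Cr_eq _ _ _ (fun x => dp f i x + dp g i x)) => //.
  by move=> x Ax; rewrite pdD//; [exact: fd|exact: gd].
by apply: IH; [exact: fp|exact: gp].
Qed.

Lemma CrM n p (A : set 'rV[R]_p) f g : open A ->
  Cr n A f -> Cr n A g -> Cr n A (fun x => f x * g x).
Proof.
move=> oA; elim: n f g => [|n IH] f g.
  by move=> fc gc x Ax; apply: continuousM; [exact: fc|exact: gc].
move=> fC gC; have [fd fp] := fC; have [gd gp] := gC; split=> [x Ax|i].
  by apply: differentiableM; [exact: fd|exact: gd].
apply: (@Cr_eq _ _ _ (fun x => dp f i x * g x + f x * dp g i x)) => //.
  by move=> x Ax; rewrite pdM//; [exact: fd|exact: gd].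
by apply: CrD => //; apply: IH; [exact: fp|exact: CrW|exact: CrW|exact: gp].
Qed.

Lemma Cr_sum n p (A : set 'rV[R]_p) (I : Type) (r : seq I) (P : pred I) (F : I -> 'rV[R]_p -> R) :
  open A -> (forall j, P j -> Cr n A (F j)) -> Cr n A (fun x => \sum_(j <- r | P j) F j x).
Proof.
move=> oA FC; elim: r => [|j r IH].
  apply: (@Cr_eq _ _ _ (fun=> 0)) => //; first by move=> x _; rewrite big_nil.
  exact: Cr_cst.
apply: (@Cr_eq _ _ _ (fun y => (if P j then F j y else 0) + \sum_(j <- r | P j) F j y)) => //.
  by move=> x _ /=; rewrite [RHS]big_cons; case: ifP; rewrite ?add0r.
by apply: CrD => //; case Pj: (P j); [exact: FC|exact: Cr_cst].
Qed.

Lemma rowE_sum (V : Type) q (phi : 'I_q -> V -> R) :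
  (fun x => \row_c phi c x) = (fun x => \sum_c phi c x *: (delta_mx 0 c : 'rV[R]_q)).
Proof.
apply/funext => x; rewrite [LHS]row_sum_delta.
by apply: eq_bigr => c _; rewrite mxE.
Qed.

Lemma differentiable_row p q (phi : 'I_q -> 'rV[R]_p -> R) x :
  (forall c, differentiable (phi c) x) -> differentiable (fun x => \row_c phi c x) x.
Proof.
move=> pd_; rewrite rowE_sum.
have -> : (fun x => \sum_c phi c x *: (delta_mx 0 c : 'rV[R]_q)) =
  \sum_c (fun x => phi c x *: (delta_mx 0 c : 'rV[R]_q)).
  by apply/funext => y; elim/big_rec2 : _ => //= k a b _ ->.
by apply: differentiable_sum => c; apply: differentiableZl.
Qed.

Lemma continuous_row p q (phi : 'I_q -> 'rV[R]_p -> R) x :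
  (forall c, {for x, continuous (phi c)}) -> {for x, continuous (fun x => \row_c phi c x)}.
Proof.
move=> pc; apply: ((@cvgrPdist_le _ _ _ (nbhs x) (nbhs_filter x) _ _).2) => e e0.
have pce c : \forall y \near x, `|phi c x - phi c y| <= e.
  by have /cvgrPdist_le := pc c; exact.
have := @filter_forall _ _ (fun c y => `|phi c x - phi c y| <= e) (nbhs x) (nbhs_filter x) pce.
by apply: filterS => y H; apply: norm_rV_le => [|c]; [exact: ltW|rewrite !mxE].
Qed.

Lemma differentiable_compr p q (g : 'rV[R]_q -> R) (phi : 'I_q -> 'rV[R]_p -> R) x :
  differentiable g (\row_c phi c x) -> (forall c, differentiable (phi c) x) ->
  differentiable (fun y => g (\row_c phi c y)) x.
Proof.
by move=> gd pd_; apply: differentiable_comp => //; exact: differentiable_row.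
Qed.

Lemma pd_comp p q (g : 'rV[R]_q -> R) (phi : 'I_q -> 'rV[R]_p -> R) i x :
  differentiable g (\row_c phi c x) -> (forall c, differentiable (phi c) x) ->
  dp (fun y => g (\row_c phi c y)) i x = \sum_c dp (phi c) i x * dp g c (\row_c phi c x).
Proof.
move=> gd pd_; have Rd := differentiable_row pd_.
rewrite diff_dp; last exact: differentiable_compr.
rewrite (@diff_comp _ _ _ _ (fun y => \row_c phi c y) g)//= -deriveE//.
rewrite -deriveE// deriveE_dp//; apply: eq_bigr => c _; congr (_ * _).
rewrite derive_mx; last exact: diff_derivable.
by rewrite mxE -derive_dp; congr ('D_ _ _ _); apply/funext => y; rewrite mxE.
Qed.

Lemma Cr_comp n p q (A : set 'rV[R]_p) (B : set 'rV[R]_q) g (phi : 'I_q -> 'rV[R]_p -> R) :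
  open A -> (forall x, A x -> B (\row_c phi c x)) ->
  Cr n B g -> (forall c, Cr n A (phi c)) -> Cr n A (fun x => g (\row_c phi c x)).
Proof.
move=> oA AB; elim: n g => [|n IH] g.
  move=> gc pc x Ax; apply: (@continuous_comp _ _ _ (fun x => \row_c phi c x) g).
    by apply: continuous_row => c; exact: pc.
  exact/gc/AB.
move=> [gd gp] pC; have pd_ c x : A x -> differentiable (phi c) x.
  by move=> Ax; exact: Cr_differentiable (pC c) Ax.
split=> [x Ax|i].
  by apply: differentiable_compr => [|c]; [exact/gd/AB|exact: pd_].
apply: (@Cr_eq _ _ _ (fun x => \sum_c dp (phi c) i x * dp g c (\row_c phi c x))) => //.
  by move=> x Ax; rewrite pd_comp// => [|c]; [exact/gd/AB|exact: pd_].
apply: Cr_sum => // c _; apply: CrM => //; first exact: Cr_pd.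
by apply: IH; [exact: gp|move=> c'; exact: CrW].
Qed.

Lemma differentiable_powR p (f : 'rV[R]_p -> R) a x : 0 < f x ->
  differentiable f x -> differentiable (fun y => f y `^ a) x.
Proof.
move=> f0 fd; have gd : differentiable (fun t : R => t `^ a) (f x).
  by apply/derivable1_diffP; case: (is_derive1_powR a f0).
exact: differentiable_comp fd gd.
Qed.

Lemma pd_powR p (f : 'rV[R]_p -> R) a i x : 0 < f x -> differentiable f x ->
  dp (fun y => f y `^ a) i x = a * f x `^ (a - 1) * dp f i x.
Proof.
move=> f0 fd; have gd : differentiable (fun t : R => t `^ a) (f x).
  by apply/derivable1_diffP; case: (is_derive1_powR a f0).
rewrite diff_dp; last exact: differentiable_powR.
have -> := diff_comp fd gd.
rewrite /= -diff_dp// diff1E// derive1E.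
by case: (is_derive1_powR a f0) => _ ->; exact: mulrC.
Qed.

Lemma Cr_powR n p (A : set 'rV[R]_p) f a : open A -> (forall x, A x -> 0 < f x) ->
  Cr n A f -> Cr n A (fun x => f x `^ a).
Proof.
move=> oA f0; elim: n a => [|n IH] a fC.
  move=> x Ax; apply: (@continuous_comp _ _ _ f (fun t : R => t `^ a)); first exact: fC.
  apply: differentiable_continuous; apply/derivable1_diffP.
  by case: (is_derive1_powR a (f0 _ Ax)).
have [fd fp] := fC; split=> [x Ax|i].
  by apply: differentiable_powR; [exact: f0|exact: fd].
apply: (@Cr_eq _ _ _ (fun x => a * f x `^ (a - 1) * dp f i x)) => //.
  by move=> x Ax; rewrite pd_powR//; [exact: f0|exact: fd].
apply: CrM => //; last exact: fp.
by apply: CrM => //; [exact: Cr_cst|apply: IH; exact: CrW].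
Qed.

Lemma smooth_dp p (f : 'rV[R]_p -> R) i : smooth f -> smooth (dp f i).
Proof. by move=> fs s; rewrite dpE; exact: (fs (i :: s)). Qed.

Lemma smooth_Cr n p (f : 'rV[R]_p -> R) : smooth f -> Cr n setT f.
Proof.
elim: n f => [|n IH] f fs; first by move=> x _; have [+ _] := fs [::]; exact.
split=> [x _|i]; last exact/IH/smooth_dp.
apply: C1_differentiable => i; last by have [+ _] := fs [:: i]; exact.
by near=> y; have [_] := fs [::]; exact.
Unshelve. all: by end_near. Qed.

Lemma Cr_smooth p (f : 'rV[R]_p -> R) : (forall n, Cr n setT f) -> smooth f.
Proof.
move=> fC s /=; suff : forall n, Cr n setT (foldl (@pd R p) f s).
  move=> /(_ 1%N) h; split => [x|i x]; first exact: Cr_continuous h _.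
  by apply: diff_derivable; exact: Cr_differentiable h _.
elim: s f fC => [|i s IH] f fC //=.
by apply: IH => n; rewrite -dpE; exact: Cr_pd (fC n.+1).
Qed.

End Calculus2.

(** * Second derivatives, their symmetry, and the Laplacian at a maximum *)

Section Calculus3.
Context {R : realType}.

Lemma mvt_line_pos (V : normedModType R) (f : V -> R) (y e : V) (t : R) : 0 < t ->
  (forall c : R, 0 <= c <= t -> derivable f (y + c *: e) e) ->
  exists2 c, 0 < c < t & f (y + t *: e) - f y = t * 'D_e f (y + c *: e).
Proof.
move=> t0 fd; pose g (s : R) := f (y + s *: e).
have gd (s : R) : 0 <= s <= t -> is_derive s (1 : R) g ('D_e f (y + s *: e)).
  by move=> st; apply/is_derive_line/fd.
have gc : {within `[0, t], continuous g}.
  by apply: derivable_within_continuous => s; rewrite in_itv /= => /gd[].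
have [|c ct E] := @MVT _ g (fun s => 'D_e f (y + s *: e)) 0 t t0 _ gc.
  by move=> s; rewrite in_itv /= => /andP[s0 st]; apply: gd; rewrite !ltW.
exists c; first by move: ct; rewrite in_itv.
by rewrite mulrC -[X in _ * X](subr0 t) -E /g scale0r addr0.
Qed.

Lemma norm_delta p (i : 'I_p) : `|delta_mx 0 i : 'rV[R]_p| <= 1.
Proof.
apply: norm_rV_le => // j; rewrite mxE eqxx /=.
by case: (j == i); rewrite ?normr1 ?normr0.
Qed.

Section Second.
Context {p : nat}.
Implicit Types (A : set 'rV[R]_p) (f : 'rV[R]_p -> R).

(** The second difference is the increment along e_i of [H], whose derivative is in turn an
    increment along e_j of [dp f i]; two mean values produce the mixed derivative. *)
Lemma second_difference A f i j x (t : R) : Cr 2 A f ->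
  (forall s s' : R, `|s| <= `|t| -> `|s'| <= `|t| ->
     A (x + s *: delta_mx 0 i + s' *: delta_mx 0 j)) ->
  exists s s' : R, [/\ `|s| <= `|t|, `|s'| <= `|t| &
    (f (x + t *: delta_mx 0 i + t *: delta_mx 0 j) - f (x + t *: delta_mx 0 i))
    - (f (x + t *: delta_mx 0 j) - f x) =
    t * (t * dp (dp f i) j (x + s *: delta_mx 0 i + s' *: delta_mx 0 j))].
Proof.
move=> fC At; have fd := Cr_differentiable fC.
have f'd := Cr_differentiable (Cr_pd i fC).
set ei := delta_mx 0 i : 'rV[R]_p; set ej := delta_mx 0 j : 'rV[R]_p.
pose H (s : R) := f (x + t *: ej + s *: ei) - f (x + s *: ei).
have A1 (s : R) : `|s| <= `|t| -> A (x + t *: ej + s *: ei).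
  by move=> st; rewrite addrAC; apply: At.
have A2 (s : R) : `|s| <= `|t| -> A (x + s *: ei).
  by move=> st; have := At s 0 st; rewrite normr0 scale0r addr0; apply.
have Hd (s : R) : `|s| <= `|t| ->
    is_derive s (1 : R) H (dp f i (x + t *: ej + s *: ei) - dp f i (x + s *: ei)).
  move=> st; have := is_derive_line (@diff_derivable _ _ _ _ _ ei (fd _ (A1 s st))).
  have := is_derive_line (@diff_derivable _ _ _ _ _ ei (fd _ (A2 s st))).
  by rewrite !derive_dp => d2 d1; exact: is_deriveB.
have [|s st] := @mvt_line _ R^o H 0 1 t.
  by move=> c ct; rewrite add0r [_ *: _]mulr1; case: (Hd c ct).
rewrite !add0r ![_ *: 1]mulr1 => E.
have [|s' st' E'] := @mvt_line _ _ (dp f i) (x + s *: ei) ej t.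
  by move=> c ct; apply: diff_derivable; apply: f'd; apply: At.
exists s, s'; split => //.
have [_ E2] := Hd s st; move: E; rewrite derive_dp in E'; rewrite E2 (addrAC x (t *: ej)) E' => <-.
by rewrite /H !scale0r !addr0 (addrAC x (t *: ej)).
Qed.

(** The second difference is symmetric in i and j, so it equals t^2 times either mixed derivative at
    points close to x. Continuity then brings the two values at x within every e. *)
Lemma pd_comm A f i j x : open A -> A x -> Cr 2 A f ->
  dp (dp f i) j x = dp (dp f j) i x.
Proof.
move=> oA Ax fC; apply/eqP; rewrite -subr_eq0 -normr_le0; apply/ler_addgt0Pl => e e0.
rewrite addr0.
have cont k l : {for x, continuous (dp (dp f k) l)}.
  by apply: Cr_continuous (Cr_pd l (Cr_pd k fC)) Ax.
have e2 : 0 < e / 2 by rewrite divr_gt0.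
have near1 : \forall y \near x, [/\ A y, `|dp (dp f i) j x - dp (dp f i) j y| <= e / 2
    & `|dp (dp f j) i x - dp (dp f j) i y| <= e / 2].
  have /cvgrPdist_le/(_ _ e2) n1 := cont i j.
  have /cvgrPdist_le/(_ _ e2) n2 := cont j i.
  have nA : nbhs x A by exact: (open_nbhs_nbhs (conj oA Ax)).
  apply: (@filterS3 _ (nbhs x) (nbhs_filter x) _ _ _ _ _ nA n1 n2) => y h1 h2 h3.
  exact: And3 h1 h2 h3.
have /nbhs_ballP[r /= r0 Hr] := near1.
(* Two successive displacements of length at most r / 3 stay in the ball of radius r. *)
pose t := r / 3.
have t0 : 0 < t by rewrite divr_gt0.
have inb k l (s s' : R) : `|s| <= `|t| -> `|s'| <= `|t| ->
    ball x r (x + s *: delta_mx 0 k + s' *: delta_mx 0 l).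
  rewrite (gtr0_norm t0) => st st'; rewrite -ball_normE /=.
  rewrite -addrA opprD addNKr normrN; apply: le_lt_trans (ler_normD _ _) _.
  have d (u : R) m : `|u| <= t -> `|u *: (delta_mx 0 m : 'rV[R]_p)| <= t.
    move=> ut; rewrite normrZ; apply: le_trans ut.
    by rewrite ler_piMr// norm_delta.
  by apply: le_lt_trans (lerD (d _ _ st) (d _ _ st')) _; rewrite /t; lra.
have [|s1 [s2 [h1 h2 E1]]] := @second_difference A f i j x t fC.
  by move=> s s' st st'; have [] := Hr _ (inb i j s s' st st').
have [|s3 [s4 [h3 h4 E2]]] := @second_difference A f j i x t fC.
  by move=> s s' st st'; have [] := Hr _ (inb j i s s' st st').
have [_ b1 _] := Hr _ (inb i j _ _ h1 h2).
have [_ _ b2] := Hr _ (inb j i _ _ h3 h4).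
move: b1 b2 E1 E2; rewrite (addrAC x (t *: delta_mx 0 j)).
move: (dp (dp f i) j (x + s1 *: delta_mx 0 i + s2 *: delta_mx 0 j)).
move: (dp (dp f j) i (x + s3 *: delta_mx 0 j + s4 *: delta_mx 0 i)).
move: (dp (dp f i) j x) (dp (dp f j) i x).
move: (f (x + t *: delta_mx 0 i + t *: delta_mx 0 j)) (f (x + t *: delta_mx 0 i)).
move: (f (x + t *: delta_mx 0 j)) (f x) => {Hr inb near1 cont} F3 F4 F1 F2 a b P Q b1 b2 E1 E2.
have EE : Q = P.
  apply: (mulfI (lt0r_neq0 t0)); apply: (mulfI (lt0r_neq0 t0)).
  by rewrite -E1 -E2; ring.
rewrite EE in b1; apply: le_trans (ler_distD P _ _) _.
by rewrite [e]splitr lerD// distrC.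
Qed.

Lemma pd_at_max A f i x : open A -> A x -> Cr 1 A f ->
  (forall y, A y -> f y <= f x) -> dp f i x = 0.
Proof.
move=> oA Ax fC fmax; have fd := Cr_differentiable fC.
have /nbhs_ballP[r /= r0 Hr] := open_nbhs_nbhs (conj oA Ax).
have inA (s : R) : s \in `]- r, r[ -> A (x + s *: delta_mx 0 i).
  rewrite in_itv /= -ltr_norml => sr; apply: Hr; rewrite -ball_normE /=.
  rewrite opprD addNKr normrN normrZ; apply: le_lt_trans sr.
  by rewrite ler_piMr// norm_delta.
have m0 : 0 \in `]- r, r[ by rewrite in_itv /= r0 oppr_lt0 r0.
pose F (s : R) := f (x + s *: delta_mx 0 i).
have Fd (s : R) : s \in `]- r, r[ -> is_derive s (1 : R) F (dp f i (x + s *: delta_mx 0 i)).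
  move=> sr; rewrite -derive_dp; apply: is_derive_line; apply: diff_derivable.
  exact/fd/inA.
have [|s /Fd[]//|s sr|_ E] := @derive1_at_max _ F (- r) r 0 _ _ m0 _.
- by rewrite ge0_cp// ltW.
- by rewrite /F scale0r addr0; apply/fmax/inA.
by have [_] := Fd 0 m0; rewrite E scale0r addr0.
Qed.

(** A positive second derivative would stay positive near x; the first derivative, zero at x, would
    then be positive just beyond, and two mean values give f (x + (r / 2) e_i) > f x. *)
Lemma pd2_at_max A f i x : open A -> A x -> Cr 2 A f ->
  (forall y, A y -> f y <= f x) -> dp (dp f i) i x <= 0.
Proof.
move=> oA Ax fC fmax; rewrite leNgt; apply/negP => d0.
have fd := Cr_differentiable fC.
have f'C := Cr_pd i fC; have f'd := Cr_differentiable f'C.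
have c2 : {for x, continuous (dp (dp f i) i)} by exact: Cr_continuous (Cr_pd i f'C) Ax.
have near1 : \forall y \near x, A y /\ 0 < dp (dp f i) i y.
  have /cvgrPdist_lt/(_ _ d0) n2 := c2.
  have nA : nbhs x A by exact: (open_nbhs_nbhs (conj oA Ax)).
  apply: (@filterS2 _ (nbhs x) (nbhs_filter x) _ _ _ _ nA n2) => y Ay b.
  move: b; rewrite ltr_norml => /andP[_]; rewrite ltrBlDr ltrDl => b; exact: conj Ay b.
have /nbhs_ballP[r /= r0 Hr] := near1; move: d0 near1 c2 => _ _ _.
have inb (s : R) : 0 <= s <= r / 2 -> ball x r (x + s *: delta_mx 0 i).
  move=> /andP[s0 sr]; rewrite -ball_normE /= opprD addNKr normrN normrZ.
  apply: (@le_lt_trans _ _ `|s|); first by rewrite ler_piMr// norm_delta.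
  by rewrite ger0_norm//; lra.
have r2 : 0 < r / 2 by rewrite divr_gt0.
have [|c /andP[c0 cr] E] := @mvt_line_pos _ f x (delta_mx 0 i) _ r2.
  by move=> s sr; apply: diff_derivable; apply: fd; have [] := Hr _ (inb s sr).
have [|c' /andP[c'0 c'c] E'] := @mvt_line_pos _ (dp f i) x (delta_mx 0 i) _ c0.
  move=> s /andP[s0 sc]; apply: diff_derivable; apply: f'd.
  by have [] := Hr _ (inb s _) => //; rewrite s0 (le_trans sc)// ltW.
have [_ pos] : A (x + c' *: delta_mx 0 i) /\ 0 < dp (dp f i) i (x + c' *: delta_mx 0 i).
  by apply: Hr; apply: inb; rewrite !ltW// (lt_trans c'c).
have : 0 < f (x + (r / 2) *: delta_mx 0 i) - f x.
  rewrite derive_dp in E; rewrite derive_dp (pd_at_max i oA Ax (CrW fC) fmax) subr0 in E'.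
  by rewrite E E'; exact: mulr_gt0 r2 (mulr_gt0 c0 pos).
apply/negP; rewrite -leNgt subr_le0; apply: fmax.
by have [] := Hr _ (inb (r / 2) _) => //; rewrite lexx ltW.
Qed.

Definition lap f x := \sum_i dp (dp f i) i x.

Lemma lap_at_max A f x : open A -> A x -> Cr 2 A f ->
  (forall y, A y -> f y <= f x) -> lap f x <= 0.
Proof. by move=> oA Ax fC fmax; apply: sumr_le0 => i _; apply: pd2_at_max fC fmax. Qed.

Lemma pd_eq A f g i x : open A -> (forall y, A y -> f y = g y) -> A x -> dp f i x = dp g i x.
Proof.
move=> oA fg Ax; apply: pd_near.
by apply: filterS (open_nbhs_nbhs (conj oA Ax)) => y /fg.
Qed.

Lemma lap_eq A f g x : open A -> (forall y, A y -> f y = g y) -> A x -> lap f x = lap g x.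
Proof.
move=> oA fg Ax; apply: eq_bigr => i _; apply: (pd_eq _ oA) => // y Ay.
exact: (pd_eq _ oA).
Qed.

Lemma lapM A f g x : open A -> A x -> Cr 2 A f -> Cr 2 A g ->
  lap (fun y => f y * g y) x =
  lap f x * g x + 2 * (\sum_i dp f i x * dp g i x) + f x * lap g x.
Proof.
move=> oA Ax fC gC; have fd := Cr_differentiable fC; have gd := Cr_differentiable gC.
rewrite /lap mulr_suml !mulr_sumr -!big_split /=; apply: eq_bigr => i _.
have f'd := Cr_differentiable (Cr_pd i fC); have g'd := Cr_differentiable (Cr_pd i gC).
rewrite (@pd_eq A _ (fun y => dp f i y * g y + f y * dp g i y))//; last first.
  by move=> y Ay; rewrite pdM//; [exact: fd|exact: gd].
rewrite pdD; [|exact: (differentiableM (f'd _ Ax) (gd _ Ax))|exact: (differentiableM (fd _ Ax)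
  (g'd _ Ax))].
rewrite !pdM//; [|exact: fd|exact: g'd|exact: f'd|exact: gd].
by ring.
Qed.

Lemma lapD A f g (c : R) x : open A -> A x -> Cr 2 A f -> Cr 2 A g ->
  lap (fun y => f y + c * g y) x = lap f x + c * lap g x.
Proof.
move=> oA Ax fC gC; have fd := Cr_differentiable fC; have gd := Cr_differentiable gC.
rewrite /lap mulr_sumr -big_split /=; apply: eq_bigr => i _.
have f'd := Cr_differentiable (Cr_pd i fC); have g'd := Cr_differentiable (Cr_pd i gC).
rewrite (@pd_eq A _ (fun y => dp f i y + c * dp g i y))//; last first.
  move=> y Ay; rewrite pdD ?pdZ//; [exact: gd|exact: fd|].
  exact: differentiableZ (gd _ Ay).
by rewrite pdD ?pdZ//; [exact: g'd|exact: f'd|exact: differentiableZ (g'd _ Ax)].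
Qed.

(** The derivative in direction j is moved past both derivatives in direction i by [pd_comm], which
    costs three orders of regularity. *)
Lemma lap_pd A f j x : open A -> A x -> Cr 3 A f -> (forall y, A y -> lap f y = 0) ->
  lap (dp f j) x = 0.
Proof.
move=> oA Ax fC f0.
rewrite -(pd_cst 0 j x) -[RHS](@pd_eq A (lap f))// /lap pd_sum; last first.
  by move=> i _; exact: Cr_differentiable (Cr_pd i (Cr_pd i fC)) Ax.
apply: eq_bigr => i _.
rewrite (@pd_eq A _ (dp (dp f i) j))//; last first.
  by move=> y Ay; apply: pd_comm oA Ay _; exact: CrW.
exact: pd_comm oA Ax (Cr_pd i fC).
Qed.

End Second.
End Calculus3.

(** * Homogeneous eigenfunctions on R^p minus 0 *)

Section Gap.
Context {R : realType} {p : nat}.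
Implicit Types (A : set 'rV[R]_p) (f g U : 'rV[R]_p -> R) (x y : 'rV[R]_p).

(** Squared Euclidean length; the ambient norm on row vectors is the sup norm. *)
Definition nsq n (x : 'rV[R]_n) : R := \sum_i x 0 i ^+ 2.

Definition punct : set 'rV[R]_p := [set x | x != 0].

Lemma nsq_ge0 n (x : 'rV[R]_n) : 0 <= nsq x.
Proof. by apply: sumr_ge0 => i _; rewrite sqr_ge0. Qed.

Lemma nsq_eq0 n (x : 'rV[R]_n) : (nsq x == 0) = (x == 0).
Proof.
apply/idP/eqP => [|->]; last by rewrite /nsq big1// => i _; rewrite mxE expr0n.
rewrite psumr_eq0 => [/allP h|i _]; last by rewrite sqr_ge0.
apply/rowP => i; rewrite mxE; apply/eqP; rewrite -sqrf_eq0.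
exact: (h i (mem_index_enum _)).
Qed.

Lemma nsq_gt0 n (x : 'rV[R]_n) : (0 < nsq x) = (x != 0).
Proof. by rewrite lt_def nsq_eq0 nsq_ge0 andbT. Qed.

Lemma nsqZ n a (x : 'rV[R]_n) : nsq (a *: x) = a ^+ 2 * nsq x.
Proof. by rewrite /nsq mulr_sumr; apply: eq_bigr => i _; rewrite mxE exprMn. Qed.

Lemma Cr_nsq n A : open A -> Cr n A (@nsq p).
Proof.
move=> oA; apply: (@Cr_eq _ _ _ _ (fun x => \sum_i x 0 i * x 0 i)) => //.
apply: Cr_sum => // i _; apply: CrM => //; exact: Cr_coord.
Qed.

Lemma dp_nsq i x : dp (@nsq p) i x = 2 * x 0 i.
Proof.
have -> : @nsq p = fun x => \sum_j x 0 j * x 0 j by apply/funext.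
have cd j := @differentiable_coord_rV R p j x.
rewrite pd_sum => [|j _]; last exact: (differentiableM (cd j) (cd j)).
rewrite (bigD1 i)//= big1 => [|j ji]; rewrite (pdM _ (cd _) (cd _)) pd_coord ?eqxx /=;
  first by ring.
by rewrite eq_sym (negbTE ji) mul0r mulr0 addr0.
Qed.

Lemma open_punct : open punct.
Proof.
have -> : punct = @nsq p @^-1` [set t | 0 < t].
  by apply/seteqP; split => x /=; rewrite /punct /= -nsq_gt0.
apply: open_comp => [x _|]; last exact: open_gt.
exact: (@Cr_continuous _ 0 _ setT _ x (@Cr_nsq 0 setT openT)).
Qed.

Lemma Cr_nsqX n a : Cr n punct (fun x => nsq x `^ a).
Proof.
apply: Cr_powR; [exact: open_punct| |exact: (Cr_nsq _ open_punct)].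
by move=> x; rewrite nsq_gt0.
Qed.

Lemma dp_nsqX a i x : x != 0 ->
  dp (fun x => nsq x `^ a) i x = 2 * a * nsq x `^ (a - 1) * x 0 i.
Proof.
move=> x0; rewrite pd_powR ?nsq_gt0//; first by rewrite dp_nsq; ring.
exact: (Cr_differentiable (Cr_nsq 1 open_punct)).
Qed.

(** With a = t / 2 this reads Delta |x|^t = t (t + p - 2) |x|^(t - 2), the source of the quadratic s
    (s + p - 2). *)
Lemma lap_nsqX a x : x != 0 ->
  lap (fun x => nsq x `^ a) x = 2 * a * (p%:R + 2 * (a - 1)) * nsq x `^ (a - 1).
Proof.
move=> x0; have n0 : 0 < nsq x by rewrite nsq_gt0.
have nX b := Cr_differentiable (Cr_nsqX 1 b) x0.
have E i : dp (dp (fun x => nsq x `^ a) i) i x = 2 * a * nsq x `^ (a - 1) +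
   2 * a * 2 * (a - 1) * nsq x `^ (a - 1 - 1) * x 0 i ^+ 2.
  rewrite (@pd_eq _ _ punct _ (fun y => 2 * a * (nsq y `^ (a - 1) * y 0 i)) _ _ open_punct)//;
    last first.
    by move=> y y0; rewrite dp_nsqX// !mulrA.
  have cd := @differentiable_coord_rV R p i x.
  rewrite pdZ; last exact: (differentiableM (nX (a - 1)) cd).
  by rewrite (pdM _ (nX (a - 1)) cd) dp_nsqX// pd_coord eqxx /=; ring.
rewrite /lap (eq_bigr _ (fun i _ => E i)) big_split /= sumr_const card_ord.
rewrite -mulr_natr -mulr_sumr -/(nsq x).
have -> : nsq x `^ (a - 1) = nsq x `^ (a - 1 - 1) * nsq x.
  by rewrite -{3}(@powRr1 _ (nsq x)) ?nsq_ge0// -powRD ?subrK// (gt_eqF n0) implybT.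
by ring.
Qed.

Definition homog s A f := forall (a : R) x, 0 < a -> A x -> f (a *: x) = a `^ s * f x.

Lemma homog_dp s A f i : open A -> (forall (a : R) x, 0 < a -> A x -> A (a *: x)) ->
  Cr 1 A f -> homog s A f -> homog (s - 1) A (dp f i).
Proof.
move=> oA cA fC fh a x a0 Ax; have fd := Cr_differentiable fC.
have cd c y : differentiable (fun y => a * y 0 c) y.
  exact: (differentiableZ a (@differentiable_coord_rV R p c y)).
have E y : \row_c (a * y 0 c) = a *: y by apply/rowP => c; rewrite !mxE.
have : dp (fun y => f (\row_c (a * y 0 c))) i x = dp (fun y => a `^ s * f y) i x.
  by apply: pd_eq oA _ Ax => y Ay; rewrite E fh.
rewrite (@pd_comp _ _ _ f (fun c y => a * y 0 c)); last by move=> c; exact: cd.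
  rewrite E (bigD1 i)//= big1 => [|c ci]; last first.
    by rewrite pdZ ?pd_coord; [rewrite eq_sym (negbTE ci) mulr0 mul0r|exact:
      differentiable_coord_rV].
  rewrite pdZ ?pd_coord ?eqxx; last exact: differentiable_coord_rV.
  rewrite pdZ; last exact: fd.
  move=> h; apply: (mulfI (lt0r_neq0 a0)); rewrite mulr1 addr0 in h; rewrite h mulrA.
  rewrite -[X in _ = X * _ * _](powRr1 (ltW a0)) -powRD ?(gt_eqF a0) ?implybT//.
  by rewrite addrC subrK.
by rewrite E; apply/fd/cA.
Qed.

(** Near t = 0 the point x + t x = (1 + t) x stays on the open ray of x, along which f is
    constant. *)
Lemma euler0 A f x : open A -> A x -> differentiable f x -> (forall (a : R) y,
  0 < a -> A y -> f (a *: y) = f y) ->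
  \sum_i x 0 i * dp f i x = 0.
Proof.
move=> oA Ax fd fh; rewrite -deriveE_dp//.
have d0 : derivable f (x + 0 *: x) x by rewrite scale0r addr0; exact: diff_derivable.
have [_] := is_derive_line d0; rewrite scale0r addr0 => <-.
rewrite -[RHS](derive_cst (f x) 0 (1 : R)); apply: near_eq_derive.
near=> t; rewrite -{1}[x]scale1r -scalerDl fh//=.
rewrite -ltrBlDl sub0r; near: t; exact: lt_nbhsr.
Unshelve. all: by end_near. Qed.

Lemma norm_le_nsq n (x : 'rV[R]_n) : nsq x = 1 -> `|x| <= 1.
Proof.
move=> x1; apply: norm_rV_le => // i; rewrite -(@ler_pXn2r _ 2)// ?nnegrE//.
rewrite expr1n real_normK ?num_real// -x1 /nsq (bigD1 i)//= lerDl.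
by apply: sumr_ge0 => j _; rewrite sqr_ge0.
Qed.

Lemma compact_sphere : compact [set x : 'rV[R]_p | nsq x = 1].
Proof.
apply: bounded_closed_compact.
  exists 1; split; first exact: num_real.
  by move=> M M1 x /norm_le_nsq x1; apply: le_trans x1 (ltW M1).
have -> : [set x : 'rV[R]_p | nsq x = 1] = @nsq p @^-1` [set 1].
  by apply/seteqP; split.
apply: closed_comp => [x _|]; last exact: closed_eq.
exact: (@Cr_continuous _ 0 _ setT _ x (@Cr_nsq 0 setT openT)).
Qed.

Lemma normalize x : x != 0 ->
  exists2 r, 0 < r & nsq (r^-1 *: x) = 1.
Proof.
move=> x0; have n0 : 0 < nsq x by rewrite nsq_gt0.
exists (Num.sqrt (nsq x)); first by rewrite sqrtr_gt0.
by rewrite nsqZ exprVn sqr_sqrtr ?nsq_ge0// mulVf// gt_eqF.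
Qed.

(* [U] is compared with the multiple of |x|^t that touches it from above at a
   maximum point of U on the unit sphere. *)
Lemma homog_max t c U : Cr 2 punct U -> homog t punct U ->
  (forall x, x != 0 -> lap U x = c / nsq x * U x) ->
  t * (t + p%:R - 2) < c -> forall x, x != 0 -> U x <= 0.
Proof.
move=> UC Uh UL tc x x0; rewrite leNgt; apply/negP => Ux.
have [r r0 xr] := normalize x0.
have [||y yS ymax] := @EVT_max_rV _ _ U _ _ compact_sphere _.
- by exists (r^-1 *: x).
- apply: continuous_in_subspaceT => z; rewrite inE /= => z1.
  apply: Cr_continuous UC _; rewrite /punct /= -nsq_gt0 z1//.
have y1 : nsq y = 1 by rewrite inE in yS.
have y0 : y != 0 by rewrite -nsq_gt0 y1.
have Uy : 0 < U y.
  apply: lt_le_trans (ymax (r^-1 *: x) _); last by rewrite inE.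
  by rewrite Uh ?invr_gt0// mulr_gt0// powR_gt0// invr_gt0.
pose W z := U z + (- U y) * nsq z `^ (t / 2).
have : lap W y <= 0.
  apply: (lap_at_max open_punct) => //.
    apply: CrD UC _; first exact: open_punct.
    by apply: CrM; [exact: open_punct|exact: Cr_cst|exact: Cr_nsqX].
  have -> : W y = 0 by rewrite /W y1 powR1 mulr1 subrr.
  move=> z z0; have [s s0 sz] := normalize z0.
  have Ez : z = s *: (s^-1 *: z) by rewrite scalerA mulfV ?gt_eqF// scale1r.
  rewrite /W Ez Uh//; last by rewrite /punct /= -nsq_gt0 sz.
  rewrite nsqZ sz mulr1.
  have -> : (s ^+ 2) `^ (t / 2) = s `^ t.
    by rewrite -powR_mulrn ?ltW// -powRrM mulrC divfK.
  rewrite mulNr mulrC -mulrBl mulr_le0_ge0//; last exact: powR_ge0.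
  by rewrite subr_le0; apply: ymax; rewrite inE.
rewrite (lapD _ open_punct)//; last exact: Cr_nsqX.
rewrite UL// lap_nsqX// y1 powR1 invr1 !mulr1.
rewrite mulNr [c * _]mulrC -mulrBr pmulr_rle0//.
move: tc => /[swap]; rewrite subr_le0 => h; apply/negP; rewrite -leNgt; apply: le_trans h _.
by rewrite le_eqVlt; apply/orP; left; apply/eqP; field.
Qed.

(** The one-sided bound [homog_max] is applied to U and to - U. Two instances matter: t = 0 and c =
    - lam for eigenfunctions with lam < 0, and c = 0 with 2 - p < t < 0 for harmonic functions. *)
Lemma homog_zero t c U : Cr 2 punct U -> homog t punct U ->
  (forall x, x != 0 -> lap U x = c / nsq x * U x) ->
  t * (t + p%:R - 2) < c -> forall x, x != 0 -> U x = 0.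
Proof.
move=> UC Uh UL tc x x0; apply/eqP; rewrite eq_le (homog_max UC Uh UL tc x0) /=.
rewrite -oppr_le0; have E y : 0 + (-1) * U y = - U y by rewrite add0r mulN1r.
apply: (@homog_max t c (fun y => - U y)) => //.
- apply: (@Cr_eq _ _ _ _ (fun y => 0 + (-1) * U y)) => //; first exact: open_punct.
  by apply: CrD; [exact: open_punct|exact: Cr_cst|apply: CrM; [exact: open_punct|exact: Cr_cst|]].
- by move=> a y a0 y0; rewrite Uh// mulrN.
- move=> y y0; rewrite mulrN -UL// -(@lap_eq _ _ punct (fun y => 0 + (-1) * U y) _ _ open_punct)//.
  rewrite (lapD _ open_punct)//; last exact: Cr_cst.
  rewrite mulN1r /lap big1 ?add0r// => i _; rewrite (@pd_eq _ _ setT _ (fun=> 0) _ _ openT)//.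
    exact: pd_cst.
  by move=> z _; rewrite pd_cst.
Qed.

End Gap.

(** * Rigidity of homogeneous harmonic functions and the eigenvalue gaps *)

Section Gap2.
Context {R : realType} {p : nat}.
Implicit Types (f g U : 'rV[R]_p -> R) (x y : 'rV[R]_p).

Let oP := @open_punct R p.

Lemma segment_const f x y : (forall z, z != 0 -> differentiable f z) ->
  (forall i z, z != 0 -> dp f i z = 0) ->
  (forall c : R, 0 <= c <= 1 -> x + c *: (y - x) != 0) -> f y = f x.
Proof.
move=> fd f0 seg.
have [|c /andP[c0 c1] E] := @mvt_line_pos _ _ f x (y - x) 1 ltr01.
  by move=> c c01; apply: diff_derivable; apply/fd/seg.
have nz : x + c *: (y - x) != 0 by apply: seg; rewrite !ltW.
apply/eqP; rewrite -subr_eq0; move: E; rewrite scale1r [x + (y - x)]addrC subrK mul1r => ->.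
by rewrite deriveE_dp ?big1// => [i _|]; [rewrite f0// mulr0|exact: fd].
Qed.

Lemma noncollinear x : (1 < p)%N -> x != 0 -> exists z, forall a : R, z != a *: x.
Proof.
move=> p1 x0; have p0 : (0 < p)%N by exact: ltnW.
pose i0 := Ordinal p0; pose i1 := Ordinal p1.
apply: contrapT => /forallNP H.
have [a Ha] : exists a, delta_mx 0 i0 = a *: x.
  by apply: contrapT => /forallNP h; apply: (H (delta_mx 0 i0)) => a; apply/eqP/h.
have [b Hb] : exists b, delta_mx 0 i1 = b *: x.
  by apply: contrapT => /forallNP h; apply: (H (delta_mx 0 i1)) => b; apply/eqP/h.
have e00 : a * x 0 i0 = 1 by have /rowP/(_ i0) := Ha; rewrite !mxE !eqxx.
have e01 : a * x 0 i1 = 0 by have /rowP/(_ i1) := Ha; rewrite !mxE.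
have e11 : b * x 0 i1 = 1 by have /rowP/(_ i1) := Hb; rewrite !mxE !eqxx.
move/eqP: e01; rewrite mulf_eq0 => /orP[] /eqP z.
  by move/eqP: e00; rewrite z mul0r eq_sym oner_eq0.
by move/eqP: e11; rewrite z mulr0 eq_sym oner_eq0.
Qed.

(** The segment between two collinear points may pass through 0; such pairs are joined through a
    point off their line, which exists since p > 1. *)
Lemma punct_const f : (1 < p)%N -> (forall z, z != 0 -> differentiable f z) ->
  (forall i z, z != 0 -> dp f i z = 0) -> forall x y, x != 0 -> y != 0 -> f x = f y.
Proof.
move=> p1 fd f0.
have seg x z : x != 0 -> (forall a : R, z != a *: x) -> f z = f x.
  move=> x0 zx; apply: segment_const => // c _; apply/eqP => E.
  have [c0|c0] := eqVneq c 0.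
    by move: E x0; rewrite c0 scale0r addr0 => ->; rewrite eqxx.
  have : z = (c^-1 * (c - 1)) *: x.
    apply: (scalerI c0); rewrite scalerA mulrA divff// mul1r scalerBl scale1r.
    by apply/eqP; rewrite -subr_eq0 opprB addrCA -scalerBr E.
  by apply/eqP/zx.
move=> x y x0 y0.
have [[a ya]|ny] := pselect (exists a, y = a *: x); last first.
  by apply/esym/seg => // a; apply/eqP => E; apply: ny; exists a.
have [z zx] := noncollinear p1 x0.
rewrite -(seg x z)//; apply: seg => // b.
by rewrite ya scalerA; exact: zx.
Qed.

Lemma odd_dp f i : (forall x, x != 0 -> f (- x) = f x) ->
  (forall z, z != 0 -> differentiable f z) -> forall x, x != 0 -> dp f i (- x) = - dp f i x.
Proof.
move=> ev fd x x0.
have cd c y : differentiable (fun y : 'rV[R]_p => (-1) * y 0 c) y.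
  exact: (differentiableZ (-1) (@differentiable_coord_rV R p c y)).
have E y : \row_c ((-1) * y 0 c) = - y by apply/rowP => c; rewrite !mxE mulN1r.
have : dp (fun y => f (\row_c ((-1) * y 0 c))) i x = dp f i x.
  by apply: (pd_eq _ oP) => // y y0; rewrite E ev.
rewrite (@pd_comp _ _ _ f (fun c y => (-1) * y 0 c)); last by move=> c; exact: cd.
  rewrite E (bigD1 i)//= big1 => [|c ci]; last first.
    by rewrite pdZ ?pd_coord; [rewrite eq_sym (negbTE ci) mulr0 mul0r|exact:
      differentiable_coord_rV].
  rewrite pdZ ?pd_coord ?eqxx; last exact: differentiable_coord_rV.
  by rewrite mulr1 addr0 mulN1r => <-; rewrite opprK.
by rewrite E; apply: fd; rewrite oppr_eq0.
Qed.

Lemma lap0_dp f i : Cr 3 (@punct R p) f -> (forall x, x != 0 -> lap f x = 0) ->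
  forall x, x != 0 -> lap (dp f i) x = 0.
Proof. by move=> fC f0 x x0; exact: (lap_pd i oP x0 fC f0). Qed.

Lemma lap0_homog t f : Cr 2 (@punct R p) f -> homog t (@punct R p) f ->
  (forall x, x != 0 -> lap f x = 0) -> t < 0 -> 2 < t + p%:R -> forall x, x != 0 -> f x = 0.
Proof.
move=> fC fh f0 t0 tp; apply: (@homog_zero _ _ t 0) => //.
  by move=> x x0; rewrite f0// !mul0r.
by rewrite nmulr_rlt0// subr_gt0.
Qed.

Lemma cone_punct (a : R) x : 0 < a -> punct x -> punct (a *: x).
Proof. by move=> a0 x0; rewrite /punct /= scaler_eq0 negb_or gt_eqF. Qed.

(** The first derivatives are harmonic of degree s - 1, which lies in [-1, 0[ and exceeds 2 - p
    because p > 3. *)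
Lemma harmonic_const1 s U : (3 < p)%N -> Cr 3 (@punct R p) U -> homog s (@punct R p) U ->
  (forall x, x != 0 -> lap U x = 0) -> 0 <= s < 1 ->
  forall x y, x != 0 -> y != 0 -> U x = U y.
Proof.
move=> p3 UC Uh U0 /andP[s0 s1]; apply: punct_const.
- exact: ltn_trans p3.
- by move=> z z0; exact: (Cr_differentiable UC z0).
move=> i; apply: (@lap0_homog (s - 1)).
- exact: Cr_pd.
- by apply: homog_dp oP cone_punct _ Uh; apply: CrW; apply: CrW.
- exact: lap0_dp.
- by rewrite subr_lt0.
- have : 4%:R <= p%:R :> R by rewrite ler_nat.
  lra.
Qed.

(** Second derivatives have degree s - 2 >= -2, above 2 - p because p > 4; [Cr 4] allows two
    derivatives to be commuted with [lap] one after the other. A first derivative is then constant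
    and odd, hence zero. *)
Lemma harmonic_const2 s U : (4 < p)%N -> Cr 4 (@punct R p) U -> homog s (@punct R p) U ->
  (forall x, x != 0 -> lap U x = 0) -> (forall x, x != 0 -> U (- x) = U x) -> 0 <= s < 2 ->
  forall x y, x != 0 -> y != 0 -> U x = U y.
Proof.
move=> p4 UC Uh U0 Ue /andP[s0 s2]; have p1 : (1 < p)%N by exact: ltn_trans p4.
have Ud z (z0 : z != 0) := Cr_differentiable UC z0.
apply: punct_const => // i z z0.
have h1 : homog (s - 1) (@punct R p) (dp U i).
  by apply: homog_dp oP cone_punct _ Uh; do 3 apply: CrW.
have c1 := Cr_pd i UC; have d1 w (w0 : w != 0) := Cr_differentiable c1 w0.
have eq1 x y : x != 0 -> y != 0 -> dp U i x = dp U i y.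
  apply: punct_const => // j; apply: (@lap0_homog (s - 1 - 1)).
  - exact: Cr_pd.
  - by apply: homog_dp oP cone_punct _ h1; do 2 apply: CrW.
  - by apply: lap0_dp => //; apply: lap0_dp => //; exact: CrW.
  - by lra.
  - have : 5%:R <= p%:R :> R by rewrite ler_nat.
    lra.
have := eq1 (- z) z; rewrite odd_dp// oppr_eq0 => /(_ z0 z0) /eqP.
rewrite eq_sym -addr_eq0 -mulr2n mulrn_eq0 /= => /eqP //.
Qed.

Lemma Cr_nsqXM n a g : Cr n (@punct R p) g -> Cr n (@punct R p) (fun x => nsq x `^ a * g x).
Proof. by move=> gC; apply: (CrM oP _ gC); exact: Cr_nsqX. Qed.

(** The cross term of the product rule is a multiple of the radial derivative of g, zero by
    [euler0]. The formula is read in both directions: from an eigenfunction to a harmonic function,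
    and back in [chart_eigen]. *)
Lemma lap_nsqXM A s g x : open A -> A `<=` @punct R p -> A x ->
  Cr 2 A g -> (forall (a : R) y, 0 < a -> A y -> g (a *: y) = g y) ->
  lap (fun y => nsq y `^ (s / 2) * g y) x =
  nsq x `^ (s / 2) * (lap g x + s * (s + p%:R - 2) / nsq x * g x).
Proof.
move=> oA AP Ax gC gh; have x0 := AP _ Ax; have n0 : 0 < nsq x by rewrite nsq_gt0.
rewrite (lapM oA Ax (CrS AP (Cr_nsqX 2 _)) gC) lap_nsqX//.
have -> : \sum_i dp (fun y => nsq y `^ (s / 2)) i x * dp g i x = 0.
  transitivity (2 * (s / 2) * nsq x `^ (s / 2 - 1) * \sum_i x 0 i * dp g i x).
    by rewrite mulr_sumr; apply: eq_bigr => i _; rewrite dp_nsqX// [RHS]mulrA.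
  by rewrite (euler0 oA Ax (Cr_differentiable gC Ax) gh) mulr0.
have -> : nsq x `^ (s / 2 - 1) = nsq x `^ (s / 2) / nsq x.
  rewrite powRB ?powRr1 ?nsq_ge0// (gt_eqF n0) implybT//.
by field; rewrite gt_eqF.
Qed.

Definition const_on_punct g := exists C : R, forall x, x != 0 -> g x = C.

(** The witness is the nonnegative root of s^2 + (p - 2) s = lam. *)
Lemma exponent (lam : R) : 0 <= lam -> (2 < p)%N ->
  exists2 s, 0 <= s & s * (s + p%:R - 2) = lam.
Proof.
move=> lam0 p2; have q0 : 0 < p%:R - 2 :> R by rewrite subr_gt0 ltr_nat.
set q := p%:R - 2 in q0.
exists ((Num.sqrt (q ^+ 2 + 4 * lam) - q) / 2).
  rewrite divr_ge0// subr_ge0 -{1}(ger0_norm (ltW q0)) -sqrtr_sqr ler_wsqrtr//.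
  by rewrite lerDl mulr_ge0.
rewrite -addrA -/q; set w := Num.sqrt _.
have ww : w ^+ 2 = q ^+ 2 + 4 * lam by rewrite sqr_sqrtr// addr_ge0 ?sqr_ge0// mulr_ge0.
transitivity ((w ^+ 2 - q ^+ 2) / 4); first by field.
by rewrite ww; field.
Qed.

Section Eigen.
Variables (lam : R) (g : 'rV[R]_p -> R).
Hypothesis p4 : (4 < p)%N.
Hypothesis gC : Cr 4 (@punct R p) g.
Hypothesis g0 : forall (a : R) y, 0 < a -> y != 0 -> g (a *: y) = g y.
Hypothesis gL : forall x, x != 0 -> lap g x = - lam / nsq x * g x.

Lemma eigen_neg : lam < 0 -> forall x, x != 0 -> g x = 0.
Proof.
move=> l0; apply: (@homog_zero _ _ 0 (- lam)) => //.
- by do 2 apply: CrW.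
- by move=> a x a0 x0; rewrite g0// powRr0 mul1r.
- by rewrite mul0r oppr_gt0.
Qed.

(** On the unit sphere |x|^s g is g itself, and homogeneity of degree 0 carries its value along the
    rays. *)
Lemma eigen_const s : 0 <= s -> s * (s + p%:R - 2) = lam ->
  (forall x y, x != 0 -> y != 0 ->
    nsq x `^ (s / 2) * g x = nsq y `^ (s / 2) * g y) -> const_on_punct g.
Proof.
move=> s0 sl UU; have p0 : (0 < p)%N by exact: ltn_trans p4.
exists (g (delta_mx 0 (Ordinal p0))) => x x0.
have nd : nsq (delta_mx 0 (Ordinal p0) : 'rV[R]_p) = 1.
  rewrite /nsq (bigD1 (Ordinal p0))//= big1 ?mxE ?eqxx ?expr1n ?addr0// => j ji.
  by rewrite mxE (negbTE ji) andbF expr0n.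
have [r r0 xr] := normalize x0.
have x'0 : r^-1 *: x != 0 by rewrite -nsq_gt0 xr.
have := UU (r^-1 *: x) (delta_mx 0 (Ordinal p0)) x'0.
rewrite xr nd powR1 !mul1r g0 ?invr_gt0// => ->//.
by rewrite -nsq_gt0 nd.
Qed.

Let U s x := nsq x `^ (s / 2) * g x.

Let UC s n : (n <= 4)%N -> Cr n (@punct R p) (U s).
Proof.
have h : Cr 4 (@punct R p) (U s) by exact: Cr_nsqXM.
by move: n => [|[|[|[|[|//]]]]] _; do ?[exact: h|apply: CrW].
Qed.

Let Uh s : homog s (@punct R p) (U s).
Proof.
move=> a x a0 x0; rewrite /U g0// nsqZ powRM ?nsq_ge0 ?sqr_ge0//.
by rewrite -powR_mulrn ?ltW// -powRrM [2%:R * _]mulrC divfK// mulrA.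
Qed.

Let UL s : s * (s + p%:R - 2) = lam -> forall x, x != 0 -> lap (U s) x = 0.
Proof.
move=> sl x x0; rewrite (lap_nsqXM s oP)//; last by do 2 apply: CrW.
by rewrite gL// sl; ring.
Qed.

Lemma eigen_gap1 : 0 <= lam < p%:R - 1 -> const_on_punct g.
Proof.
move=> /andP[l0 l1]; have p2 : (2 < p)%N by exact: ltn_trans p4.
have q : 5%:R <= p%:R :> R by rewrite ler_nat.
have [s s0 sl] := exponent l0 p2.
apply: (eigen_const s0 sl); apply: (@harmonic_const1 s (U s)) => //.
- exact: ltn_trans p4.
- exact: UC.
- exact: UL.
(* If s >= 1, then s (s + p - 2) >= p - 1, against the bound on lam. *)
rewrite s0 ltNge; apply/negP => s1; move: l1; apply/negP; rewrite -leNgt -sl.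
nra.
Qed.

Lemma eigen_gap2 : (forall x, x != 0 -> g (- x) = g x) ->
  0 <= lam < 2 * p%:R -> const_on_punct g.
Proof.
move=> ge /andP[l0 l1]; have p2 : (2 < p)%N by exact: ltn_trans p4.
have q : 5%:R <= p%:R :> R by rewrite ler_nat.
have [s s0 sl] := exponent l0 p2.
apply: (eigen_const s0 sl); apply: (@harmonic_const2 s (U s)) => //.
- exact: UC.
- exact: UL.
- move=> x x0; rewrite /U ge//; congr (_ `^ _ * _).
  by apply: eq_bigr => i _; rewrite mxE sqrrN.
(* If s >= 2, then s (s + p - 2) >= 2 p, against the bound on lam. *)
rewrite s0 ltNge; apply/negP => s1; move: l1; apply/negP; rewrite -leNgt -sl.
nra.
Qed.

End Eigen.
End Gap2.

(** * The model metric in affine coordinates *)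

Section HasDp.
Context {R : realType} {p : nat}.
Implicit Types (f g : 'rV[R]_p -> R) (x : 'rV[R]_p) (i : 'I_p).

(** Differentiability and the value travel together, so a derivative is assembled by composing the
    rules below without separate side conditions. *)
Definition hasdp f i x (v : R) := differentiable f x /\ dp f i x = v.

Lemma hasdp_eq f i x v v' : hasdp f i x v -> v = v' -> hasdp f i x v'.
Proof. by move=> h <-. Qed.

Lemma hasdp_cst (c : R) i x : hasdp (fun=> c) i x 0.
Proof. by split; [exact: differentiable_cst|exact: pd_cst]. Qed.

Lemma hasdp_coord j i x : hasdp (fun y => y 0 j) i x (i == j)%:R.
Proof. by split; [exact: differentiable_coord_rV|exact: pd_coord]. Qed.

Lemma hasdpD f g i x u v : hasdp f i x u -> hasdp g i x v ->
  hasdp (fun y => f y + g y) i x (u + v).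
Proof. by move=> [fd <-] [gd <-]; split; [exact: differentiableD|exact: pdD]. Qed.

Lemma hasdpM f g i x u v : hasdp f i x u -> hasdp g i x v ->
  hasdp (fun y => f y * g y) i x (u * g x + f x * v).
Proof. by move=> [fd <-] [gd <-]; split; [exact: differentiableM|exact: pdM]. Qed.

Lemma hasdpZ f (c : R) i x u : hasdp f i x u -> hasdp (fun y => c * f y) i x (c * u).
Proof. by move=> [fd <-]; split; [exact: (differentiableZ c fd)|exact: pdZ]. Qed.

Lemma hasdpN f i x u : hasdp f i x u -> hasdp (fun y => - f y) i x (- u).
Proof.
move=> /(hasdpZ (-1)); rewrite mulN1r.
by have -> : (fun y => -1 * f y) = (fun y => - f y) by apply/funext => y; rewrite mulN1r.
Qed.

Lemma hasdpB f g i x u v : hasdp f i x u -> hasdp g i x v ->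
  hasdp (fun y => f y - g y) i x (u - v).
Proof. by move=> hf hg; exact: hasdpD hf (hasdpN hg). Qed.

Lemma hasdp_sum (I : Type) (r : seq I) (P : pred I) (F : I -> 'rV[R]_p -> R) (v : I -> R) i x :
  (forall j, P j -> hasdp (F j) i x (v j)) ->
  hasdp (fun y => \sum_(j <- r | P j) F j y) i x (\sum_(j <- r | P j) v j).
Proof.
move=> Fd; split; first by apply: differentiable_fsum => j /Fd[].
by rewrite pd_sum => [|j /Fd[]//]; apply: eq_bigr => j /Fd[].
Qed.

Lemma hasdpV f i x u : f x != 0 -> hasdp f i x u -> hasdp (fun y => (f y)^-1) i x (- u / f x ^+ 2).
Proof.
move=> f0 [fd <-]; split; first exact: differentiableV.
have := deriveV f0 (@diff_derivable _ _ _ _ _ (delta_mx 0 i) fd).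
by rewrite !derive_dp => ->; rewrite -[LHS]/(_ * _) mulNr [RHS]mulNr [X in - X]mulrC.
Qed.

Lemma hasdp_lin q (B : 'M[R]_(p, q)) a i x : hasdp (fun y => (y *m B) 0 a) i x (B i a).
Proof.
have -> : (fun y : 'rV[R]_p => (y *m B) 0 a) = (fun y => \sum_j y 0 j * B j a).
  by apply/funext => y; rewrite mxE.
apply: (@hasdp_eq _ _ _ (\sum_j ((i == j)%:R * B j a + x 0 j * 0))).
  by apply: hasdp_sum => j _; apply: hasdpM; [exact: hasdp_coord|exact: hasdp_cst].
rewrite (bigD1 i)//= eqxx mul1r mulr0 addr0 big1 ?addr0// => j ji.
by rewrite eq_sym (negbTE ji) mul0r mulr0 addr0.
Qed.

Lemma hasdp_nsq i x : hasdp (@nsq R p) i x (2 * x 0 i).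
Proof.
by split; [exact: (Cr_differentiable (Cr_nsq 1 openT))|exact: dp_nsq].
Qed.

Lemma Cr_lin n (A : set 'rV[R]_p) q (B : 'M[R]_(p, q)) a : open A -> Cr n A (fun y => (y *m B) 0 a).
Proof.
move=> oA; apply: (@Cr_eq _ _ _ _ (fun y => \sum_j y 0 j * B j a)) => //.
  by move=> y _; rewrite mxE.
by apply: Cr_sum => // j _; apply: CrM => //; [exact: Cr_coord|exact: Cr_cst].
Qed.

End HasDp.

Section Model.
Context {R : realType} {d k : nat}.
Implicit Types (y w z : 'rV[R]_k) (a b c : 'I_k).

(* The [J s] are the right multiplications by an orthonormal basis of R, C or H
   whose element of index 0 is 1. *)
Record hypercomplex (J : 'I_d.+1 -> 'M[R]_k) : Prop := Hypercomplex {
  hc_one : J 0 = 1%:M;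
  hc_skew : forall s, (J s)^T = if s == 0 then J s else - J s;
  hc_orth : forall s t, J s *m (J t)^T + J t *m (J s)^T = (2 * (s == t)%:R)%:M;
  hc_alt : forall y r a b,
    \sum_t ((y *m J t) 0 a * (y *m J r *m (J t)^T) 0 b
            + (y *m J t) 0 b * (y *m J r *m (J t)^T) 0 a) =
    2 * (y 0 a * (y *m J r) 0 b + y 0 b * (y *m J r) 0 a)
    - 2 * (r == 0)%:R * \sum_t (y *m J t) 0 a * (y *m J t) 0 b;
  hc_norm : forall y (u : 'rV[R]_d.+1) a b, let A := \sum_s u 0 s *: J s in
    \sum_t (y *m J t *m A^T) 0 a * (y *m J t *m A^T) 0 b =
    nsq u * \sum_t (y *m J t) 0 a * (y *m J t) 0 b }.

Variables (J : 'I_d.+1 -> 'M[R]_k) (hJ : hypercomplex J) (kap : R).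

Definition rho y : R := 1 + nsq y.

(** The matrix |y|^2 times the orthogonal projection onto the K-line of y, which the [y *m J s] span
    (compare [proj_sqr]). *)
Definition proj y a b : R := \sum_s (y *m J s) 0 a * (y *m J s) 0 b.

(* The metric of the projective space over R, C or H in affine coordinates,
   multiplied by [kap]. *)
Definition fsm y : 'M[R]_k :=
  \matrix_(a, b) (kap * ((a == b)%:R / rho y - proj y a b / rho y ^+ 2)).

Definition fsm_inv y : 'M[R]_k :=
  \matrix_(a, b) (kap^-1 * (rho y * ((a == b)%:R + proj y a b))).

Lemma rho_gt0 y : 0 < rho y.
Proof. by rewrite ltr_pwDl// nsq_ge0. Qed.

Lemma rho_neq0 y : rho y != 0.
Proof. by rewrite gt_eqF// rho_gt0. Qed.

Lemma Y0 y a : (y *m J 0) 0 a = y 0 a.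
Proof. by rewrite (hc_one hJ) mulmx1. Qed.

Lemma dotrow n (u v : 'rV[R]_n) : \sum_i u 0 i * v 0 i = (u *m v^T) 0 0.
Proof. by rewrite mxE; apply: eq_bigr => i _; rewrite mxE. Qed.

Lemma nsq_dot n (u : 'rV[R]_n) : nsq u = (u *m u^T) 0 0.
Proof. by rewrite -dotrow; apply: eq_bigr => i _; rewrite expr2. Qed.

(** [hc_orth] makes the symmetric part of [J s *m (J t)^T] scalar, and a quadratic form in y sees
    only the symmetric part. *)
Lemma J_orth y s t : \sum_a (y *m J s) 0 a * (y *m J t) 0 a = (s == t)%:R * nsq y.
Proof.
have sym : ((y *m J s) *m (y *m J t)^T) 0 0 = ((y *m J t) *m (y *m J s)^T) 0 0.
  by rewrite -!dotrow; apply: eq_bigr => a _; rewrite mulrC.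
rewrite dotrow; have : ((y *m J s) *m (y *m J t)^T) 0 0 + ((y *m J t) *m (y *m J s)^T) 0 0 =
    2 * (s == t)%:R * nsq y.
  have E u v : (y *m u) *m (y *m v)^T = y *m (u *m v^T) *m y^T by rewrite trmx_mul !mulmxA.
  transitivity ((y *m (J s *m (J t)^T + J t *m (J s)^T) *m y^T) 0 0).
    by rewrite !E mulmxDr mulmxDl [RHS]mxE.
  by rewrite (hc_orth hJ) mul_mx_scalar -scalemxAl mxE nsq_dot.
by rewrite -sym => h; lra.
Qed.

Lemma proj_sym y a b : proj y a b = proj y b a.
Proof. by apply: eq_bigr => s _; rewrite mulrC. Qed.

Lemma proj_row y s a : \sum_b (y *m J s) 0 b * proj y a b = nsq y * (y *m J s) 0 a.
Proof.
under eq_bigr do rewrite mulr_sumr.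
rewrite exchange_big /= (bigD1 s)//= [X in _ + X]big1 => [|t ts].
  rewrite addr0; have := J_orth y s s; rewrite eqxx mul1r => <-; rewrite mulr_suml.
  by apply: eq_bigr => b _; ring.
transitivity ((y *m J t) 0 a * \sum_b (y *m J s) 0 b * (y *m J t) 0 b).
  by rewrite mulr_sumr; apply: eq_bigr => b _; ring.
by rewrite J_orth eq_sym (negbTE ts) mul0r mulr0.
Qed.

Lemma proj_sqr y a b : \sum_c proj y a c * proj y c b = nsq y * proj y a b.
Proof.
under eq_bigr do rewrite /proj mulr_suml.
rewrite exchange_big /= [in RHS]/proj mulr_sumr; apply: eq_bigr => s _.
transitivity ((y *m J s) 0 a * \sum_c (y *m J s) 0 c * proj y b c).
  by rewrite mulr_sumr; apply: eq_bigr => c _; rewrite [proj y b c]proj_sym /proj; ring.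
by rewrite proj_row; ring.
Qed.

Lemma sum_delta n (F : 'I_n -> R) i : \sum_j (i == j)%:R * F j = F i.
Proof.
rewrite (bigD1 i)//= eqxx mul1r big1 ?addr0// => j ji.
by rewrite eq_sym (negbTE ji) mul0r.
Qed.

Hypothesis kap0 : kap != 0.

(** Since [proj y] squares to |y|^2 [proj y], the combinations of 1 and [proj y] are closed under
    products, and the inverse is found among them. *)
Lemma fsmV y : fsm y *m fsm_inv y = 1%:M.
Proof.
apply/matrixP => a b; rewrite mxE.
under eq_bigr => c _ do rewrite !mxE.
have E c : kap * ((a == c)%:R / rho y - proj y a c / rho y ^+ 2) *
     (kap^-1 * (rho y * ((c == b)%:R + proj y c b))) =
   (a == c)%:R * ((c == b)%:R + proj y c b) - (rho y)^-1 * ((b == c)%:R * proj y a c) -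
    (rho y)^-1 * (proj y a c * proj y c b).
  by rewrite (eq_sym b); field; rewrite rho_neq0 kap0.
under eq_bigr => c _ do rewrite E.
rewrite !sumrB -!mulr_sumr (sum_delta (fun c => (c == b)%:R + proj y c b)).
rewrite (sum_delta (fun c => proj y a c)) proj_sqr mxE.
by have := rho_neq0 y; rewrite /rho => h; field.
Qed.

Lemma invmx_fsm y : invmx (fsm y) = fsm_inv y.
Proof.
have [u _] := mulmx1_unit (fsmV y).
by rewrite -[LHS]mulmx1 -(fsmV y) mulmxA mulVmx// mul1mx.
Qed.

Lemma hasdp_rho i y : hasdp rho i y (2 * y 0 i).
Proof.
apply: hasdp_eq (add0r _); apply: hasdpD; [exact: hasdp_cst|exact: hasdp_nsq].
Qed.

Definition dproj y i a b : R := \sum_s (J s i a * (y *m J s) 0 b + (y *m J s) 0 a * J s i b).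

Lemma hasdp_proj i a b y : hasdp (fun y => proj y a b) i y (dproj y i a b).
Proof. by apply: hasdp_sum => s _; apply: hasdpM; exact: hasdp_lin. Qed.

Lemma hasdp_fsm i a b y : hasdp (fun y => fsm y a b) i y
  (kap * (- (a == b)%:R * (2 * y 0 i) / rho y ^+ 2
          - dproj y i a b / rho y ^+ 2 + 4 * y 0 i * proj y a b / rho y ^+ 3)).
Proof.
have -> : (fun y => fsm y a b) = (fun y =>
    kap * ((a == b)%:R * (rho y)^-1 - proj y a b * ((rho y)^-1 * (rho y)^-1))).
  by apply/funext => z; rewrite mxE -exprVn expr2.
have dV := hasdpV (rho_neq0 y) (hasdp_rho i y).
apply: hasdp_eq.
  apply: hasdpZ; apply: hasdpB; first exact: hasdpZ dV.
  by apply: hasdpM (hasdp_proj i a b y) _; exact: (hasdpM dV dV).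
by rewrite /=; field; exact: rho_neq0.
Qed.

Lemma J_skew s a b : J s b a = (if s == 0 then 1 else -1) * J s a b.
Proof.
have /matrixP/(_ a b) := hc_skew hJ s; rewrite mxE => ->.
by case: ifP; rewrite ?mxE ?mul1r ?mulN1r.
Qed.

(** This is the contribution of [proj] to the Christoffel symbols of the first kind. Skewness of
    [J t] for t <> 0 lets the three terms combine; the symmetric [J 0] = 1 leaves the second summand
    as a correction. *)
Lemma dproj_cyclic y a b s :
  dproj y a s b + dproj y b s a - dproj y s a b =
  2 * (\sum_t (J t a s * (y *m J t) 0 b + J t b s * (y *m J t) 0 a))
  + 2 * (y 0 s * (a == b)%:R - (a == s)%:R * y 0 b - (b == s)%:R * y 0 a).
Proof.
rewrite /dproj -big_split -sumrB /= mulr_sumr (bigD1 0)//= [X in _ = X + _](bigD1 0)//=.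
rewrite [RHS]addrAC; congr (_ + _).
  by rewrite !Y0 (hc_one hJ) !mxE (eq_sym b a) (eq_sym s a) (eq_sym s b); ring.
apply: eq_bigr => t t0.
by rewrite (J_skew t a s) (J_skew t b s) (J_skew t a b) (negbTE t0); ring.
Qed.

(** The candidate [Gam] is checked against the symbols of the first kind, and [fsm] is inverted only
    at the end. The scale [kap] cancels. *)
Lemma christoffel_fsm c a b y : christoffel fsm c a b y =
  - (rho y)^-1 * \sum_s ((y *m J s) 0 a * J s b c + (y *m J s) 0 b * J s a c).
Proof.
pose Gam c' := - (rho y)^-1 * \sum_s ((y *m J s) 0 a * J s b c' + (y *m J s) 0 b * J s a c').
suff low s : dp (fun y => fsm y s b) a y + dp (fun y => fsm y s a) b y
     - dp (fun y => fsm y a b) s y = 2 * \sum_c' fsm y s c' * Gam c'.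
  rewrite /christoffel -!dpE; under eq_bigr do rewrite low.
  transitivity (\sum_c' (invmx (fsm y) *m fsm y) c c' * Gam c').
    rewrite mulr_sumr; under eq_bigr do rewrite mulrCA mulKf ?pnatr_eq0// mulr_sumr.
    rewrite exchange_big /=; apply: eq_bigr => c' _; rewrite mxE mulr_suml.
    by apply: eq_bigr => s _; rewrite mulrA.
  rewrite mulVmx; last by have [] := mulmx1_unit (fsmV y).
  by under eq_bigr do rewrite mxE; rewrite sum_delta.
have [_ ->] := hasdp_fsm a s b y; have [_ ->] := hasdp_fsm b s a y.
have [_ ->] := hasdp_fsm s a b y.
have cyc := dproj_cyclic y a b s.
set S1 := \sum_t _ in cyc.
have E1 : \sum_c' (s == c')%:R * Gam c' = - (rho y)^-1 * S1.
  by rewrite (sum_delta Gam) /Gam; congr (_ * _); apply: eq_bigr => t _; ring.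
(* The contraction of [Gam] with [y *m J r] is the expression that [hc_alt] evaluates. *)
have alt r : \sum_c' (y *m J r) 0 c' * Gam c' =
   - (rho y)^-1 * (2 * (y 0 a * (y *m J r) 0 b + y 0 b * (y *m J r) 0 a)
    - 2 * (r == 0)%:R * proj y a b).
  rewrite -(hc_alt hJ y r a b) /Gam.
  under eq_bigr do rewrite mulrCA; rewrite -mulr_sumr; congr (_ * _).
  under eq_bigr do rewrite mulr_sumr; rewrite exchange_big /=; apply: eq_bigr => t _.
  rewrite ![(_ *m (J t)^T) 0 _]mxE !mulr_sumr -big_split /=; apply: eq_bigr => c' _.
  by rewrite !mxE; ring.
have E2 : \sum_c' proj y s c' * Gam c' = - (rho y)^-1 * (2 * (y 0 a * proj y s b +
  y 0 b * proj y s a)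
    - 2 * y 0 s * proj y a b).
  under eq_bigr do rewrite mulr_suml; rewrite exchange_big /=.
  transitivity (\sum_r (y *m J r) 0 s * \sum_c' (y *m J r) 0 c' * Gam c').
    by apply: eq_bigr => r _; rewrite mulr_sumr; apply: eq_bigr => c' _; rewrite mulrA.
  under eq_bigr do rewrite alt mulrCA; rewrite -mulr_sumr; congr (_ * _).
  transitivity (\sum_r (2 * y 0 a * ((y *m J r) 0 s * (y *m J r) 0 b)
     + 2 * y 0 b * ((y *m J r) 0 s * (y *m J r) 0 a)
     - 2 * proj y a b * ((0 == r)%:R * (y *m J r) 0 s))).
    by apply: eq_bigr => r _; rewrite (eq_sym r); ring.
  rewrite sumrB big_split /= -!mulr_sumr (sum_delta (fun r => (y *m J r) 0 s)) Y0 -!/(proj _ _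
    _); ring.
have -> : \sum_c' fsm y s c' * Gam c' =
   kap * (\sum_c' (s == c')%:R * Gam c' / rho y - (\sum_c' proj y s c' * Gam c') / rho y ^+ 2).
  rewrite !mulr_suml -sumrB mulr_sumr; apply: eq_bigr => c' _; rewrite mxE; ring.
rewrite -mulr_suml E1 E2 (eq_sym s b) (eq_sym s a).
have -> : dproj y a s b = dproj y s a b - dproj y b s a + (2 * S1
  + 2 * (y 0 s * (a == b)%:R - (a == s)%:R * y 0 b - (b == s)%:R * y 0 a)).
  by rewrite -cyc; ring.
by field; exact: rho_neq0.
Qed.

End Model.

(** * The Euclidean Laplacian of the cone in affine coordinates *)

Section LapComp.
Context {R : realType} {p q : nat}.

Lemma lap_comp (A : set 'rV[R]_p) (B : set 'rV[R]_q) (f : 'rV[R]_q -> R) (phi : 'I_q ->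
  'rV[R]_p -> R) z :
  open A -> A z -> (forall y, A y -> B (\row_c phi c y)) ->
  (forall c, Cr 2 A (phi c)) -> Cr 2 B f ->
  lap (fun y => f (\row_c phi c y)) z =
  \sum_c \sum_c' (\sum_i dp (phi c) i z * dp (phi c') i z) * dp (dp f c) c' (\row_c phi c z)
  + \sum_c lap (phi c) z * dp f c (\row_c phi c z).
Proof.
move=> oA Az AB pC fC; pose F y := \row_c phi c y.
have pd_ c y : A y -> differentiable (phi c) y by move=> Ay; exact: Cr_differentiable (pC c) Ay.
have fd y : B y -> differentiable f y by exact: (Cr_differentiable fC).
have f'd c y : B y -> differentiable (dp f c) y by exact: (Cr_differentiable (Cr_pd c fC)).
have p'd c i : differentiable (dp (phi c) i) z by exact: Cr_differentiable (Cr_pd i (pC c)) Az.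
transitivity (\sum_i \sum_c (dp (dp (phi c) i) i z * dp f c (F z)
   + \sum_c' (dp (phi c) i z * dp (phi c') i z) * dp (dp f c) c' (F z))).
  apply: eq_bigr => i _.
  rewrite (@pd_eq _ _ A _ (fun y => \sum_c dp (phi c) i y * dp f c (F y)) _ _ oA)//; last first.
    by move=> y Ay; rewrite pd_comp// => [|c]; [exact/fd/AB|exact: pd_].
  have cd c : differentiable (fun y => dp f c (F y)) z.
    by apply: differentiable_compr => [|c']; [exact/f'd/AB|exact: pd_].
  rewrite pd_sum => [|c _]; last exact: (differentiableM (p'd c i) (cd c)).
  apply: eq_bigr => c _; rewrite (pdM _ (p'd c i) (cd c)); congr (_ + _).
  rewrite (@pd_comp _ _ _ (dp f c)); [|exact/f'd/AB|by move=> c'; exact: pd_].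
  by rewrite mulr_sumr; apply: eq_bigr => c' _; rewrite mulrA.
rewrite exchange_big -big_split /=; apply: eq_bigr => c _.
rewrite big_split /= addrC; congr (_ + _); last by rewrite mulr_suml.
by rewrite exchange_big; apply: eq_bigr => c' _; rewrite mulr_suml.
Qed.

End LapComp.

Section Model2.
Context {R : realType} {d k : nat}.
Implicit Types (y w : 'rV[R]_k) (a b c : 'I_k) (z : 'rV[R]_(d.+1 + k)).
Variables (J : 'I_d.+1 -> 'M[R]_k) (hJ : hypercomplex J) (kap : R).
Hypothesis kap0 : kap != 0.

Local Notation fsm := (@fsm R d k J kap).
Local Notation fsm_inv := (@fsm_inv R d k J kap).
Local Notation proj := (@proj R d k J).
Local Notation rho := (@rho R k).

(** The Laplacian of [fsm] for [kap] = 1. The first-order coefficient is 2, 0 and -4 over R, C and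
    H; over C it vanishes, as affine coordinates are harmonic on a Kaehler manifold. *)
Definition fslap (f : 'rV[R]_k -> R) y : R :=
  rho y * (\sum_a \sum_b ((a == b)%:R + proj y a b) * dp (dp f b) a y
    + (4 - 2 * d.+1%:R) * \sum_a y 0 a * dp f a y).

Lemma J_trace s : \sum_a J s a a = (s == 0)%:R * k%:R.
Proof.
have [->|s0] := eqVneq s 0.
  rewrite (hc_one hJ) mul1r; under eq_bigr do rewrite mxE eqxx.
  by rewrite sumr_const card_ord.
rewrite mul0r big1// => a _; have := J_skew hJ s a a; rewrite (negbTE s0) => h; lra.
Qed.

Lemma J_mulT s : J s *m (J s)^T = 1%:M.
Proof.
apply: (scalerI (_ : 2 != 0 :> R)); first by rewrite pnatr_eq0.
by rewrite scaler_nat mulr2n (hc_orth hJ) eqxx mulr1 scale_scalar_mx mulr1.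
Qed.

Lemma sum_sign (x : R) : \sum_(s < d.+1) (if s == 0 then 1 else -1) * x = (1 - d%:R) * x.
Proof.
rewrite -mulr_suml; congr (_ * _); rewrite (bigD1 0)//=; congr (_ + _).
rewrite (eq_bigr (fun=> -1)) => [|s /negbTE -> //].
rewrite sumr_const -mulNrn; congr (- _ *+ _).
by rewrite cardC1 card_ord.
Qed.

Lemma J_sqr s b y : (y *m J s *m J s) 0 b = (if s == 0 then 1 else -1) * y 0 b.
Proof.
have E : (J s)^T = (if s == 0 then 1 else -1) *: J s.
  by rewrite (hc_skew hJ); case: ifP; rewrite ?scale1r// scaleN1r.
have := J_mulT s; rewrite E -scalemxAr => /(congr1 (fun M => (y *m M) 0 b)).
rewrite mulmx1 -scalemxAr mulmxA mxE => <-.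
by case: ifP; rewrite ?mul1r// !mulN1r opprK.
Qed.

Lemma dproj_trace y b : \sum_a dproj J y a a b = (k%:R + 1 - d%:R) * y 0 b.
Proof.
rewrite exchange_big /=.
transitivity (\sum_s ((0 == s)%:R * (k%:R * (y *m J s) 0 b) + (if s == 0 then 1 else -1) * y 0 b)).
  apply: eq_bigr => s _; rewrite big_split /= -mulr_suml J_trace -J_sqr [(y *m J s *m J s) 0
    b]mxE (eq_sym s).
  by rewrite -mulrA.
rewrite big_split /= sum_sign (sum_delta (fun s => k%:R * (y *m J s) 0 b)) (Y0 hJ); ring.
Qed.

Lemma proj_y y b : \sum_a y 0 a * ((a == b)%:R + proj y a b) = rho y * y 0 b.
Proof.
under eq_bigr do rewrite mulrDr.
rewrite big_split /=; under eq_bigr do rewrite mulrC (eq_sym _ b).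
rewrite sum_delta /rho mulrDl mul1r; congr (_ + _).
rewrite -(Y0 hJ y b) -(proj_row hJ); apply: eq_bigr => a _.
by rewrite (Y0 hJ) proj_sym.
Qed.

(** In other words, the logarithmic derivative of the volume density, a constant multiple of
    rho^(-(d + 1 + k) / 2). *)
Lemma christoffel_trace y j :
  \sum_i christoffel fsm i i j y = - (rho y)^-1 * (d.+1%:R + k%:R) * y 0 j.
Proof.
under eq_bigr do rewrite (christoffel_fsm hJ kap0).
rewrite -mulr_sumr -mulrA; congr (_ * _); rewrite exchange_big /=.
transitivity (\sum_s (y 0 j + (0 == s)%:R * (k%:R * (y *m J s) 0 j))).
  apply: eq_bigr => s _; rewrite big_split /= -mulr_sumr J_trace (eq_sym s); congr (_ + _);
    last by ring.
  have := congr1 (fun M => (y *m M) 0 j) (J_mulT s); rewrite mulmx1 mulmxA mxE => <-.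
  by apply: eq_bigr => i _; rewrite [(J s)^T _ _]mxE.
rewrite big_split /= (sum_delta (fun s => k%:R * (y *m J s) 0 j)) (Y0 hJ) sumr_const card_ord.
by rewrite -mulr_natr; ring.
Qed.

Lemma hasdp_fsm_inv i a b y : hasdp (fun y => fsm_inv y a b) i y
  (kap^-1 * (2 * y 0 i * ((a == b)%:R + proj y a b) + rho y * dproj J y i a b)).
Proof.
have -> : (fun y => fsm_inv y a b) = fun y => kap^-1 * (rho y * ((a == b)%:R + proj y a b)).
  by apply/funext => z; rewrite mxE.
apply: hasdpZ; apply: hasdpM; first exact: hasdp_rho.
by apply: hasdp_eq (add0r _); apply: hasdpD; [exact: hasdp_cst|exact: hasdp_proj].
Qed.

Lemma gradE f l : grad fsm f l = fun y => \sum_s fsm_inv y l s * dp f s y.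
Proof.
by apply/funext => y; rewrite /grad (invmx_fsm hJ kap0) -dpE.
Qed.

(** In the first-order part, the divergence of [fsm_inv] gives 2 + (k + 1 - d) and the Christoffel
    trace subtracts d + 1 + k; the rest is 2 - 2 d = 4 - 2 (d + 1). *)
Lemma laplacian_fsm f y : Cr 2 setT f -> laplacian fsm f y = kap^-1 * fslap f y.
Proof.
move=> fC; have f'd c : differentiable (dp f c) y by exact: (Cr_differentiable (Cr_pd c fC)).
rewrite /laplacian /divg -dpE big_split /=.
have -> : \sum_i dp (grad fsm f i) i y = \sum_i \sum_s
   (kap^-1 * (2 * y 0 i * ((i == s)%:R + proj y i s) + rho y * dproj J y i i s) * dp f s y
    + fsm_inv y i s * dp (dp f s) i y).
  apply: eq_bigr => i _; rewrite gradE.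
  have H := @hasdp_sum R k _ (index_enum _) xpredT (fun s x => fsm_inv x i s * dp f s x) _ i y
    (fun s _ => hasdpM (hasdp_fsm_inv i i s y) (conj (f'd s) erefl)).
  exact: (proj2 H).
have -> : \sum_i \sum_j christoffel fsm i i j y * grad fsm f j y =
   - kap^-1 * (d.+1%:R + k%:R) * rho y * \sum_a y 0 a * dp f a y.
  rewrite exchange_big /=; under eq_bigr do rewrite -mulr_suml christoffel_trace gradE mulr_sumr.
  rewrite exchange_big /= mulr_sumr; apply: eq_bigr => s _.
  transitivity (- (rho y)^-1 * (d.+1%:R + k%:R) * kap^-1 * rho y * dp f s y *
     \sum_a y 0 a * ((a == s)%:R + proj y a s)).
    by rewrite mulr_sumr; apply: eq_bigr => a _; rewrite mxE; ring.
  by rewrite proj_y; field; rewrite rho_neq0 kap0.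
have -> : \sum_i \sum_s (kap^-1 * (2 * y 0 i * ((i == s)%:R + proj y i s) +
  rho y * dproj J y i i s) * dp f s y
    + fsm_inv y i s * dp (dp f s) i y) = 
   kap^-1 * (rho y * (2 + (k%:R + 1 - d%:R)) * \sum_a y 0 a * dp f a y
    + rho y * \sum_a \sum_b ((a == b)%:R + proj y a b) * dp (dp f b) a y).
  under eq_bigr do rewrite big_split; rewrite big_split mulrDr /=; congr (_ + _); last first.
    rewrite mulrA mulr_sumr; apply: eq_bigr => a _; rewrite mulr_sumr.
    by apply: eq_bigr => b _; rewrite mxE; ring.
  rewrite exchange_big /= mulrA mulr_sumr; apply: eq_bigr => s _.
  transitivity (kap^-1 * dp f s y * (2 * (\sum_i y 0 i * ((i == s)%:R + proj y i s))
     + rho y * \sum_i dproj J y i i s)).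
    rewrite !mulr_sumr -big_split mulr_sumr; apply: eq_bigr => i _ /=; ring.
  by rewrite proj_y dproj_trace; ring.
by rewrite /fslap -[d.+1]addn1 natrD; field.
Qed.

(* Affine coordinates of the class of (a, v) with respect to right
   multiplication: v a^-1, where a^-1 is the conjugate of a over |a|^2. *)
Definition Amx (u : 'rV[R]_d.+1) : 'M[R]_k := \sum_s u 0 s *: J s.

Definition aff c z : R := (rsubmx z *m (Amx (lsubmx z))^T) 0 c / nsq (lsubmx z).

Definition affrow z : 'rV[R]_k := \row_c aff c z.

Lemma AmxT u : (Amx u)^T = \sum_s u 0 s *: (J s)^T.
Proof. by rewrite /Amx linear_sum; apply: eq_bigr => s _; rewrite linearZ. Qed.

Lemma Amx_J u t : Amx u *m (J t)^T + J t *m (Amx u)^T = (2 * u 0 t)%:M.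
Proof.
rewrite AmxT /Amx mulmx_suml mulmx_sumr -big_split /=.
transitivity (\sum_s (t == s)%:R *: (2 * u 0 s)%:M : 'M[R]_k).
  apply: eq_bigr => s _; rewrite -scalemxAl -scalemxAr -scalerDr (hc_orth hJ) !scale_scalar_mx.
  by congr (_ %:M); rewrite (eq_sym s); ring.
rewrite (bigD1 t)//= eqxx scale1r big1 ?addr0// => s st.
by rewrite eq_sym (negbTE st) scale0r.
Qed.

Lemma Amx_norm u : Amx u *m (Amx u)^T = (nsq u)%:M.
Proof.
apply: (scalerI (_ : 2 != 0 :> R)); first by rewrite pnatr_eq0.
have E1 : Amx u *m (Amx u)^T = \sum_t u 0 t *: (Amx u *m (J t)^T).
  by rewrite AmxT mulmx_sumr; apply: eq_bigr => t _; rewrite scalemxAr.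
have E2 : Amx u *m (Amx u)^T = \sum_t u 0 t *: (J t *m (Amx u)^T).
  by rewrite {1}/Amx mulmx_suml; apply: eq_bigr => t _; rewrite scalemxAl.
rewrite scaler_nat mulr2n {1}E1 E2 -big_split /=.
transitivity (\sum_t u 0 t *: (2 * u 0 t)%:M : 'M[R]_k).
  by apply: eq_bigr => t _; rewrite -Amx_J scalerDr.
rewrite scale_scalar_mx /nsq mulr_sumr raddf_sum; apply: eq_bigr => t _.
by rewrite scale_scalar_mx; congr (_ %:M); ring.
Qed.

Lemma Amx_normV u : u != 0 -> (Amx u)^T *m Amx u = (nsq u)%:M.
Proof.
rewrite -nsq_eq0 => u0; have : ((nsq u)^-1 *: Amx u) *m (Amx u)^T = 1%:M.
  by rewrite -scalemxAl Amx_norm scale_scalar_mx mulVf.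
move=> /mulmx1C; rewrite -scalemxAr => /(congr1 (fun M => nsq u *: M)).
by rewrite scalerA mulfV// scale1r scale_scalar_mx mulr1.
Qed.

Lemma affrowE z : affrow z = (nsq (lsubmx z))^-1 *: (rsubmx z *m (Amx (lsubmx z))^T).
Proof. by apply/rowP => c; rewrite [LHS]mxE [RHS]mxE mulrC. Qed.

Lemma affrow_mul z : lsubmx z != 0 -> affrow z *m Amx (lsubmx z) = rsubmx z.
Proof.
move=> u0; rewrite affrowE -scalemxAl -mulmxA Amx_normV// mul_mx_scalar scalerA mulVf ?scale1r//.
by rewrite nsq_eq0.
Qed.

Lemma nsq_split z : nsq z = nsq (lsubmx z) + nsq (rsubmx z).
Proof.
by rewrite /nsq big_split_ord /=; congr (_ + _); apply: eq_bigr => i _; rewrite mxE.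
Qed.

Lemma nsq_Amx y u : nsq (y *m Amx u) = nsq u * nsq y.
Proof.
rewrite !nsq_dot trmx_mul mulmxA -(mulmxA y) Amx_norm mul_mx_scalar -scalemxAl mxE.
by rewrite nsq_dot.
Qed.

Lemma nsq_affrow z : lsubmx z != 0 -> nsq z = nsq (lsubmx z) * rho (affrow z).
Proof.
by move=> u0; rewrite nsq_split -{1}(affrow_mul u0) nsq_Amx /rho; ring.
Qed.

Definition chart_dom : set 'rV[R]_(d.+1 + k) := [set z | lsubmx z != 0].

Lemma Cr_lsub n (A : set 'rV[R]_(d.+1 + k)) : open A -> Cr n A (fun z => nsq (lsubmx z)).
Proof.
move=> oA; apply: (@Cr_eq _ _ _ _ (fun z => \sum_s z 0 (lshift k s) * z 0 (lshift k s))) => //.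
  by move=> z _; apply: eq_bigr => s _; rewrite mxE expr2.
by apply: Cr_sum => // s _; apply: CrM => //; exact: Cr_coord.
Qed.

Lemma open_chart_dom : open chart_dom.
Proof.
have -> : chart_dom = (fun z => nsq (lsubmx z)) @^-1` [set t | 0 < t].
  by apply/seteqP; split => z /=; rewrite /chart_dom /= -nsq_gt0.
apply: open_comp => [z _|]; last exact: open_gt.
exact: (@Cr_continuous _ 0 _ setT _ z (@Cr_lsub 0 setT openT)).
Qed.

Definition affnum c z : R := (rsubmx z *m (Amx (lsubmx z))^T) 0 c.

Lemma affnumE c z : affnum c z =
  \sum_s z 0 (lshift k s) * \sum_j z 0 (rshift d.+1 j) * J s c j.
Proof.
rewrite /affnum AmxT mulmx_sumr summxE; apply: eq_bigr => s _.
rewrite -scalemxAr !mxE; congr (_ * _); apply: eq_bigr => j _.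
by rewrite !mxE.
Qed.

Lemma rsub_J s c z : \sum_j z 0 (rshift d.+1 j) * J s c j = (rsubmx z *m (J s)^T) 0 c.
Proof. by rewrite mxE; apply: eq_bigr => j _; rewrite !mxE. Qed.

Lemma Cr_aff n c : Cr n chart_dom (aff c).
Proof.
have oD := open_chart_dom.
have nC : Cr n chart_dom (fun z => nsq (lsubmx z)) by exact: Cr_lsub.
apply: (@Cr_eq _ _ _ _ (fun z => affnum c z * nsq (lsubmx z) `^ (-1))) => //.
  by move=> z z0; rewrite powR_inv1// nsq_ge0.
apply: CrM => //; last by apply: Cr_powR => // z z0; rewrite nsq_gt0.
have -> : affnum c = fun z => \sum_s z 0 (lshift k s) * \sum_j z 0 (rshift d.+1 j) * J s c j.
  by apply/funext => z; exact: affnumE.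
apply: Cr_sum => // s _; apply: CrM => //; first exact: Cr_coord.
by apply: Cr_sum => // j _; apply: CrM => //; [exact: Cr_coord|exact: Cr_cst].
Qed.

Lemma lr_eq (t : 'I_d.+1) (j : 'I_k) : (lshift k t == rshift d.+1 j) = false.
Proof. by apply/negbTE/eqP => /(congr1 val) /= E; have := ltn_ord t; rewrite E ltnNge leq_addr. Qed.

Lemma hasdp_coord_l t t' z : hasdp (fun x : 'rV[R]_(d.+1 +
  k) => x 0 (lshift k t')) (lshift k t) z (t == t')%:R.
Proof. by apply: hasdp_eq (hasdp_coord _ _ _) _; rewrite (inj_eq (@lshift_inj _ _)). Qed.

Lemma hasdp_coord_lr t' j z : hasdp (fun x : 'rV[R]_(d.+1 +
  k) => x 0 (lshift k t')) (rshift d.+1 j) z 0.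
Proof. by apply: hasdp_eq (hasdp_coord _ _ _) _; rewrite eq_sym lr_eq. Qed.

Lemma hasdp_nu_l t z : hasdp (fun x : 'rV[R]_(d.+1 +
  k) => nsq (lsubmx x)) (lshift k t) z (2 * z 0 (lshift k t)).
Proof.
have -> : (fun x : 'rV[R]_(d.+1 + k) => nsq (lsubmx x)) =
    (fun x => \sum_s x 0 (lshift k s) * x 0 (lshift k s)).
  by apply/funext => x; apply: eq_bigr => s _; rewrite mxE expr2.
apply: hasdp_eq.
  by apply: hasdp_sum => s _; apply: hasdpM; exact: hasdp_coord_l.
transitivity (\sum_s (t == s)%:R * (2 * z 0 (lshift k s))); first by apply: eq_bigr => s _; ring.
by rewrite sum_delta.
Qed.

Lemma hasdp_nu_r j z : hasdp (fun x : 'rV[R]_(d.+1 + k) => nsq (lsubmx x)) (rshift d.+1 j) z 0.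
Proof.
have -> : (fun x : 'rV[R]_(d.+1 + k) => nsq (lsubmx x)) =
    (fun x => \sum_s x 0 (lshift k s) * x 0 (lshift k s)).
  by apply/funext => x; apply: eq_bigr => s _; rewrite mxE expr2.
apply: hasdp_eq.
  by apply: hasdp_sum => s _; apply: hasdpM; exact: hasdp_coord_lr.
by rewrite big1// => s _; ring.
Qed.

Lemma hasdp_coord_r j j' z : hasdp (fun x : 'rV[R]_(d.+1 +
  k) => x 0 (rshift d.+1 j')) (rshift d.+1 j) z (j == j')%:R.
Proof. by apply: hasdp_eq (hasdp_coord _ _ _) _; rewrite (inj_eq (@rshift_inj _ _)). Qed.

Lemma hasdp_coord_rl j' t z : hasdp (fun x : 'rV[R]_(d.+1 +
  k) => x 0 (rshift d.+1 j')) (lshift k t) z 0.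
Proof. by apply: hasdp_eq (hasdp_coord _ _ _) _; rewrite lr_eq. Qed.

Lemma hasdp_rJ_l s c t z :
  hasdp (fun x : 'rV[R]_(d.+1 + k) => \sum_j x 0 (rshift d.+1 j) * J s c j) (lshift k t) z 0.
Proof.
apply: hasdp_eq.
  by apply: hasdp_sum => j _; apply: hasdpM; [exact: hasdp_coord_rl|exact: hasdp_cst].
by rewrite big1// => j _; ring.
Qed.

Lemma hasdp_rJ_r s c j z :
  hasdp (fun x : 'rV[R]_(d.+1 + k) => \sum_j x 0 (rshift d.+1 j) * J s c j) (rshift d.+1 j) z (J
    s c j).
Proof.
apply: hasdp_eq.
  by apply: hasdp_sum => j' _; apply: hasdpM; [exact: hasdp_coord_r|exact: hasdp_cst].
transitivity (\sum_j' (j == j')%:R * J s c j'); first by apply: eq_bigr => j' _; ring.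
by rewrite sum_delta.
Qed.

Lemma affnum_fun c : affnum c = fun z => \sum_s z 0 (lshift k s) * \sum_j z 0 (rshift d.+1 j) *
  J s c j.
Proof. by apply/funext => z; exact: affnumE. Qed.

Lemma hasdp_affnum_l c t z : hasdp (affnum c) (lshift k t) z ((rsubmx z *m (J t)^T) 0 c).
Proof.
rewrite affnum_fun; apply: hasdp_eq.
  by apply: hasdp_sum => s _; apply: hasdpM; [exact: hasdp_coord_l|exact: hasdp_rJ_l].
transitivity (\sum_s (t == s)%:R * (rsubmx z *m (J s)^T) 0 c).
  by apply: eq_bigr => s _; rewrite rsub_J; ring.
by rewrite sum_delta.
Qed.

Lemma hasdp_affnum_r c j z : hasdp (affnum c) (rshift d.+1 j) z (Amx (lsubmx z) c j).
Proof.
rewrite affnum_fun; apply: hasdp_eq.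
  by apply: hasdp_sum => s _; apply: hasdpM; [exact: hasdp_coord_lr|exact: hasdp_rJ_r].
by rewrite /Amx summxE; apply: eq_bigr => s _; rewrite !mxE mul0r add0r.
Qed.

Let nu z := nsq (lsubmx z).

Lemma nu_neq0 z : chart_dom z -> nu z != 0.
Proof. by move=> z0; rewrite /nu nsq_eq0. Qed.

Lemma dp_aff_l c t z : chart_dom z -> dp (aff c) (lshift k t) z =
  (rsubmx z *m (J t)^T) 0 c / nu z - 2 * z 0 (lshift k t) * affnum c z / nu z ^+ 2.
Proof.
move=> z0; have n0 := nu_neq0 z0.
have [_ ->] := hasdpM (hasdp_affnum_l c t z) (hasdpV n0 (hasdp_nu_l t z)).
by field.
Qed.

Lemma dp_aff_r c j z : chart_dom z -> dp (aff c) (rshift d.+1 j) z = Amx (lsubmx z) c j / nu z.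
Proof.
move=> z0; have n0 := nu_neq0 z0.
have [_ ->] := hasdpM (hasdp_affnum_r c j z) (hasdpV n0 (hasdp_nu_r j z)).
by field.
Qed.

Lemma dp2_aff_r c j z : chart_dom z -> dp (dp (aff c) (rshift d.+1 j)) (rshift d.+1 j) z = 0.
Proof.
move=> z0; have n0 := nu_neq0 z0.
rewrite (@pd_eq _ _ chart_dom _ (fun x => (\sum_s x 0 (lshift k s) * J s c j) * (nu x)^-1) _ _
  open_chart_dom)//.
  have h : hasdp (fun x : 'rV[R]_(d.+1 + k) => \sum_s x 0 (lshift k s) * J s c j) (rshift d.+1
    j) z 0.
    apply: hasdp_eq.
      by apply: hasdp_sum => s _; apply: hasdpM; [exact: hasdp_coord_lr|exact: hasdp_cst].
    by rewrite big1// => s _; ring.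
  by have [_ ->] := hasdpM h (hasdpV n0 (hasdp_nu_r j z)); ring.
move=> x x0; rewrite dp_aff_r// /Amx summxE; congr (_ / _).
by apply: eq_bigr => s _; rewrite !mxE.
Qed.

Lemma dp2_aff_l c t z : chart_dom z -> dp (dp (aff c) (lshift k t)) (lshift k t) z =
  - 4 * (z 0 (lshift k t) * (rsubmx z *m (J t)^T) 0 c) / nu z ^+ 2 - 2 * affnum c z / nu z ^+ 2
  + 8 * z 0 (lshift k t) ^+ 2 * affnum c z / nu z ^+ 3.
Proof.
move=> z0; have n0 := nu_neq0 z0.
pose K (x : 'rV[R]_(d.+1 + k)) := \sum_j x 0 (rshift d.+1 j) * J t c j.
rewrite (@pd_eq _ _ chart_dom _ (fun x => K x * (nu x)^-1
   - (2 * x 0 (lshift k t) * affnum c x) * ((nu x)^-1 * (nu x)^-1)) _ _ open_chart_dom)//.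
  have V := hasdpV n0 (hasdp_nu_l t z).
  have hK : hasdp K (lshift k t) z 0 by exact: hasdp_rJ_l.
  have [_ ->] := hasdpB (hasdpM hK V) (hasdpM (hasdpM (hasdpZ 2 (hasdp_coord_l t t z))
    (hasdp_affnum_l c t z)) (hasdpM V V)).
  by rewrite eqxx /K rsub_J -/(nu z) /=; field.
by move=> x x0; rewrite dp_aff_l// /K rsub_J -exprVn expr2.
Qed.

(** The v-directions contribute nothing because v enters linearly. Among the a-directions the
    quotient rule gives -4, -2 (d + 1) and +8, which is the first-order coefficient of [fslap]. *)
Lemma lap_aff c z : chart_dom z -> lap (aff c) z = (4 - 2 * d.+1%:R) * aff c z / nu z.
Proof.
move=> z0; have n0 := nu_neq0 z0.
rewrite /lap big_split_ord /= [X in _ + X]big1 ?addr0 => [|j _]; last exact: dp2_aff_r.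
under eq_bigr => t _ do rewrite dp2_aff_l//.
rewrite big_split sumrB /= -!mulr_suml -!mulr_sumr.
have -> : \sum_t z 0 (lshift k t) * (rsubmx z *m (J t)^T) 0 c = affnum c z.
  by rewrite affnumE; apply: eq_bigr => t _; rewrite rsub_J.
have -> : \sum_t z 0 (lshift k t) ^+ 2 = nu z by apply: eq_bigr => t _; rewrite mxE.
rewrite sumr_const card_ord -mulr_natr /aff -/(affnum c z) -/(nu z).
by field.
Qed.

(** As 1 / nu = rho / |z|^2, these are the entries of the inverse metric over |z|^2: affine
    coordinates are a Riemannian submersion up to that factor. The v-directions give the identity
    through [Amx_norm], the a-directions give [proj] through [hc_norm]. *)
Lemma grad_aff c c' z : chart_dom z -> \sum_i dp (aff c) i z * dp (aff c') i z =
  ((c == c')%:R + proj (affrow z) c c') / nu z.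
Proof.
move=> z0; have n0 := nu_neq0 z0.
rewrite big_split_ord /= addrC mulrDl; congr (_ + _).
  transitivity ((Amx (lsubmx z) *m (Amx (lsubmx z))^T) c c' / nu z ^+ 2).
    rewrite mxE mulr_suml; apply: eq_bigr => j _; rewrite !dp_aff_r// [in RHS]mxE.
    by field.
  by rewrite Amx_norm mxE -/(nu z); case: (c == c'); rewrite ?mulr1n ?mulr0n; field.
set w := affrow z; set u := lsubmx z.
(* With v = w A, [Amx_J] rewrites v J_t^T as 2 u_t w - w J_t A^T; the first term cancels the
   derivative of the denominator. *)
have E c0 t : dp (aff c0) (lshift k t) z = - (w *m J t *m (Amx u)^T) 0 c0 / nu z.
  rewrite dp_aff_l//.
  have -> : (rsubmx z *m (J t)^T) 0 c0 = 2 * z 0 (lshift k t) * w 0 c0 - (w *m J t *m (Amx u)^T)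
    0 c0.
    rewrite -(affrow_mul z0) -/u -/w -!mulmxA; have := Amx_J u t.
    move=> /eqP; rewrite eq_sym -subr_eq => /eqP <-.
    by rewrite mulmxBr mul_mx_scalar [LHS]mxE !mxE.
  by rewrite /w mxE /aff -/(affnum c0 z) -/u -/(nu z); field.
transitivity ((\sum_t (w *m J t *m (Amx u)^T) 0 c * (w *m J t *m (Amx u)^T) 0 c') / nu z ^+ 2).
  by rewrite mulr_suml; apply: eq_bigr => t _; rewrite !E; field.
by rewrite (hc_norm hJ w u c c') -/(proj w c c') -/(nu z); field.
Qed.

(** By [grad_aff] and [lap_aff], the chain rule has the coefficients of [fslap] with the factor rho
    replaced by 1 / nu, and 1 / nu = rho / |z|^2. *)
Lemma lap_affrow f z : chart_dom z -> Cr 2 setT f ->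
  lap (fun x => f (affrow x)) z = fslap f (affrow z) / nsq z.
Proof.
move=> z0 fC; have n0 := nu_neq0 z0.
rewrite (@lap_comp _ _ _ _ setT _ _ _ open_chart_dom z0 _ (Cr_aff 2) fC)// -/(affrow z).
under eq_bigr => c _ do under eq_bigr => c' _ do rewrite grad_aff// mulrAC.
under [X in _ + X]eq_bigr => c _ do rewrite lap_aff//.
rewrite /fslap (nsq_affrow z0) -/(nu z).
under eq_bigr => c _ do rewrite -mulr_suml.
rewrite -mulr_suml.
have -> : \sum_c (4 - 2 * d.+1%:R) * aff c z / nu z * dp f c (affrow z) =
   (4 - 2 * d.+1%:R) * (\sum_a affrow z 0 a * dp f a (affrow z)) / nu z.
  by rewrite mulr_sumr mulr_suml; apply: eq_bigr => c _; rewrite [affrow z 0 c]mxE; ring.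
have -> : \sum_c \sum_c' ((c == c')%:R + proj (affrow z) c c') * dp (dp f c) c' (affrow z) =
   \sum_a \sum_b ((a == b)%:R + proj (affrow z) a b) * dp (dp f b) a (affrow z).
  rewrite exchange_big; apply: eq_bigr => a _; apply: eq_bigr => b _.
  by rewrite proj_sym (eq_sym b).
by field; rewrite n0 rho_neq0.
Qed.

End Model2.

(** * Functions on the cone glued from charts *)

Section Charts.
Context {R : realType} {d k : nat}.
Local Notation V := 'rV[R]_(d.+1 + k).
Variables (J : 'I_d.+1 -> 'M[R]_k) (hJ : hypercomplex J).

Lemma lap_orth p (B : set 'rV[R]_p) (h : 'rV[R]_p -> R) (O : 'M[R]_p) x :
  open B -> Cr 2 B h -> O^T *m O = 1%:M -> B (x *m O) ->
  lap (fun y => h (y *m O)) x = lap h (x *m O).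
Proof.
move=> oB hC OO Bx; pose phi c (y : 'rV[R]_p) := (y *m O) 0 c.
have rE y : \row_c phi c y = y *m O by apply/rowP => c; rewrite mxE.
pose A := [set y | B (y *m O)].
have oA : open A.
  apply: open_comp => // y _.
  have -> : (fun y => y *m O) = (fun y => \row_c phi c y) by apply/funext => z; rewrite rE.
  by apply: continuous_row => c; apply: (@Cr_continuous _ 0 _ setT _ y (@Cr_lin _ _ 0 _ _ O c
    openT)).
have -> : (fun y => h (y *m O)) = (fun y => h (\row_c phi c y)).
  by apply/funext => y; rewrite rE.
have pC c : Cr 2 A (phi c) by exact: Cr_lin.
rewrite (@lap_comp _ _ _ A B h phi x oA Bx _ pC hC); last by move=> y Ay; rewrite rE.
have dE c i y : dp (phi c) i y = O i c by have [_ ->] := hasdp_lin O c i y.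
rewrite [X in _ + X]big1 => [|c _]; last first.
  rewrite /lap big1 ?mul0r// => i _.
  have -> : dp (phi c) i = fun=> O i c by apply/funext => y.
  exact: pd_cst.
rewrite addr0 rE; apply: eq_bigr => c _.
transitivity (\sum_c' (c == c')%:R * dp (dp h c) c' (x *m O)); last by rewrite sum_delta.
apply: eq_bigr => c' _; congr (_ * _).
have /matrixP/(_ c c') := OO; rewrite !mxE => <-.
by apply: eq_bigr => i _; rewrite !dE mxE.
Qed.

Lemma affrowZ (a : R) (z : V) : a != 0 -> affrow J (a *: z) = affrow J z.
Proof.
move=> a0; rewrite !affrowE !linearZ /= nsqZ.
have -> : Amx J (a *: lsubmx z) = a *: Amx J (lsubmx z).
  by rewrite /Amx scaler_sumr; apply: eq_bigr => s _; rewrite mxE scalerA.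
rewrite linearZ /= -scalemxAl -scalemxAr !scalerA; congr (_ *: _).
by rewrite invfM; move: (nsq _)^-1 => t; field.
Qed.

Definition emb (v : 'rV[R]_k) : V := row_mx (delta_mx 0 0) v.

Lemma lsub_emb v : lsubmx (emb v) = delta_mx 0 0.
Proof. exact: row_mxKl. Qed.

Lemma nsq_delta p (i : 'I_p) : nsq (delta_mx 0 i : 'rV[R]_p) = 1.
Proof.
rewrite /nsq (bigD1 i)//= big1 ?mxE ?eqxx ?expr1n ?addr0// => j ji.
by rewrite mxE (negbTE ji) andbF expr0n.
Qed.

Lemma delta_neq0 p (i : 'I_p) : delta_mx 0 i != 0 :> 'rV[R]_p.
Proof. by rewrite -nsq_gt0 nsq_delta. Qed.

Lemma emb_dom v : chart_dom (emb v).
Proof. by rewrite /chart_dom /= lsub_emb delta_neq0. Qed.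

Lemma affrow_emb v : affrow J (emb v) = v.
Proof.
rewrite affrowE lsub_emb nsq_delta invr1 scale1r row_mxKr.
suff -> : Amx J (delta_mx 0 0) = 1%:M by rewrite trmx1 mulmx1.
rewrite /Amx -(hc_one hJ) (bigD1 0)//= big1 => [|s s0]; first by rewrite addr0 mxE !eqxx scale1r.
by rewrite mxE (negbTE s0) scale0r.
Qed.

Lemma nsq_emb v : nsq (emb v) = rho v.
Proof.
by rewrite (nsq_affrow hJ (emb_dom v)) lsub_emb nsq_delta affrow_emb mul1r.
Qed.

(** Two cones are substituted for D: [chart_dom] for projective spaces, which contains - z with z,
    and an open half space for spheres, where a chart sees one hemisphere only. *)
Variable D : set V.
Hypothesis oD : open D.
Hypothesis D_dom : D `<=` chart_dom.
Hypothesis D_cone : forall (a : R) z, 0 < a -> D z -> D (a *: z).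

Lemma lap_affrow_cone f z : D z -> Cr 2 setT f ->
  lap (fun x => f (affrow J x)) z = fslap J f (affrow J z) / nsq z.
Proof. by move=> Dz; exact: (lap_affrow hJ (D_dom Dz)). Qed.

Section Gap.
Variables (lam : R) (g : V -> R) (I : Type) (O : I -> 'M[R]_(d.+1 + k)) (f : I -> 'rV[R]_k -> R).
Hypothesis O_orth : forall i, (O i)^T *m O i = 1%:M.
Hypothesis f_smooth : forall i, smooth (f i).
Hypothesis f_eigen : forall i v, fslap J (f i) v + lam * f i v = 0.
Hypothesis g_loc : forall i x, D (x *m O i) -> g x = f i (affrow J (x *m O i)).
Hypothesis D_cover : forall x, x != 0 -> exists i, D (x *m O i).

Let DI i : set V := [set x | D (x *m O i)].

Let oDI i : open (DI i).
Proof.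
apply: open_comp => // y _.
pose phi c (y : V) := (y *m O i) 0 c.
have -> : (fun y => y *m O i) = (fun y => \row_c phi c y).
  by apply/funext => z; apply/rowP => c; rewrite mxE.
by apply: continuous_row => c; apply: (@Cr_continuous _ 0 _ setT _ y (@Cr_lin _ _ 0 _ _ (O i) c
  openT)).
Qed.

Let fa_Cr n i : Cr n D (fun z => f i (affrow J z)).
Proof.
apply: (@Cr_comp _ n _ _ D setT (f i) (@aff R d k J)) => //.
  exact: smooth_Cr.
by move=> c; apply: CrS D_dom _; exact: Cr_aff.
Qed.

(** Near each nonzero x the lift g is a single chart expression composed with a rotation and
    [affrow]. *)
Lemma chart_Cr n : Cr n (@punct R (d.+1 + k)) g.
Proof.
apply: Cr_local => x x0; have [i Dx] := D_cover x0; exists (DI i); split => //.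
apply: (@Cr_eq _ _ _ _ (fun x => f i (affrow J (x *m O i)))) => //.
  by move=> y Dy; rewrite -g_loc.
pose phi c (y : V) := (y *m O i) 0 c.
have rE y : \row_c phi c y = y *m O i by apply/rowP => c; rewrite mxE.
have -> : (fun x => f i (affrow J (x *m O i))) = fun x => f i (affrow J (\row_c phi c x)).
  by apply/funext => y; rewrite rE.
apply: (@Cr_comp _ n _ _ (DI i) D (fun z => f i (affrow J z)) phi) => //.
  by move=> y Dy; rewrite rE.
by move=> c; exact: Cr_lin.
Qed.

Lemma chart_homog (a : R) x : 0 < a -> x != 0 -> g (a *: x) = g x.
Proof.
move=> a0 x0; have [i Dx] := D_cover x0.
rewrite (@g_loc i); last by rewrite -scalemxAl; exact: D_cone.
by rewrite -scalemxAl affrowZ ?gt_eqF// -g_loc.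
Qed.

(** The frame is orthogonal, so it changes neither the Laplacian nor |x|, and the cone formula may
    be used in any one chart that contains x. *)
Lemma chart_lap x : x != 0 -> lap g x = - lam / nsq x * g x.
Proof.
move=> x0; have [i Dx] := D_cover x0.
rewrite (@lap_eq _ _ (DI i) g (fun x => f i (affrow J (x *m O i)))) => [||y Dy|//];
  last exact: g_loc.
  rewrite (lap_orth oD (fa_Cr 2 i) (O_orth i) Dx) lap_affrow_cone//; last exact: smooth_Cr.
  rewrite (g_loc Dx) -[fslap _ _ _](addrK (lam * f i (affrow J (x *m O i)))) f_eigen.
  suff -> : nsq (x *m O i) = nsq x by ring.
  by rewrite !nsq_dot trmx_mul mulmxA -(mulmxA x) (mulmx1C (O_orth i)) mulmx1.
exact: oDI.
Qed.

Hypothesis dim4 : (4 < d.+1 + k)%N.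

Lemma chart_neg : lam < 0 -> forall x, x != 0 -> g x = 0.
Proof. exact: (eigen_neg (chart_Cr 4) chart_homog chart_lap). Qed.

Lemma chart_gap1 : 0 <= lam < (d.+1 + k)%:R - 1 -> const_on_punct g.
Proof. exact: (eigen_gap1 dim4 (chart_Cr 4) chart_homog chart_lap). Qed.

(** Since x and - x have the same affine coordinates, a symmetric D makes g even, as [eigen_gap2]
    requires. *)
Lemma chart_gap2 : (forall z, D z -> D (- z)) -> 0 <= lam < 2 * (d.+1 + k)%:R -> const_on_punct g.
Proof.
move=> Ds; apply: (eigen_gap2 dim4 (chart_Cr 4) chart_homog chart_lap) => x x0.
have [i Dx] := D_cover x0.
have m1 : -1 != 0 :> R by rewrite oppr_eq0 oner_eq0.
rewrite (@g_loc i); last by rewrite mulNmx; exact: Ds.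
by rewrite mulNmx -scaleN1r affrowZ// -g_loc.
Qed.

End Gap.

Section Eigen.
Variables (h : V -> R) (s : R).
Hypothesis hC : forall n, Cr n setT h.
Hypothesis h0 : forall z, lap h z = 0.
Hypothesis h_aff : forall z, D z ->
  h z = nsq (lsubmx z) `^ (s / 2) * h (emb (affrow J z)).
Hypothesis D_emb : forall v, D (emb v).

Let F v := rho v `^ (- (s / 2)) * h (emb v).

Let F_Cr n : Cr n setT F.
Proof.
apply: CrM; first exact: openT.
  apply: Cr_powR; [exact: openT|by move=> v _; exact: rho_gt0|].
  by apply: CrD; [exact: openT|exact: Cr_cst|exact: (Cr_nsq _ openT)].
pose phi c (v : 'rV[R]_k) := emb v 0 c.
have rE v : \row_c phi c v = emb v by apply/rowP => c; rewrite mxE.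
have -> : (fun v => h (emb v)) = fun v => h (\row_c phi c v) by apply/funext => v; rewrite rE.
apply: (@Cr_comp _ n _ _ setT setT) => //; first exact: openT.
move=> c; case: (split_ordP c) => i ->.
  have -> : phi (lshift k i) = fun=> (delta_mx 0 0 : 'rV[R]_d.+1) 0 i.
    by apply/funext => v; rewrite /phi row_mxEl.
  exact: Cr_cst.
have -> : phi (rshift d.+1 i) = fun v : 'rV[R]_k => v 0 i.
  by apply/funext => v; rewrite /phi row_mxEr.
exact: Cr_coord.
Qed.

Lemma chart_smooth : smooth F.
Proof. exact: Cr_smooth. Qed.

(** [lap_nsqXM] read backwards: h = |z|^s g is harmonic and g is F in affine coordinates. The
    identity is taken at [emb v], where |z|^2 = rho v; the factor rho^(- s / 2) in F normalises
    [emb v] to length 1. *)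
Lemma chart_eigen v : fslap J F v + s * (s + (d.+1 + k)%:R - 2) * F v = 0.
Proof.
pose g z := F (affrow J z).
have hg z : D z -> h z = nsq z `^ (s / 2) * g z.
  move=> Dz; rewrite h_aff// /g /F (nsq_affrow hJ (D_dom Dz)) powRM ?nsq_ge0 ?ltW ?rho_gt0//.
  rewrite powRN -mulrA mulVKf//.
  by rewrite gt_eqF// powR_gt0// rho_gt0.
have DP : D `<=` @punct R (d.+1 + k).
  move=> z /D_dom; apply: contraNneq => ->; by rewrite linear0.
have gC : Cr 2 D g.
  apply: (@Cr_comp _ 2 _ _ D setT F (@aff R d k J)) => //.
  by move=> c; apply: CrS D_dom _; exact: Cr_aff.
have := h0 (emb v).
rewrite (@lap_eq _ _ D h _ _ oD hg (D_emb v)) (lap_nsqXM s oD DP (D_emb v) gC); last first.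
  by move=> a y a0 Dy; rewrite /g affrowZ// gt_eqF.
rewrite (lap_affrow_cone (D_emb v) (F_Cr 2)) affrow_emb nsq_emb /g affrow_emb => /eqP.
rewrite mulf_eq0 => /orP[|/eqP E]; first by rewrite gt_eqF// powR_gt0// rho_gt0.
have r0 := rho_neq0 v.
transitivity (rho v * (fslap J F v / rho v + s * (s + (d.+1 + k)%:R - 2) / rho v * F v));
  first by field.
by rewrite E mulr0.
Qed.

End Eigen.
End Charts.

(** * Right multiplications over R, C and H *)

Section Instances.
Context {R : realType}.

Lemma hypercomplex_real k : hypercomplex (fun _ : 'I_1 => 1%:M : 'M[R]_k).
Proof.
split=> //.
- by move=> s; rewrite ord1 eqxx trmx1.
- by move=> s t; rewrite !ord1 eqxx trmx1 mulmx1 mulr1 -[_ +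
  _]mulr2n -scaler_nat scale_scalar_mx mulr1.
- by move=> y r a b; rewrite !big_ord1 ord1 eqxx trmx1 !mulmx1 /=; ring.
- move=> y u a b /=; rewrite /nsq !big_ord1 linearZ /= trmx1 !mulmx1 -!scalemxAr !mulmx1 !mxE.
  by ring.
Qed.

Section Blocks.
Context {d q : nat}.
Variable B : 'I_d.+1 -> 'M[R]_q.
Hypothesis B_one : B 0 = 1%:M.
Hypothesis B_skew : forall s, (B s)^T = if s == 0 then B s else - B s.
Hypothesis B_orth : forall s t, B s *m (B t)^T + B t *m (B s)^T = (2 * (s == t)%:R)%:M.
Hypothesis B_alt : forall (x y : 'rV[R]_q) r a b,
  \sum_t ((x *m B t) 0 a * (y *m B r *m (B t)^T) 0 b
          + (y *m B t) 0 b * (x *m B r *m (B t)^T) 0 a) =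
  2 * (x 0 a * (y *m B r) 0 b + y 0 b * (x *m B r) 0 a)
  - 2 * (r == 0)%:R * \sum_t (x *m B t) 0 a * (y *m B t) 0 b.
Hypothesis B_norm : forall (x y : 'rV[R]_q) (u : 'rV[R]_d.+1) a b,
  let A := \sum_s u 0 s *: B s in
  \sum_t (x *m B t *m A^T) 0 a * (y *m B t *m A^T) 0 b =
  nsq u * \sum_t (x *m B t) 0 a * (y *m B t) 0 b.

Variable n : nat.

(** Vectors of length n q are n x q matrices through [mxvec], and M acts on the right of every
    row. *)
Definition blockJ (M : 'M[R]_q) : 'M[R]_(n * q) := lin_mulmxr M.

Lemma mul_blockJ (y : 'rV[R]_(n * q)) M : y *m blockJ M = mxvec (vec_mx y *m M).
Proof. by rewrite mul_rV_lin. Qed.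

Lemma mul_blockJE (y : 'rV[R]_(n * q)) M i j :
  (y *m blockJ M) 0 (mxvec_index i j) = (row i (vec_mx y) *m M) 0 j.
Proof. by rewrite mul_blockJ mxvecE -row_mul [RHS]mxE. Qed.

Lemma blockJE M i j i' j' :
  blockJ M (mxvec_index i j) (mxvec_index i' j') = (i == i')%:R * M j j'.
Proof.
have -> : blockJ M (mxvec_index i j) (mxvec_index i' j') =
    ((delta_mx 0 (mxvec_index i j) : 'rV_(n * q)) *m blockJ M) 0 (mxvec_index i' j') by rewrite
      -rowE [RHS]mxE.
rewrite mul_blockJE -mxvec_delta mxvecK mxE (bigD1 j)//= big1 => [|s sj].
  by rewrite !mxE eqxx andbT addr0 eq_sym.
by rewrite !mxE (negbTE sj) andbF mul0r.
Qed.

Lemma blockJT M : (blockJ M)^T = blockJ M^T.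
Proof.
apply/matrixP => a b; case/mxvec_indexP: a => i j; case/mxvec_indexP: b => i' j'.
by rewrite mxE !blockJE mxE eq_sym.
Qed.

Lemma blockJM M N : blockJ M *m blockJ N = blockJ (M *m N).
Proof.
apply/row_matrixP => a; rewrite !rowE mulmxA !mul_blockJ mxvecK; by rewrite mulmxA.
Qed.

Lemma mul_blockJ2 (y : 'rV[R]_(n * q)) M N i j :
  (y *m blockJ M *m (blockJ N)^T) 0 (mxvec_index i j) = (row i (vec_mx y) *m M *m N^T) 0 j.
Proof. by rewrite blockJT -mulmxA blockJM mul_blockJE mulmxA. Qed.

Lemma blockJD M N : blockJ M + blockJ N = blockJ (M + N).
Proof.
by apply/row_matrixP => a; rewrite !rowE mulmxDr !mul_blockJ mulmxDr linearD.
Qed.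

Lemma blockJ_scalar a : blockJ a%:M = a%:M.
Proof.
by apply/row_matrixP => b; rewrite !rowE !mul_blockJ !mul_mx_scalar linearZ /= vec_mxK.
Qed.

Lemma blockJN M : blockJ (- M) = - blockJ M.
Proof. by apply/row_matrixP => b; rewrite !rowE mulmxN !mul_blockJ mulmxN linearN. Qed.

Lemma blockJ_sum (u : 'rV[R]_d.+1) :
  \sum_s u 0 s *: blockJ (B s) = blockJ (\sum_s u 0 s *: B s).
Proof.
apply/row_matrixP => b; rewrite !rowE mul_blockJ !mulmx_sumr linear_sum.
by apply: eq_bigr => s _; rewrite -!scalemxAr linearZ /= mul_blockJ.
Qed.

(** Two indices a and b may lie in different blocks, where y restricts to two unrelated rows. Hence
    [B_alt] and [B_norm] are required in polarised form, for independent x and y. *)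
Lemma hypercomplex_block : hypercomplex (fun s => blockJ (B s)).
Proof.
split=> [|s|s t|y r a b|y u a b].
- by rewrite B_one blockJ_scalar.
- by rewrite blockJT B_skew; case: ifP; rewrite ?blockJN.
- by rewrite !blockJT !blockJM blockJD B_orth blockJ_scalar.
- case/mxvec_indexP: a => i j; case/mxvec_indexP: b => i' j'.
  have E i0 j0 : y 0 (mxvec_index i0 j0) = row i0 (vec_mx y) 0 j0 by rewrite !mxE.
  rewrite !E !mul_blockJE; under [X in _ = _ - _ * X]eq_bigr => t _ do rewrite !mul_blockJE.
  rewrite -(B_alt (row i (vec_mx y)) (row i' (vec_mx y))).
  by apply: eq_bigr => t _; rewrite !mul_blockJ2 !mul_blockJE.
- case/mxvec_indexP: a => i j; case/mxvec_indexP: b => i' j' /=.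
  rewrite blockJ_sum; under eq_bigr => t _ do rewrite !mul_blockJ2.
  by rewrite B_norm; congr (_ * _); apply: eq_bigr => t _; rewrite !mul_blockJE.
Qed.

End Blocks.

Definition rq (q : 'rV[R]_4) : 'M[R]_4 := \matrix_i qmul (delta_mx 0 i) q.

Lemma mul_rq (p q : 'rV[R]_4) : p *m rq q = qmul p q.
Proof. by rewrite -rscaleE -[LHS](row_id 0) row_rscale row_id. Qed.

Lemma ord4P (P : 'I_4 -> Prop) :
  P (inord 0) -> P (inord 1) -> P (inord 2) -> P (inord 3) -> forall i, P i.
Proof.
move=> h0 h1 h2 h3 i; rewrite -(inord_val i).
by case: i => [[|[|[|[|i]]]]].
Qed.

Lemma rqE q i j : (i < 4)%N -> rq q (inord i) j = qmul (qe i) q 0 j.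
Proof. by move=> i4; rewrite mxE. Qed.

Lemma rqT q : (rq q)^T = rq (qconj q).
Proof.
apply/matrixP => i j; rewrite mxE; move: i j.
by apply: ord4P; apply: ord4P; rewrite !rqE// !qmulEs !qconjE// !qeE//=; ring.
Qed.

Lemma rqM p q : rq p *m rq q = rq (qmul p q).
Proof. by apply/row_matrixP => i; rewrite !rowE mulmxA !mul_rq qmulA. Qed.

Lemma rqD p q : rq p + rq q = rq (p + q).
Proof.
apply/row_matrixP => i; rewrite !rowE mulmxDr !mul_rq.
by apply: quatP; rewrite [LHS]mxE !qmulEs ![(p + q) _ _]mxE; ring.
Qed.

Lemma rqZ a q : a *: rq q = rq (a *: q).
Proof. by apply/row_matrixP => i; rewrite !rowE -scalemxAr !mul_rq qmulZr. Qed.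

Lemma rq1 : rq (qe 0) = 1%:M.
Proof. by apply/row_matrixP => i; rewrite !rowE mul_rq qmulp1 mulmx1. Qed.

Lemma qmul_conjD (p q : 'rV[R]_4) :
  qmul p (qconj q) + qmul q (qconj p) = (2 * dotm p q) *: qe 0.
Proof.
by apply: quatP; rewrite [LHS]mxE [RHS]mxE !qmulEs !qconjE// !qeE// dotm4 /=; ring.
Qed.

Lemma dotm_qe s t : (s < 4)%N -> (t < 4)%N -> dotm (qe s) (qe t) = (s == t)%:R :> R.
Proof.
move=> s4 t4; rewrite dotm4 !qeE//.
by case: s s4 => [|[|[|[|//]]]] _; case: t t4 => [|[|[|[|//]]]] _ /=; ring.
Qed.

Lemma sum4V (V : zmodType) (F : 'I_4 -> V) :
  \sum_i F i = F (inord 0) + F (inord 1) + F (inord 2) + F (inord 3).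
Proof.
rewrite !big_ord_recl big_ord0 addr0 !addrA.
by congr (F _ + F _ + F _ + F _); apply: val_inj; rewrite /= inordK.
Qed.

Lemma qmul_lin (z v : 'rV[R]_4) b : qmul z v 0 b = \sum_s v 0 s * qmul z (qe s) 0 b.
Proof.
rewrite sum4V !inordK//.
by move: b; apply: ord4P; rewrite !qmulEs !qeE//=; ring.
Qed.

Lemma ord4_0 : (0 : 'I_4) = inord 0.
Proof. by apply: val_inj; rewrite /= inordK. Qed.

Lemma eq4 i j : (i < 4)%N -> (j < 4)%N -> (inord i == inord j :> 'I_4) = (i == j).
Proof. by move=> i4 j4; rewrite -val_eqE /= !inordK. Qed.

(* e_r times the conjugate of e_t is a unit up to sign. *)
Definition quat_sgn (r t : nat) : R :=
  nth 0 (nth [::] [:: [:: 1; -1; -1; -1]; [:: 1; 1; -1; 1]; [:: 1; 1; 1; -1]; [:: 1; -1; 1;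
    1]] r) t.

Definition quat_idx (r t : nat) : nat :=
  nth 0%N (nth [::] [:: [:: 0; 1; 2; 3]; [:: 1; 0; 3; 2]; [:: 2; 3; 0; 1]; [:: 3; 2; 1; 0]]%N r) t.

Lemma quat_tab r t : (r < 4)%N -> (t < 4)%N ->
  qmul (qe r) (qconj (qe t)) = quat_sgn r t *: qe (quat_idx r t).
Proof.
move=> r4 t4.
have E i j : (i < 4)%N -> qe i 0 (inord j) = (inord i == inord j :> 'I_4)%:R :> R.
  by move=> i4; rewrite mxE eqxx eq_sym.
case: r r4 => [|[|[|[|//]]]] _; case: t t4 => [|[|[|[|//]]]] _;
  by apply: quatP; rewrite [RHS]mxE !qmulEs !qconjE// !qeE//= /quat_sgn /=; ring.
Qed.

(** X t and Y t stand for one fixed coordinate of x e_t and one of y e_t. By [quat_tab], multiplying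
    further by a conjugate unit only permutes these numbers up to sign, so [hc_alt] becomes a
    polynomial identity for each r. *)
Lemma quat_alt (X Y : nat -> R) (r : 'I_4) :
  \sum_(t < 4) (X t * (quat_sgn r t * Y (quat_idx r t)) + Y t * (quat_sgn r t * X (quat_idx r t))) =
  2 * (X 0%N * Y r + Y 0%N * X r) - 2 * (r == 0)%:R * \sum_(t < 4) X t * Y t.
Proof.
rewrite !big_ord_recl !big_ord0 /=.
case: r => [[|[|[|[|//]]]] i]; rewrite /quat_sgn /quat_idx -val_eqE /= /bump /=; ring.
Qed.

(** The polarised multiplicativity of the quaternion norm, in the coordinates of [quat_alt]. *)
Lemma quat_norm (X Y : nat -> R) (u : 'I_4 -> R) :
  \sum_(t < 4) (\sum_(r < 4) u r * (quat_sgn t r * X (quat_idx t r))) *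
              (\sum_(r < 4) u r * (quat_sgn t r * Y (quat_idx t r))) =
  (\sum_r u r ^+ 2) * \sum_(t < 4) X t * Y t.
Proof.
rewrite !big_ord_recl !big_ord0 /quat_sgn /quat_idx /= /bump /=.
by move: (u _) (u _) (u _) (u _) => u0 u1 u2 u3; ring.
Qed.

Definition unitH (s : 'I_4) : 'M[R]_4 := rq (qe s).

Lemma quat_row (z : 'rV[R]_4) (c r t : 'I_4) :
  (z *m unitH r *m (unitH t)^T) 0 c = quat_sgn r t * (z *m rq (qe (quat_idx r t))) 0 c.
Proof.
by rewrite /unitH rqT -mulmxA rqM quat_tab// -rqZ -scalemxAr mxE.
Qed.

Lemma hypercomplex_quat n : hypercomplex (fun s => @blockJ 4 n (unitH s)).
Proof.
have val4 i : (i < 4)%N -> val (inord i : 'I_4) = i by move=> i4; rewrite /= inordK.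
apply: hypercomplex_block.
- by rewrite /unitH ord4_0 val4// rq1.
- move=> s; rewrite /unitH rqT ord4_0; move: s; apply: ord4P; rewrite eq4//= val4//.
  + by congr rq; apply: quatP; rewrite !qconjE// !qeE//=; ring.
  + by rewrite -scaleN1r rqZ; congr rq; apply: quatP; rewrite !qconjE// [RHS]mxE !qeE//=; ring.
  + by rewrite -scaleN1r rqZ; congr rq; apply: quatP; rewrite !qconjE// [RHS]mxE !qeE//=; ring.
  + by rewrite -scaleN1r rqZ; congr rq; apply: quatP; rewrite !qconjE// [RHS]mxE !qeE//=; ring.
- move=> s t; rewrite /unitH !rqT !rqM rqD qmul_conjD -rqZ rq1 scale_scalar_mx mulr1.
  by rewrite dotm_qe// (inj_eq val_inj).
- move=> x y r a b.
  have E (z : 'rV[R]_4) c : z 0 c = (z *m rq (qe 0%N)) 0 c by rewrite rq1 mulmx1.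
  rewrite (E x a) (E y b).
  under eq_bigr do rewrite !quat_row.
  exact: (quat_alt (fun s => (x *m rq (qe s)) 0 a) (fun s => (y *m rq (qe s)) 0 b)).
- move=> x y u a b /=.
  have H (z : 'rV[R]_4) c t : (z *m unitH t *m (\sum_s u 0 s *: unitH s)^T) 0 c =
      \sum_s u 0 s * (quat_sgn t s * (z *m rq (qe (quat_idx t s))) 0 c).
    rewrite linear_sum mulmx_sumr summxE; apply: eq_bigr => s _.
    by rewrite linearZ /= -scalemxAr mxE quat_row.
  under eq_bigr do rewrite !H.
  exact: (quat_norm (fun s => (x *m rq (qe s)) 0 a) (fun s => (y *m rq (qe s)) 0 b)).
Qed.

(** Right multiplication by i: the row (x_0, x_1) goes to (- x_1, x_0). *)
Definition rot2 : 'M[R]_2 := \matrix_(i, j) (if i == j then 0 else if i == 0 then 1 else -1).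

Definition unitC (s : 'I_2) : 'M[R]_2 := if s == 0 then 1%:M else rot2.

Lemma hypercomplex_cplx n : hypercomplex (fun s => @blockJ 2 n (unitC s)).
Proof.
have T : rot2^T = - rot2.
  apply/matrixP => i j; rewrite !mxE eq_sym.
  by case: i j => [[|[|]]] // ? [[|[|]]] //= ?; rewrite ?oppr0 ?opprK.
have S : rot2 *m rot2 = - 1%:M.
  apply/matrixP => i j; rewrite !mxE !big_ord_recl big_ord0 !mxE.
  by case: i j => [[|[|]]] // ? [[|[|]]] //= ?; rewrite ?mulr0n ?mulr1n /=; ring.
have rE (x : 'rV[R]_2) : (x *m rot2) 0 0 = - x 0 1 /\ (x *m rot2) 0 1 = x 0 0.
  have L : lift ord0 ord0 = 1 :> 'I_2 by apply: val_inj.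
  by rewrite !mxE !big_ord_recl !big_ord0 !mxE /= !L; split; ring.
have o2 (P : 'I_2 -> Prop) : P 0 -> P 1 -> forall i, P i.
  move=> h0 h1 [[|[|//]] h].
    by rewrite (_ : Ordinal h = 0)//; apply: val_inj.
  by rewrite (_ : Ordinal h = 1)//; apply: val_inj.
have s2 (F : 'I_2 -> R) : \sum_i F i = F 0 + F 1.
  by rewrite !big_ord_recl big_ord0 addr0; congr (_ + F _); apply: val_inj.
apply: hypercomplex_block.
- by [].
- by rewrite /unitC; apply: (o2); rewrite /= ?trmx1.
- rewrite /unitC; apply: (o2); apply: (o2);
  rewrite /= ?trmx1 ?T ?mulmx1 ?mul1mx ?mulmxN ?S ?opprK ?mulr1 ?mulr0.
  + by rewrite -[LHS]mulr2n -scaler_nat scale_scalar_mx mulr1.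
  + by rewrite addNr raddf0.
  + by rewrite subrr raddf0.
  + by rewrite -[LHS]mulr2n -scaler_nat scale_scalar_mx mulr1.
- move=> x y r a b; rewrite !s2 /unitC /= !trmx1 T !mulmx1 !mulmxN.
  have NE (M : 'rV[R]_2) i : (- M) 0 i = - M 0 i by rewrite mxE.
  have [x0 x1] := rE x; have [y0 y1] := rE y.
  have [x2 x3] := rE (x *m rot2); have [y2 y3] := rE (y *m rot2).
  move: r a b; apply: (o2); apply: (o2); apply: (o2);
    rewrite /= ?mulmx1 !NE ?x2 ?x3 ?y2 ?y3 ?x0 ?x1 ?y0 ?y1; ring.
- move=> x y u a b /=.
  have -> : \sum_s u 0 s *: unitC s = u 0 0 *: 1%:M + u 0 1 *: rot2.
    by rewrite !big_ord_recl big_ord0 addr0; congr (_ + u 0 _ *: _); apply: val_inj.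
  rewrite /nsq !s2 /unitC /= !linearD !linearZ /= trmx1 T.
  rewrite ?mulmx1 ?mulmxDr -?scalemxAr ?mulmx1 ?mulmxN.
  have [x0 x1] := rE x; have [y0 y1] := rE y.
  have [x2 x3] := rE (x *m rot2); have [y2 y3] := rE (y *m rot2).
  have DE (M N : 'rV[R]_2) i : (M + N) 0 i = M 0 i + N 0 i by rewrite mxE.
  have ZE c (M : 'rV[R]_2) i : (c *: M) 0 i = c * M 0 i by rewrite mxE.
  have NE (M : 'rV[R]_2) i : (- M) 0 i = - M 0 i by rewrite mxE.
  move: a b; apply: (o2); apply: (o2); rewrite !DE !ZE !NE ?x2 ?x3 ?y2 ?y3 ?x0 ?x1 ?y0 ?y1; ring.
Qed.

End Instances.

(** * The metric of HP^m and linear inclusions *)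

Section Hmetric.
Context {R : realType}.

Lemma mxvec_sum m n (F : 'I_(m * n) -> R) : \sum_a F a = \sum_i \sum_j F (mxvec_index i j).
Proof.
rewrite (reindex _ (curry_mxvec_bij m n)) pair_big /=.
by apply: eq_bigr => -[i j] _.
Qed.

Lemma dotm_mxvec p q (A B : 'M[R]_(p, q)) : dotm A B = \sum_a mxvec A 0 a * mxvec B 0 a.
Proof.
rewrite mxvec_sum dotmE; apply: eq_bigr => i _; apply: eq_bigr => j _.
by rewrite !mxvecE.
Qed.

Lemma dotm_vec_mx p q (u v : 'rV[R]_(p * q)) :
  dotm (vec_mx u : 'M[R]_(p, q)) (vec_mx v) = \sum_a u 0 a * v 0 a.
Proof. by rewrite dotm_mxvec !vec_mxK. Qed.

Lemma dotm_sumr p q (I : Type) (r : seq I) (P : pred I) (F : I -> 'M[R]_(p, q)) x :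
  dotm x (\sum_(i <- r | P i) F i) = \sum_(i <- r | P i) dotm x (F i).
Proof.
elim/big_rec2 : _ => [|i a b _ <-]; first by rewrite dotmC dotm0l.
by rewrite dotmDr.
Qed.

Lemma rscale_orth n (x : 'M[R]_(n, 4)) s t : (s < 4)%N -> (t < 4)%N ->
  dotm (rscale x (qe s)) (rscale x (qe t)) = (s == t)%:R * dotm x x.
Proof.
move=> s4 t4.
have E (u v : 'M[R]_(n, 4)) : dotm u v = \sum_i dotm (row i u) (row i v).
  rewrite dotmE; apply: eq_bigr => i _; rewrite dotmE big_ord1.
  by apply: eq_bigr => j _; rewrite !mxE.
rewrite !E mulr_sumr; apply: eq_bigr => i _; rewrite !row_rscale.
move: (row i x) => p {E}; rewrite !dotm4 !qmulEs !qeE//.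
by case: s s4 => [|[|[|[|//]]]] _; case: t t4 => [|[|[|[|//]]]] _ /=; ring.
Qed.

(** For a unit x the vectors x i, x j, x k are orthonormal, so the vertical part is an orthogonal
    projection and is subtracted once, not twice. *)
Lemma dotm_hor n (x w w' : 'M[R]_(n, 4)) : dotm x x = 1 ->
  dotm (hor x w) (hor x w') =
  dotm w w' - \sum_(1 <= s < 4) dotm w (rscale x (qe s)) * dotm w' (rscale x (qe s)).
Proof.
move=> x1; set P := fun w => \sum_(1 <= s < 4) dotm w (rscale x (qe s)) *: rscale x (qe s).
have dP v w0 : dotm v (P w0) = \sum_(1 <= s < 4) dotm v (rscale x (qe s)) * dotm w0 (rscale x
  (qe s)).
  by rewrite /P dotm_sumr; apply: eq_bigr => s _; rewrite dotmZr mulrC.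
have PP s : (1 <= s < 4)%N -> dotm (P w) (rscale x (qe s)) = dotm w (rscale x (qe s)).
  move=> /andP[s1 s4]; rewrite dotmC dP /index_iota /= !big_cons big_nil !rscale_orth// x1.
  by case: s s1 s4 => [|[|[|[|//]]]] //= _ _; ring.
rewrite /hor -!/(P _) dotmBl !dotmBr !dP.
have -> : \sum_(1 <= s < 4) dotm (P w) (rscale x (qe s)) * dotm w' (rscale x (qe s)) =
   \sum_(1 <= s < 4) dotm w (rscale x (qe s)) * dotm w' (rscale x (qe s)).
  by apply: eq_big_nat => s s4; rewrite PP.
rewrite (dotmC (P w) w') dP.
have -> : \sum_(1 <= s < 4) dotm w' (rscale x (qe s)) * dotm w (rscale x (qe s)) =
   \sum_(1 <= s < 4) dotm w (rscale x (qe s)) * dotm w' (rscale x (qe s)).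
  by apply: eq_bigr => s _; rewrite mulrC.
by ring.
Qed.

Section Lift.
Variables (m : nat) (Q : 'M[R]_m.+1).
Hypothesis QQ : Q^T *m Q = 1%:M.
Implicit Type y : 'rV[R]_(m * 4).

Definition haff y : 'M[R]_(m.+1, 4) := col_mx (qe 0) (vec_mx y).

Definition htan y : 'M[R]_(m.+1, 4) := col_mx (0 : 'rV[R]_4) (vec_mx y).

Lemma dotm_col p q (a b : 'rV[R]_q) (x y : 'M[R]_(p, q)) :
  dotm (col_mx a x : 'M[R]_(p.+1, q)) (col_mx b y) = dotm a b + dotm x y.
Proof. exact: (dotm_col_mx a b x y). Qed.

Lemma dotm_haff y z : dotm (haff y) (haff z) = 1 + \sum_a y 0 a * z 0 a.
Proof. by rewrite dotm_col dotm_qe0 dotm_vec_mx. Qed.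

Lemma dotm_haff_htan y z : dotm (haff y) (htan z) = \sum_a y 0 a * z 0 a.
Proof. by rewrite dotm_col (dotmC _ 0) dotm0l add0r dotm_vec_mx. Qed.

Lemma dotm_htan y z : dotm (htan y) (htan z) = \sum_a y 0 a * z 0 a.
Proof. by rewrite dotm_col dotm0l add0r dotm_vec_mx. Qed.

Lemma haffD y : haff y = haff 0 + htan y.
Proof. by rewrite /haff /htan (@add_col_mx _ 1 m) addr0 linear0 add0r. Qed.

Lemma htan_sum y : htan y = \sum_a y 0 a *: htan (delta_mx 0 a).
Proof.
have L : linear htan.
  move=> c u v; rewrite /htan linearP /= -[X in col_mx X _](addr0 (0 : 'rV[R]_4)).
  by rewrite -{1}(scaler0 _ c) -(@add_col_mx _ 1 m) -(@scale_col_mx _ 1 m).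
pose Lm := GRing.isLinear.Build _ _ _ _ _ L.
pose Ll : {linear 'rV[R]_(m * 4) -> 'M[R]_(m.+1, 4)} := HB.pack htan Lm.
rewrite -[htan y]/(Ll y) {1}(row_sum_delta y) linear_sum.
by apply: eq_bigr => a _; rewrite linearZ.
Qed.

Lemma hlift_rho y : hlift Q y = rho y `^ (- 2^-1) *: (Q *m haff y).
Proof.
rewrite /hlift /unitize dotm_orth// -/(haff y) dotm_haff -[X in 1 + X]/(\sum_a _).
have -> : 1 + \sum_a y 0 a * y 0 a = rho y.
  by congr (1 + _); apply: eq_bigr => a _; rewrite expr2.
by rewrite powRN powR12_sqrt// ltW// rho_gt0.
Qed.

Lemma hasdp_Qhaff i j a y : hasdp (fun y => (Q *m haff y) i j) a y ((Q *m htan (delta_mx 0 a)) i j).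
Proof.
have -> : (fun y => (Q *m haff y) i j) =
   fun y => (Q *m haff 0) i j + \sum_b y 0 b * (Q *m htan (delta_mx 0 b)) i j.
  apply/funext => z; rewrite haffD htan_sum mulmxDr mulmx_sumr mxE summxE; congr (_ + _).
  by apply: eq_bigr => b _; rewrite -scalemxAr mxE.
apply: hasdp_eq.
  apply: hasdpD; first exact: hasdp_cst.
  by apply: hasdp_sum => b _; apply: hasdpM; [exact: hasdp_coord|exact: hasdp_cst].
rewrite add0r -[RHS](sum_delta (fun b => (Q *m htan (delta_mx 0 b)) i j)).
by apply: eq_bigr => b _; rewrite mulr0 addr0.
Qed.

Lemma hasdp_rhoX n e (a : 'I_n) (y : 'rV[R]_n) : hasdp (fun x => rho x `^ e) a y (2 * e * rho y
  `^ (e - 1) * y 0 a).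
Proof.
have [rd re] := hasdp_rho a y; split; first by apply: differentiable_powR; rewrite ?rho_gt0.
by rewrite pd_powR ?rho_gt0// re; ring.
Qed.

(** The second term comes from differentiating rho^(-1/2); it makes the derivative orthogonal to the
    lift itself. *)
Lemma derive_hlift a y : 'D_(delta_mx 0 a) (hlift Q) y =
  rho y `^ (- 2^-1) *: (Q *m (htan (delta_mx 0 a) - (y 0 a / rho y) *: haff y)).
Proof.
have H i j : hasdp (fun y => hlift Q y i j) a y
   ((rho y `^ (- 2^-1) *: (Q *m (htan (delta_mx 0 a) - (y 0 a / rho y) *: haff y))) i j).
  have -> : (fun y => hlift Q y i j) = fun y => rho y `^ (- 2^-1) * (Q *m haff y) i j.
    by apply/funext => z; rewrite hlift_rho mxE.
  apply: hasdp_eq.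
    by apply: hasdpM; [exact: hasdp_rhoX|exact: hasdp_Qhaff].
  rewrite mulmxBr -scalemxAr [RHS]mxE [X in _ = _ * X]mxE [X in _ = _ * (_ + X)]mxE.
  rewrite [X in _ = _ * (_ - X)]mxE powRB ?powRr1 ?(ltW (rho_gt0 _)) ?rho_neq0 ?implybT//.
  by field; exact: rho_neq0.
rewrite derive_mx; last first.
  by apply/derivable_mxP => i j; apply: diff_derivable; have [] := H i j.
apply/matrixP => i j; rewrite [LHS]mxE derive_dp; by have [_ ->] := H i j.
Qed.

Lemma rscaleZ n (x : 'M[R]_(n, 4)) q c : rscale (c *: x) q = c *: rscale x q.
Proof. by rewrite !rscaleE -scalemxAl. Qed.

Lemma blockJ_rscale n (y : 'rV[R]_(n * 4)) (s : 'I_4) :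
  y *m @blockJ R 4 n (unitH s) = mxvec (rscale (vec_mx y) (qe s)).
Proof. by rewrite mul_blockJ rscaleE. Qed.

Lemma dotm_htan_rscale a y (s : 'I_4) :
  dotm (htan (delta_mx 0 a)) (rscale (haff y) (qe s)) = (y *m @blockJ R 4 m (unitH s)) 0 a.
Proof.
have -> : rscale (haff y) (qe s) = col_mx (qe s) (rscale (vec_mx y) (qe s)) :> 'M[R]_(m.+1, 4).
  rewrite !rscaleE /haff (@mul_col_mx _ 1 m); congr (@col_mx _ 1 m _ _ _).
  by rewrite -rscaleE -[LHS](row_id 0) row_rscale row_id qmul1p.
rewrite dotm_col dotm0l add0r -[rscale _ _]mxvecK dotm_vec_mx blockJ_rscale.
rewrite -[RHS](sum_delta (fun b => mxvec (rscale (vec_mx y) (qe s)) 0 b)).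
by apply: eq_bigr => b _; rewrite mxE eqxx eq_sym.
Qed.

(** The normalisation of the lift contributes the s = 0 term - y_a y_b / rho^2, and the horizontal
    projection the terms s = 1, 2, 3; together they form [proj] over H, with [kap] = 1. *)
Lemma hmetricE y : hmetric Q y = fsm (fun s => @blockJ R 4 m (unitH s)) 1 y.
Proof.
apply/matrixP => a b; rewrite [LHS]mxE [RHS]mxE.
rewrite dotm_hor; last exact: hlift_norm.
have r0 := rho_neq0 y.
set c := rho y `^ (- 2^-1).
have cc : c * c = (rho y)^-1.
  rewrite /c -powRD ?rho_neq0 ?implybT//.
  have -> : - 2^-1 + - 2^-1 = -1 :> R by field.
  by rewrite powR_inv1// ltW// rho_gt0.
have hx (s : 'I_4) : rscale (hlift Q y) (qe s) = c *: (Q *m rscale (haff y) (qe s)).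
  by rewrite hlift_rho rscaleZ rscaleMl.
have hy : \sum_b y 0 b * y 0 b = rho y - 1.
  by rewrite /rho addrC addKr; apply: eq_bigr => i _; rewrite expr2.
have d1 (e : 'I_(m * 4)) : \sum_i y 0 i * (delta_mx 0 e : 'rV[R]_(m * 4)) 0 i = y 0 e.
  rewrite -[RHS](sum_delta (fun i => y 0 i)); apply: eq_bigr => i _.
  by rewrite mxE eqxx mulrC eq_sym.
have D e (s : 'I_4) : s != 0 -> dotm ('D_(delta_mx 0 e) (hlift Q) y) (rscale (hlift Q y) (qe s)) =
    (rho y)^-1 * (y *m @blockJ R 4 m (unitH s)) 0 e.
  move=> s0; rewrite derive_hlift hx dotmZl dotmZr mulrA cc dotm_orth//; congr (_ * _).
  rewrite dotmBl dotmZl dotm_htan_rscale.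
  have -> : dotm (haff y) (rscale (haff y) (qe s)) = 0.
    rewrite -{1}(rscalex1 (haff y)) rscale_orth// eq_sym.
    by rewrite (_ : (nat_of_ord s == 0%N) = false) ?mul0r//; apply/negbTE.
  by rewrite mulr0 subr0.
have -> : \sum_(1 <= s < 4) dotm ('D_(delta_mx 0 a) (hlift Q) y) (rscale (hlift Q y) (qe s)) *
      dotm ('D_(delta_mx 0 b) (hlift Q) y) (rscale (hlift Q y) (qe s)) =
   \sum_(s < 4 | s != 0) ((rho y)^-1 * (y *m @blockJ R 4 m (unitH s)) 0 a) *
      ((rho y)^-1 * (y *m @blockJ R 4 m (unitH s)) 0 b).
  rewrite big_add1 /= big_mkord [RHS]big_mkcond [RHS]big_ord_recl eqxx [RHS]add0r /=.
  by apply: eq_bigr => s _; rewrite -(D a (lift ord0 s))// -(D b (lift ord0 s))//.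
rewrite !derive_hlift dotmZl dotmZr mulrA cc dotm_orth//.
rewrite dotmBl !dotmBr !dotmZl !dotmZr dotm_htan (dotmC _ (haff y)) !dotm_haff_htan dotm_haff hy.
rewrite !d1.
have -> : \sum_i (delta_mx 0 a : 'rV[R]_(m * 4)) 0 i * (delta_mx 0 b : 'rV[R]_(m * 4)) 0 i = (a
  == b)%:R.
  rewrite -[RHS](sum_delta (fun i => (i == b)%:R)).
  by apply: eq_bigr => i _; rewrite !mxE !eqxx (eq_sym i a) .
have -> : proj (fun s => @blockJ R 4 m (unitH s)) y a b = y 0 a * y 0 b +
   rho y ^+ 2 * \sum_(s < 4 | s != 0) ((rho y)^-1 * (y *m @blockJ R 4 m (unitH s)) 0 a) *
      ((rho y)^-1 * (y *m @blockJ R 4 m (unitH s)) 0 b).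
  rewrite /proj (bigD1 0)//= !(Y0 (hypercomplex_quat m)); congr (_ + _).
  by rewrite mulr_sumr; apply: eq_bigr => s _; field.
by field.
Qed.

End Lift.
End Hmetric.

(** * Totally geodesic linear inclusions *)

Section LinearLoc.
Context {R : realType} {m n k d : nat}.
Variables (Q : 'M[R]_m.+1) (C : {linear 'rV[R]_k -> 'M[R]_(n, 4)}).
(** Column t of [kappa] holds the coordinates in H of the t-th unit of K. Thus [C_mul] says that
    [J t] is right multiplication by that unit, and [C_orth] that right multiplication by e_s,
    projected orthogonally back to the image of [C], is a combination of the [J t]. *)
Variables (J : 'I_d.+1 -> 'M[R]_k) (kappa : 'I_4 -> 'I_d.+1 -> R).
Hypothesis QQ : Q^T *m Q = 1%:M.
Hypothesis nm : (n <= m)%N.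
Hypothesis hJ : hypercomplex J.
Hypothesis C_isom : forall v w, dotm (C v) (C w) = \sum_i v 0 i * w 0 i.
Hypothesis C_mul : forall v t, \sum_s kappa s t *: rscale (C v) (qe (s : 'I_4)) = C (v *m J t).
Hypothesis C_orth : forall v w s,
  dotm (rscale (C v) (qe (s : 'I_4))) (C w) = \sum_t kappa s t * dotm (C (v *m J t)) (C w).

Definition linloc (v : 'rV[R]_k) : 'rV[R]_(m * 4) := mxvec (pad m (C v)).

Lemma linlocE v : linloc v = mxvec (pad m (C v)).
Proof. by []. Qed.

Lemma padD q (x y : 'M[R]_(n, q)) : pad m (x + y) = pad m x + pad m y.
Proof.
apply/row_matrixP => i; rewrite linearD /= !row_pad.
by case: insub => [j|]; rewrite ?linearD ?addr0.
Qed.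

Lemma linloc_linear : linear linloc.
Proof. by move=> a u v; rewrite /linloc linearP padD padZ linearP. Qed.

HB.instance Definition _ := GRing.isLinear.Build _ _ _ _ linloc linloc_linear.

Definition locmx : 'M[R]_(k, m * 4) := lin1_mx linloc.

Local Notation J4 := (fun s => @blockJ R 4 m (unitH s)).

Lemma mul_locmx v : v *m locmx = linloc v.
Proof. by rewrite mul_rV_lin1. Qed.

Lemma dotm_padl q (x y : 'M[R]_(n, q)) : dotm (pad m x) (pad m y) = dotm x y.
Proof.
have pol p (a b : 'M[R]_(p, q)) : dotm a b = (dotm (a + b) (a + b) - dotm a a - dotm b b) / 2.
  by rewrite !dotmDl !dotmDr (dotmC b a); field.
by rewrite pol [RHS]pol -padD !dotm_pad.
Qed.

Lemma rscale_pad (x : 'M[R]_(n, 4)) q : rscale (pad m x) q = pad m (rscale x q).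
Proof. by rewrite !rscaleE padM. Qed.

Lemma dot_linloc (u : 'M[R]_(n, 4)) v :
  \sum_c (mxvec (pad m u)) 0 c * (linloc v) 0 c = dotm u (C v).
Proof. by rewrite -dotm_mxvec dotm_padl. Qed.

Lemma nsq_linloc v : nsq (linloc v) = nsq v.
Proof.
transitivity (dotm (C v) (C v)).
  by rewrite -dot_linloc; apply: eq_bigr => c _; rewrite expr2.
by rewrite C_isom; apply: eq_bigr => c _; rewrite expr2.
Qed.

Lemma linloc_J4 v s : linloc v *m J4 s = mxvec (pad m (rscale (C v) (qe s))).
Proof. by rewrite blockJ_rscale mxvecK rscale_pad. Qed.

Lemma locmx_row i : row i locmx = linloc (delta_mx 0 i).
Proof. by rewrite rowE mul_locmx. Qed.

Lemma locmxE i c : locmx i c = linloc (delta_mx 0 i) 0 c.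
Proof. by rewrite -locmx_row [RHS]mxE. Qed.

Lemma dot_delta (v : 'rV[R]_k) i : \sum_j v 0 j * (delta_mx 0 i : 'rV[R]_k) 0 j = v 0 i.
Proof.
rewrite -[RHS](sum_delta (fun j => v 0 j)); apply: eq_bigr => j _.
by rewrite mxE eqxx mulrC eq_sym.
Qed.

Lemma linloc_J4_row v s i :
  \sum_c (linloc v *m J4 s) 0 c * locmx i c = \sum_t kappa s t * (v *m J t) 0 i.
Proof.
under eq_bigr do rewrite locmxE.
rewrite linloc_J4 dot_linloc C_orth; apply: eq_bigr => t _.
by rewrite C_isom dot_delta.
Qed.

Lemma linloc_sum (I : Type) (r : seq I) (P : pred I) (F : I -> 'M[R]_(n, 4)) :
  mxvec (pad m (\sum_(i <- r | P i) F i)) = \sum_(i <- r | P i) mxvec (pad m (F i)).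
Proof.
elim/big_rec2 : _ => [|i a b _ <-]; first by rewrite pad0 linear0.
by rewrite padD linearD.
Qed.

(** The sum over the four units of H collapses to the units of K: the tangential component brings in
    [kappa] through [C_orth], and [C_mul] recombines the e_s. Both the induced metric and the
    induced connection rest on this. *)
Lemma linloc_intertwine v w i c :
  \sum_s (\sum_b (linloc v *m J4 s) 0 b * locmx i b) * (linloc w *m J4 s) 0 c =
  \sum_t (v *m J t) 0 i * linloc (w *m J t) 0 c.
Proof.
under eq_bigr do rewrite linloc_J4_row mulr_suml.
rewrite exchange_big; apply: eq_bigr => t _ /=.
rewrite (linlocE (w *m J t)) -C_mul linloc_sum summxE mulr_sumr; apply: eq_bigr => s _.
by rewrite linloc_J4 padZ linearZ /= [X in _ = _ * X]mxE; ring.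
Qed.

Lemma hmetric_fsm : hmetric Q = fsm J4 1.
Proof. by apply/funext => y; rewrite hmetricE. Qed.

Lemma jac_linloc v : jac linloc v = locmx.
Proof.
apply/matrixP => i c; rewrite mxE -dpE.
have -> : (fun y => linloc y 0 c) = fun y => (y *m locmx) 0 c by apply/funext => y;
  rewrite mul_locmx.
by have [_ ->] := hasdp_lin locmx c i v.
Qed.

Lemma pullback_linloc v : pullback (hmetric Q) linloc v = fsm J 1 v.
Proof.
rewrite /pullback jac_linloc hmetric_fsm; apply/matrixP => i j; rewrite mxE [RHS]mxE.
have E b : (locmx *m fsm J4 1 (linloc v)) i b = locmx i b / rho v -
    (\sum_s (\sum_a (linloc v *m J4 s) 0 a * locmx i a) * (linloc v *m J4 s) 0 b) / rho v ^+ 2.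
  rewrite mxE; transitivity (\sum_a ((b == a)%:R * (locmx i a / rho v) -
     locmx i a * proj J4 (linloc v) a b / rho v ^+ 2)).
    apply: eq_bigr => a _; rewrite [fsm _ _ _ a b]mxE /rho nsq_linloc (eq_sym b); ring.
  rewrite sumrB (sum_delta (fun a => locmx i a / rho v)) -mulr_suml; congr (_ - _ / _).
  under eq_bigr do rewrite mulr_sumr; rewrite exchange_big; apply: eq_bigr => s _ /=.
  by rewrite mulr_suml; apply: eq_bigr => a _; ring.
under eq_bigr => b _ do rewrite E linloc_intertwine [locmx^T _ _]mxE mulrBl.
rewrite sumrB mul1r; congr (_ - _).
  under eq_bigr do rewrite mulrAC; rewrite -mulr_suml; congr (_ / _).
  under eq_bigr do rewrite !locmxE.
  rewrite (linlocE (delta_mx 0 i)) dot_linloc C_isom dot_delta.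
  by rewrite mxE eqxx eq_sym.
under eq_bigr do rewrite mulrAC; rewrite -mulr_suml; congr (_ / _).
under eq_bigr do rewrite mulr_suml; rewrite exchange_big; apply: eq_bigr => t _ /=.
under eq_bigr do rewrite -mulrA; rewrite -mulr_sumr; congr (_ * _).
under eq_bigr do rewrite locmxE.
by rewrite (linlocE (v *m J t)) dot_linloc C_isom dot_delta.
Qed.

(** Each of the two halves of the ambient symbol is an instance of [linloc_intertwine], so the
    connection of HP^m restricts to the one of [fsm J 1]. *)
Lemma christoffel_linloc v i j c :
  \sum_a \sum_b christoffel (fsm J4 1) c a b (linloc v) * locmx i a * locmx j b =
  \sum_l christoffel (fsm J 1) l i j v * locmx l c.
Proof.
have k1 : 1 != 0 :> R by exact: oner_neq0.
pose w j : 'rV[R]_k := delta_mx 0 j.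
have half i0 j0 : \sum_a \sum_b (\sum_s (linloc v *m J4 s) 0 a * J4 s b c) * (locmx i0 a * locmx
  j0 b) =
    \sum_t (v *m J t) 0 i0 * linloc (w j0 *m J t) 0 c.
  rewrite -linloc_intertwine.
  transitivity (\sum_a \sum_b \sum_s (linloc v *m J4 s) 0 a * locmx i0 a * (locmx j0 b * J4 s b c)).
    apply: eq_bigr => a _; apply: eq_bigr => b _; rewrite mulr_suml.
    by apply: eq_bigr => s _; ring.
  under eq_bigr => a _ do rewrite exchange_big.
  rewrite exchange_big /=; apply: eq_bigr => s _; rewrite mulr_suml.
  apply: eq_bigr => a _; rewrite -mulr_sumr [X in _ = _ * X]mxE; congr (_ * _).
  by apply: eq_bigr => b _; rewrite locmxE.
have tan j0 t : \sum_l J t j0 l * locmx l c = linloc (w j0 *m J t) 0 c.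
  by rewrite -mul_locmx [RHS]mxE; apply: eq_bigr => l _; rewrite -rowE [in RHS]mxE.
transitivity (- (rho v)^-1 * (\sum_t (v *m J t) 0 i * linloc (w j *m J t) 0 c +
    \sum_t (v *m J t) 0 j * linloc (w i *m J t) 0 c)).
  rewrite -!half [X in _ = _ * (_ + X)]exchange_big -big_split mulr_sumr /=; apply: eq_bigr => a _.
  rewrite -big_split mulr_sumr /=; apply: eq_bigr => b _.
  rewrite (christoffel_fsm (hypercomplex_quat m) k1) big_split /= /rho nsq_linloc; ring.
rewrite -big_split mulr_sumr /=.
under [RHS]eq_bigr do rewrite (christoffel_fsm hJ k1) -mulrA mulr_suml mulr_sumr.
rewrite exchange_big /=; apply: eq_bigr => t _.
rewrite -!tan !mulr_sumr -big_split mulr_sumr /=; apply: eq_bigr => l _; ring.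
Qed.

(** The inclusion is linear in coordinates: its second derivatives vanish and the two connection
    terms of the Gauss formula cancel. *)
Lemma sff_linloc v i j c : sff (hmetric Q) linloc v i j c = 0.
Proof.
rewrite /sff jac_linloc.
have -> : pullback (hmetric Q) linloc = fsm J 1 by apply/funext => y; exact: pullback_linloc.
rewrite hmetric_fsm -!dpE.
have -> : dp (dp (fun y => linloc y 0 c) j) i v = 0.
  have -> : dp (fun y => linloc y 0 c) j = fun=> locmx j c.
    apply/funext => x.
    have -> : (fun y => linloc y 0 c) = fun y => (y *m locmx) 0 c by apply/funext => y;
      rewrite mul_locmx.
    by have [_ ->] := hasdp_lin locmx c j x.
  exact: pd_cst.
by rewrite christoffel_linloc add0r subrr.
Qed.

Lemma sff_normsq_linloc v : sff_normsq (hmetric Q) linloc v = 0.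
Proof.
rewrite /sff_normsq big1// => i _; rewrite big1// => j _; rewrite big1// => a _.
rewrite big1// => b _; rewrite big1// => c _; rewrite big1// => e _.
by rewrite sff_linloc mulr0 mul0r.
Qed.

Lemma Lop_linloc f v : Cr 2 setT f ->
  laplacian (pullback (hmetric Q) linloc) f v
  + (sff_normsq (hmetric Q) linloc v + k%:R) * f v = fslap J f v + k%:R * f v.
Proof.
move=> fC; rewrite sff_normsq_linloc add0r.
have -> : pullback (hmetric Q) linloc = fsm J 1 by apply/funext => y; exact: pullback_linloc.
by rewrite (laplacian_fsm hJ (oner_neq0 _))// invr1 mul1r.
Qed.

End LinearLoc.

(** * The inclusions over R, H and C *)

Section ProjectiveLocs.
Context {R : realType}.

Definition real_loc k (v : 'rV[R]_k) : 'M[R]_(k, 4) := v^T *m qe 0.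

Lemma real_loc_linear k : linear (@real_loc k).
Proof. by move=> a u v; rewrite /real_loc linearP /= mulmxDl scalemxAl. Qed.

HB.instance Definition _ k := GRing.isLinear.Build _ _ _ _ (@real_loc k) (@real_loc_linear k).

Definition real_kappa (s : 'I_4) (t : 'I_1) : R := (s == 0)%:R.

Definition real_J k (t : 'I_1) : 'M[R]_k := 1%:M.

Lemma dotm_tr n (v w : 'rV[R]_n) : dotm v^T w^T = \sum_i v 0 i * w 0 i.
Proof. by rewrite dotmE; apply: eq_bigr => i _; rewrite big_ord1 !mxE. Qed.

Lemma real_loc_isom k (v w : 'rV[R]_k) :
  dotm (real_loc v) (real_loc w) = \sum_i v 0 i * w 0 i.
Proof. by rewrite dotm_mul_qe0 dotm_qe0 mulr1 dotm_tr. Qed.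

Lemma real_loc_mul k (v : 'rV[R]_k) t :
  \sum_s real_kappa s t *: rscale (real_loc v) (qe (s : 'I_4)) = real_loc (v *m real_J k t).
Proof.
rewrite (bigD1 0)//= big1 => [|s s0]; last by rewrite /real_kappa (negbTE s0) scale0r.
by rewrite addr0 /real_kappa eqxx scale1r mulmx1 rscalex1.
Qed.

Lemma real_loc_orth k (v w : 'rV[R]_k) s :
  dotm (rscale (real_loc v) (qe (s : 'I_4))) (real_loc w) =
  \sum_t real_kappa s t * dotm (real_loc (v *m real_J k t)) (real_loc w).
Proof.
rewrite big_ord1 mulmx1 real_loc_isom rscale_real dotm_mul_qe0 dotm_tr dotm_qe// mulrC /real_kappa.
by congr (_%:R * _).
Qed.

Definition quat_kappa (s t : 'I_4) : R := (s == t)%:R.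

Lemma quat_loc_isom l (v w : 'rV[R]_(l * 4)) :
  dotm (vec_mx v : 'M[R]_(l, 4)) (vec_mx w) = \sum_i v 0 i * w 0 i.
Proof. exact: dotm_vec_mx. Qed.

Lemma quat_loc_mul l (v : 'rV[R]_(l * 4)) t :
  \sum_s quat_kappa s t *: rscale (vec_mx v : 'M[R]_(l, 4)) (qe (s : 'I_4)) =
  vec_mx (v *m blockJ l (unitH t)).
Proof.
rewrite blockJ_rscale mxvecK (bigD1 t)//= big1 => [|s st];
  first by rewrite addr0 /quat_kappa eqxx scale1r.
by rewrite /quat_kappa (negbTE st) scale0r.
Qed.

Lemma quat_loc_orth l (v w : 'rV[R]_(l * 4)) s :
  dotm (rscale (vec_mx v : 'M[R]_(l, 4)) (qe (s : 'I_4))) (vec_mx w) =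
  \sum_t quat_kappa s t * dotm (vec_mx (v *m blockJ l (unitH t)) : 'M[R]_(l, 4)) (vec_mx w).
Proof. by rewrite /quat_kappa sum_delta blockJ_rscale mxvecK. Qed.

Section Cplx.
Variable u : 'rV[R]_4.
Hypothesis hu : imaginary_unit u.

Definition cplx_basis : 'M[R]_(2, 4) := col_mx (qe 0) u.

Definition cplx_loc l (v : 'rV[R]_(l * 2)) : 'M[R]_(l, 4) := vec_mx v *m cplx_basis.

Lemma cplx_loc_linear l : linear (@cplx_loc l).
Proof. by move=> a v w; rewrite /cplx_loc linearP /= mulmxDl scalemxAl. Qed.

HB.instance Definition _ l := GRing.isLinear.Build _ _ _ _ (@cplx_loc l) (@cplx_loc_linear l).

Definition cplx_kappa (s : 'I_4) (t : 'I_2) : R := if t == 0 then (s == 0)%:R else u 0 s.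

Lemma ord2P (P : 'I_2 -> Prop) : P 0 -> P 1 -> forall i, P i.
Proof.
move=> h0 h1 [[|[|//]] h]; first by rewrite (_ : Ordinal h = 0)//; apply: val_inj.
by rewrite (_ : Ordinal h = 1)//; apply: val_inj.
Qed.

Lemma sum2V (V : zmodType) (F : 'I_2 -> V) : \sum_i F i = F 0 + F 1.
Proof. by rewrite !big_ord_recl big_ord0 addr0; congr (F _ + F _); apply: val_inj. Qed.

Lemma cplx_basis_mul (x : 'rV[R]_2) c :
  (x *m cplx_basis) 0 c = x 0 0 * qe 0 0 c + x 0 1 * u 0 c.
Proof.
rewrite mxE sum2V; congr (_ * _ + _ * _).
  have -> : (0 : 'I_2) = lshift 1 (0 : 'I_1) by apply: val_inj.
  by rewrite /cplx_basis (@col_mxEu _ 1 1).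
have -> : (1 : 'I_2) = rshift 1 (0 : 'I_1) by apply: val_inj.
by rewrite /cplx_basis (@col_mxEd _ 1 1).
Qed.

Lemma rot2_row (x : 'rV[R]_2) : (x *m rot2) 0 0 = - x 0 1 /\ (x *m rot2) 0 1 = x 0 0.
Proof.
by rewrite !mxE !sum2V !mxE /=; split; ring.
Qed.

Let unorm : u 0 (inord 1) ^+ 2 + u 0 (inord 2) ^+ 2 + u 0 (inord 3) ^+ 2 = 1.
Proof. by have [u0 <-] := hu; rewrite dotm4 u0; ring. Qed.

Lemma row_cplx_loc l (v : 'rV[R]_(l * 2)) i : row i (cplx_loc v) = row i (vec_mx v) *m cplx_basis.
Proof. by rewrite row_mul. Qed.

Lemma dotm_row n q (x y : 'M[R]_(n, q)) : dotm x y = \sum_i dotm (row i x) (row i y).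
Proof.
rewrite dotmE; apply: eq_bigr => i _; rewrite dotmE big_ord1.
by apply: eq_bigr => j _; rewrite !mxE.
Qed.

Lemma dotm_cplx_basis (x y : 'rV[R]_2) :
  dotm (x *m cplx_basis) (y *m cplx_basis) = x 0 0 * y 0 0 + x 0 1 * y 0 1.
Proof.
have [u0 _] := hu; rewrite dotm4 !cplx_basis_mul !qeE//= u0.
transitivity (x 0 0 * y 0 0 + x 0 1 * y 0 1 *
  (u 0 (inord 1) ^+ 2 + u 0 (inord 2) ^+ 2 + u 0 (inord 3) ^+ 2)); first by ring.
by rewrite unorm mulr1.
Qed.

Lemma cplx_loc_isom l (v w : 'rV[R]_(l * 2)) :
  dotm (cplx_loc v) (cplx_loc w) = \sum_i v 0 i * w 0 i.
Proof.
rewrite dotm_row mxvec_sum; apply: eq_bigr => i _.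
by rewrite !row_cplx_loc dotm_cplx_basis sum2V !mxE.
Qed.

(** A unit u with zero real part squares to -1, so [rot2] is multiplication by u in the basis (1,
    u). *)
Lemma unitC_basis (x : 'rV[R]_2) t :
  x *m unitC t *m cplx_basis = \sum_s cplx_kappa s t *: qmul (x *m cplx_basis) (qe (s : 'I_4)).
Proof.
have [u0 _] := hu; have [r0 r1] := rot2_row x.
move: t; apply: ord2P; rewrite /unitC /cplx_kappa /=.
  rewrite mulmx1 (bigD1 0)//= big1 => [|s s0]; last by rewrite (negbTE s0) scale0r.
  by rewrite addr0 scale1r qmulp1.
have -> : \sum_s u 0 s *: qmul (x *m cplx_basis) (qe (s : 'I_4)) = qmul (x *m cplx_basis) u.
  apply/rowP => c; rewrite summxE qmul_lin; apply: eq_bigr => s _; by rewrite [LHS]mxE.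
apply: quatP; rewrite qmulEs !cplx_basis_mul r0 r1 !qeE//= u0; [|ring..].
transitivity (- x 0 1 * (u 0 (inord 1) ^+ 2 + u 0 (inord 2) ^+ 2 + u 0 (inord 3) ^+ 2));
  last by ring.
by rewrite unorm; ring.
Qed.

Lemma row_blockC l (v : 'rV[R]_(l * 2)) M i :
  row i (vec_mx (v *m blockJ l M)) = row i (vec_mx v) *m M.
Proof. by rewrite mul_blockJ mxvecK row_mul. Qed.

Lemma cplx_loc_mul l (v : 'rV[R]_(l * 2)) t :
  \sum_s cplx_kappa s t *: rscale (cplx_loc v) (qe (s : 'I_4)) =
  cplx_loc (v *m blockJ l (unitC t)).
Proof.
apply/row_matrixP => i; rewrite row_cplx_loc row_blockC unitC_basis linear_sum.
by apply: eq_bigr => s _; rewrite linearZ /= row_rscale row_cplx_loc.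
Qed.

(** For x and y in R + R u, the inner product of x e_s with y sees only the components of e_s along
    1 and along u, which are the two entries of [cplx_kappa s]. *)
Lemma cplx_loc_orth l (v w : 'rV[R]_(l * 2)) s :
  dotm (rscale (cplx_loc v) (qe (s : 'I_4))) (cplx_loc w) =
  \sum_t cplx_kappa s t * dotm (cplx_loc (v *m blockJ l (unitC t))) (cplx_loc w).
Proof.
rewrite sum2V !dotm_row !mulr_sumr -big_split; apply: eq_bigr => i _ /=.
rewrite row_rscale !row_cplx_loc !row_blockC; move: (row i (vec_mx v)) (row i (vec_mx w)) => x y.
have [u0 _] := hu; have [r0 r1] := rot2_row x.
rewrite !dotm_cplx_basis /unitC /= mulmx1 r0 r1 /cplx_kappa /=.
rewrite dotm4 !qmulEs !cplx_basis_mul !qeE//= u0 ord4_0.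
have U := unorm.
move: s; apply: ord4P; rewrite inordK// eq4//= ?u0; [|ring..].
transitivity (x 0 0 * y 0 0 + x 0 1 * y 0 1 *
  (u 0 (inord 1) ^+ 2 + u 0 (inord 2) ^+ 2 + u 0 (inord 3) ^+ 2)); first by ring.
by rewrite U; ring.
Qed.

End Cplx.
End ProjectiveLocs.

(** * Extrinsic spheres *)

Section GeodesicSphere.
Context {R : realType} {m k : nat}.
Variables (Q : 'M[R]_m.+1) (r : R).
Hypothesis QQ : Q^T *m Q = 1%:M.
Hypothesis km : (k < m)%N.
Hypothesis t0 : tan r != 0.
Implicit Types (v : 'rV[R]_k) (i j : 'I_k) (p q : 'I_k.+1).

Local Notation tau := (tan r).
Local Notation loc1 := (@linloc R m k.+1 k.+1 (@real_loc R k.+1)).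
Local Notation E := (@locmx R m k.+1 k.+1 (@real_loc R k.+1)).
Local Notation JR n := (fun _ : 'I_1 => 1%:M : 'M[R]_n).
Local Notation J4 := (fun s => @blockJ R 4 m (unitH s)).
Local Notation gloc := (@geodesic_loc R m k r).

Definition gpt v : 'rV[R]_k.+1 := (unitize (raff v^T))^T.

Lemma geodesic_locE v : gloc v = loc1 (tau *: gpt v).
Proof.
rewrite linlocE /= /real_loc; have -> // : (tau *: gpt v)^T = tau *: unitize (raff v^T).
by rewrite linearZ /= trmxK.
Qed.

Lemma gptE v p : gpt v 0 p = rho v `^ (- 2^-1) * raff v^T p 0.
Proof.
rewrite mxE /unitize mxE raff_norm dotm_tr; congr (_ * _).
have -> : 1 + \sum_i v 0 i * v 0 i = rho v.
  by congr (1 + _); apply: eq_bigr => i _; rewrite expr2.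
by rewrite powRN powR12_sqrt// ltW// rho_gt0.
Qed.

Lemma hasdp_raff i p v : hasdp (fun v => raff v^T p 0) i v (p == lift 0 i)%:R.
Proof.
case: (unliftP 0 p) => [j ->|->].
  have -> : (fun v => raff v^T (lift 0 j) 0) = fun v => v 0 j by apply/funext => w;
    rewrite raffS mxE.
  by apply: hasdp_eq (hasdp_coord _ _ _) _; rewrite (inj_eq lift_inj) eq_sym.
have -> : (fun v => raff v^T 0 0) = fun=> 1 by apply/funext => w; rewrite raff00.
exact: hasdp_cst.
Qed.

Definition gtan i p v : R :=
  rho v `^ (- 2^-1) * (p == lift 0 i)%:R - v 0 i * raff v^T p 0 * rho v `^ (- 2^-1 - 1).

Lemma hasdp_gpt i p v : hasdp (fun v => gpt v 0 p) i v (gtan i p v).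
Proof.
have -> : (fun v => gpt v 0 p) = fun v => rho v `^ (- 2^-1) * raff v^T p 0.
  by apply/funext => w; rewrite gptE.
apply: hasdp_eq; first by apply: hasdpM; [exact: hasdp_rhoX|exact: hasdp_raff].
by rewrite /gtan; field.
Qed.

Lemma rhoXS v (e : R) : rho v `^ (e - 1) = rho v `^ e / rho v.
Proof. by rewrite powRB ?powRr1 ?(ltW (rho_gt0 _)) ?rho_neq0 ?implybT. Qed.

Lemma gtanE i p v :
  gtan i p v = rho v `^ (- 2^-1) * ((p == lift 0 i)%:R - v 0 i * raff v^T p 0 / rho v).
Proof. by rewrite /gtan rhoXS; field; exact: rho_neq0. Qed.

(** The round metric of the unit sphere in central projection, the Gram matrix of the [gtan i]; it
    is [fsm] over R with [kap] = 1. *)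
Definition ground v i j : R := (i == j)%:R / rho v - v 0 i * v 0 j / rho v ^+ 2.

(** The Gauss formula of the unit sphere in Euclidean space: a Levi-Civita part along the [gtan],
    and minus the metric times the position vector as normal part. *)
Lemma dp_gtan i j p v : dp (gtan j p) i v =
  - (rho v)^-1 * (v 0 i * gtan j p v + v 0 j * gtan i p v) - ground v i j * gpt v 0 p.
Proof.
have H : hasdp (gtan j p) i v (2 * - 2^-1 * rho v `^ (- 2^-1 - 1) * v 0 i * (p == lift 0 j)%:R
   - (((i == j)%:R * raff v^T p 0 + v 0 j * (p == lift 0 i)%:R) * rho v `^ (- 2^-1 - 1)
      + v 0 j * raff v^T p 0 * (2 * (- 2^-1 - 1) * rho v `^ (- 2^-1 - 1 - 1) * v 0 i))).
  apply: hasdpB.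
    apply: hasdp_eq; first by apply: hasdpM; [exact: hasdp_rhoX|exact: hasdp_cst].
    by rewrite mulr0 addr0.
  apply: hasdpM; last exact: hasdp_rhoX.
  by apply: hasdpM; [exact: hasdp_coord|exact: hasdp_raff].
have [_ ->] := H; rewrite !gtanE gptE /ground !rhoXS.
by field; exact: rho_neq0.
Qed.

Lemma raff_delta i v : \sum_p (p == lift 0 i)%:R * raff v^T p 0 = v 0 i.
Proof.
under eq_bigr do rewrite eq_sym.
by rewrite (sum_delta (fun p => raff v^T p 0)) raffS mxE.
Qed.

Lemma raff_sqr v : \sum_p raff v^T p 0 * raff v^T p 0 = rho v.
Proof.
transitivity (dotm (raff v^T) (raff v^T)); first by rewrite dotmE; apply: eq_bigr => p _;
  rewrite big_ord1.
by rewrite raff_norm dotm_tr; congr (1 + _); apply: eq_bigr => i _; rewrite expr2.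
Qed.

Lemma rho_half v : rho v `^ (- 2^-1) * rho v `^ (- 2^-1) = (rho v)^-1.
Proof.
rewrite -powRD ?rho_neq0 ?implybT//.
have -> : - 2^-1 + - 2^-1 = -1 :> R by field.
by rewrite powR_inv1// ltW// rho_gt0.
Qed.

Lemma gpt_unit v : \sum_p gpt v 0 p * gpt v 0 p = 1.
Proof.
transitivity ((rho v)^-1 * \sum_p raff v^T p 0 * raff v^T p 0).
  by rewrite mulr_sumr; apply: eq_bigr => p _; rewrite gptE -rho_half; ring.
by rewrite raff_sqr mulVf// rho_neq0.
Qed.

Lemma gtan_gpt i v : \sum_p gtan i p v * gpt v 0 p = 0.
Proof.
transitivity ((rho v)^-1 * (\sum_p (p == lift 0 i)%:R * raff v^T p 0
   - v 0 i / rho v * \sum_p raff v^T p 0 * raff v^T p 0)).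
  by rewrite mulrBr !mulr_sumr -sumrB; apply: eq_bigr => p _; rewrite gptE gtanE -rho_half; ring.
by rewrite raff_delta raff_sqr divfK ?rho_neq0// subrr mulr0.
Qed.

Lemma gtan_gtan i j v : \sum_p gtan i p v * gtan j p v = ground v i j.
Proof.
transitivity ((rho v)^-1 * (\sum_p (p == lift 0 i)%:R * (p == lift 0 j)%:R
   - v 0 j / rho v * (\sum_p (p == lift 0 i)%:R * raff v^T p 0)
   - v 0 i / rho v * (\sum_p (p == lift 0 j)%:R * raff v^T p 0)
   + v 0 i * v 0 j / rho v ^+ 2 * \sum_p raff v^T p 0 * raff v^T p 0)).
  rewrite !mulr_sumr -!sumrB -big_split mulr_sumr /=; apply: eq_bigr => p _.
  by rewrite !gtanE mulrACA rho_half; field; exact: rho_neq0.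
rewrite !raff_delta raff_sqr.
have -> : \sum_p (p == lift 0 i)%:R * (p == lift 0 j)%:R = (i == j)%:R :> R.
  under eq_bigr do rewrite (eq_sym _ (lift 0 i)).
  by rewrite (sum_delta (fun p => (p == lift 0 j)%:R)) (inj_eq lift_inj).
by rewrite /ground; field; exact: rho_neq0.
Qed.

Lemma gloc_coord v c : gloc v 0 c = tau * \sum_p gpt v 0 p * E p c.
Proof.
rewrite geodesic_locE -mul_locmx mxE mulr_sumr; apply: eq_bigr => p _.
by rewrite mxE mulrA.
Qed.

Lemma hasdp_gloc i c v : hasdp (fun v => gloc v 0 c) i v (tau * \sum_p gtan i p v * E p c).
Proof.
have -> : (fun v => gloc v 0 c) = fun v => tau * \sum_p gpt v 0 p * E p c.
  by apply/funext => w; rewrite gloc_coord.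
apply: hasdpZ; apply: hasdp_eq.
  by apply: hasdp_sum => p _; apply: hasdpM; [exact: hasdp_gpt|exact: hasdp_cst].
by apply: eq_bigr => p _; rewrite mulr0 addr0.
Qed.

Definition gtanmx v : 'M[R]_(k, k.+1) := \matrix_(i, p) (tau * gtan i p v).

Lemma gtanmxE v i p : gtanmx v i p = tau * gtan i p v.
Proof. by rewrite mxE. Qed.

Lemma jac_gloc v : jac gloc v = gtanmx v *m E.
Proof.
apply/matrixP => i c; rewrite [LHS]mxE -dpE; have [_ ->] := hasdp_gloc i c v.
by rewrite [RHS]mxE mulr_sumr; apply: eq_bigr => p _; rewrite gtanmxE mulrA.
Qed.

(** This is sin^2 r. *)
Definition gkap : R := tau ^+ 2 / (1 + tau ^+ 2).

Lemma tau1_neq0 : 1 + tau ^+ 2 != 0.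
Proof. by rewrite gt_eqF// ltr_pwDl// sqr_ge0. Qed.

Lemma gkap_neq0 : gkap != 0.
Proof. by rewrite mulf_neq0 ?expf_neq0// invr_eq0 tau1_neq0. Qed.

Lemma nsq_gpt v : nsq (tau *: gpt v) = tau ^+ 2.
Proof.
rewrite nsqZ -[RHS]mulr1; congr (_ * _); rewrite -(gpt_unit v).
by apply: eq_bigr => p _; rewrite expr2.
Qed.

Lemma proj_real n (w : 'rV[R]_n) a b : proj (JR n) w a b = w 0 a * w 0 b.
Proof. by rewrite /proj big_ord1 !mulmx1. Qed.

Lemma ambient_pullback v : E *m hmetric Q (gloc v) *m E^T = fsm (JR k.+1) 1 (tau *: gpt v).
Proof.
rewrite -(pullback_linloc QQ km (@real_loc_isom R k.+1) (@real_loc_mul R k.+1) (@real_loc_orth R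
  k.+1)).
by rewrite /pullback jac_linloc geodesic_locE.
Qed.

(** Tangent vectors of the sphere are orthogonal to its position vector, so the projection part of
    the ambient metric drops out and only the factor 1 / rho = 1 / (1 + tan^2 r) remains. *)
Lemma pullback_gloc v : pullback (hmetric Q) gloc v = fsm (JR k) gkap v.
Proof.
rewrite /pullback jac_gloc trmx_mul -!mulmxA (mulmxA E) (mulmxA (E *m _)) ambient_pullback.
apply/matrixP => i j; rewrite [RHS]mxE proj_real [LHS]mxE.
transitivity (\sum_p \sum_q tau ^+ 2 * (gtan i p v * gtan j q v * fsm (JR k.+1) 1 (tau *: gpt v)
  p q)).
  apply: eq_bigr => p _; rewrite gtanmxE [X in _ * X]mxE mulr_sumr.
  by apply: eq_bigr => q _; rewrite [_^T q j]mxE gtanmxE; ring.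
have n1 : rho (tau *: gpt v) = 1 + tau ^+ 2 by rewrite /rho nsq_gpt.
transitivity (tau ^+ 2 * (\sum_p gtan i p v * (\sum_q (p == q)%:R * gtan j q v) / (1 + tau ^+ 2)
   - (\sum_p gtan i p v * gpt v 0 p) * (\sum_q gtan j q v * gpt v 0 q) * (tau ^+ 2 / (1 +
     tau ^+ 2) ^+ 2))).
  rewrite !mulr_suml -sumrB mulr_sumr; apply: eq_bigr => p _.
  rewrite mulr_sumr !mulr_suml mulr_sumr mulr_suml -sumrB mulr_sumr; apply: eq_bigr => q _.
  by rewrite [fsm _ _ _ p q]mxE proj_real n1 ![(tau *: gpt v) 0 _]mxE; field; exact: tau1_neq0.
rewrite !gtan_gpt !mul0r subr0 -mulr_suml.
under eq_bigr => p _ do rewrite (sum_delta (fun q => gtan j q v)).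
by rewrite gtan_gtan /ground /gkap; field; rewrite rho_neq0 tau1_neq0.
Qed.

Lemma christoffel_real n (kap : R) (w : 'rV[R]_n) c a b : kap != 0 ->
  christoffel (fsm (JR n) kap) c a b w =
  - (rho w)^-1 * (w 0 a * (b == c)%:R + w 0 b * (a == c)%:R).
Proof.
move=> k0; rewrite (christoffel_fsm (hypercomplex_real n) k0) big_ord1 !mulmx1.
by rewrite !mxE.
Qed.

(** Every term of the ambient Christoffel contribution carries a factor <gtan, gpt> = 0. What
    remains is the Gauss formula [dp_gtan], whose tangential part is removed by the induced
    connection. *)
Lemma sff_gloc v i j c : sff (hmetric Q) gloc v i j c = - ground v i j * gloc v 0 c.
Proof.
rewrite /sff.
have -> : pullback (hmetric Q) gloc = fsm (JR k) gkap by apply/funext => w; exact: pullback_gloc.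
have jE i0 c0 : jac gloc v i0 c0 = tau * \sum_p gtan i0 p v * E p c0.
  by rewrite mxE -dpE; have [_ ->] := hasdp_gloc i0 c0 v.
have -> : \sum_a \sum_b christoffel (hmetric Q) c a b (gloc v) * jac gloc v i a * jac gloc v j b
  = 0.
  transitivity (\sum_p \sum_q tau ^+ 2 * (gtan i p v * gtan j q v) *
     (\sum_a \sum_b christoffel (hmetric Q) c a b (gloc v) * E p a * E q b)).
    transitivity (\sum_a \sum_b \sum_p \sum_q tau ^+ 2 * (gtan i p v * gtan j q v) *
        (christoffel (hmetric Q) c a b (gloc v) * E p a * E q b)).
      apply: eq_bigr => a _; apply: eq_bigr => b _; rewrite !jE.
      have alg (x y z : R) : x * (tau * y) * (tau * z) = tau ^+ 2 * x * (y * z) by ring.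
      rewrite alg big_distrlr mulr_sumr /=; apply: eq_bigr => p _.
      by rewrite mulr_sumr; apply: eq_bigr => q _; ring.
    under eq_bigr => a _ do rewrite exchange_big; rewrite exchange_big; apply: eq_bigr => p _.
    under eq_bigr => a _ do rewrite exchange_big; rewrite exchange_big; apply: eq_bigr => q _ /=.
    by rewrite mulr_sumr; apply: eq_bigr => a _; rewrite mulr_sumr.
  have C p q : \sum_a \sum_b christoffel (hmetric Q) c a b (gloc v) * E p a * E q b =
      - (1 + tau ^+ 2)^-1 * (tau * gpt v 0 p * E q c + tau * gpt v 0 q * E p c).
    rewrite geodesic_locE (hmetric_fsm QQ).
    rewrite (christoffel_linloc km (hypercomplex_real k.+1) (@real_loc_isom R k.+1)
      (@real_loc_mul R k.+1) (@real_loc_orth R k.+1)).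
    under eq_bigr => l _ do rewrite christoffel_real ?oner_neq0//.
    transitivity (- (1 + tau ^+ 2)^-1 * (tau * gpt v 0 p * (\sum_l (q == l)%:R * E l c)
        + tau * gpt v 0 q * (\sum_l (p == l)%:R * E l c))).
      rewrite !mulr_sumr -big_split mulr_sumr /=; apply: eq_bigr => l _.
      by rewrite /rho nsq_gpt ![(tau *: gpt v) 0 _]mxE; ring.
    by rewrite !(sum_delta (fun l => E l c)).
  transitivity (- (1 + tau ^+ 2)^-1 * tau ^+ 3 * ((\sum_p gtan i p v * gpt v 0 p) * (\sum_q gtan
    j q v * E q c)
      + (\sum_q gtan j q v * gpt v 0 q) * (\sum_p gtan i p v * E p c))).
    rewrite [X in _ = _ * (X + _)]mulr_suml [X in _ = _ * (_ + X)]mulr_sumr -big_split mulr_sumr /=.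
    apply: eq_bigr => p _; rewrite mulr_sumr mulr_suml -big_split mulr_sumr /=.
    by apply: eq_bigr => q _; rewrite C; ring.
  by rewrite !gtan_gpt !mul0r addr0 mulr0.
rewrite addr0 -!dpE.
have -> : dp (dp (fun y => gloc y 0 c) j) i v = tau * \sum_p dp (gtan j p) i v * E p c.
  have -> : dp (fun y => gloc y 0 c) j = fun w => tau * \sum_p gtan j p w * E p c.
    by apply/funext => w; have [_ ->] := hasdp_gloc j c w.
  have gd p : hasdp (gtan j p) i v (dp (gtan j p) i v).
    split => //; apply: differentiableB.
      by apply: differentiableM; [case: (hasdp_rhoX (- 2^-1) i v)|exact: differentiable_cst].
    apply: differentiableM; last by case: (hasdp_rhoX (- 2^-1 - 1) i v).
    by apply: differentiableM; [exact: differentiable_coord_rV|case: (hasdp_raff i p v)].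
  apply: (proj2 (_ : hasdp _ _ _ _)); apply: hasdpZ; apply: hasdp_eq.
    by apply: hasdp_sum => p _; apply: hasdpM; [exact: gd|exact: hasdp_cst].
  by apply: eq_bigr => p _; rewrite mulr0 addr0.
have -> : \sum_l christoffel (fsm (JR k) gkap) l i j v * jac gloc v l c =
   - (rho v)^-1 * (tau * (\sum_p (v 0 i * gtan j p v + v 0 j * gtan i p v) * E p c)).
  under eq_bigr => l _ do rewrite christoffel_real ?gkap_neq0// jE.
  transitivity (- (rho v)^-1 * (v 0 i * (\sum_l (j == l)%:R * (tau * \sum_p gtan l p v * E p c))
     + v 0 j * (\sum_l (i == l)%:R * (tau * \sum_p gtan l p v * E p c)))).
    by rewrite !mulr_sumr -big_split mulr_sumr /=; apply: eq_bigr => l _; ring.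
  rewrite !(sum_delta (fun l => tau * \sum_p gtan l p v * E p c)); congr (_ * _).
  by rewrite !mulr_sumr -big_split /=; apply: eq_bigr => p _; ring.
rewrite gloc_coord !mulr_sumr -sumrB; apply: eq_bigr => p _.
by rewrite dp_gtan; ring.
Qed.

(** In the radial direction the ambient metric is 1 / rho - |w|^2 / rho^2 = 1 / rho^2 times the
    Euclidean one, with rho = 1 + tan^2 r. *)
Lemma gloc_normal v : \sum_c \sum_e hmetric Q (gloc v) c e * gloc v 0 c * gloc v 0 e =
  tau ^+ 2 / (1 + tau ^+ 2) ^+ 2.
Proof.
transitivity (((tau *: gpt v) *m (E *m hmetric Q (gloc v) *m E^T) *m (tau *: gpt v)^T) 0 0).
  have -> : (tau *: gpt v) *m (E *m hmetric Q (gloc v) *m E^T) *m (tau *: gpt v)^T =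
     gloc v *m hmetric Q (gloc v) *m (gloc v)^T.
    by rewrite {2 4}geodesic_locE -mul_locmx trmx_mul !mulmxA.
  rewrite [RHS]mxE exchange_big; apply: eq_bigr => e _ /=.
  rewrite [X in _ = X * _]mxE mulr_suml; apply: eq_bigr => c _.
  by rewrite [_^T e 0]mxE; ring.
rewrite ambient_pullback [LHS]mxE.
have n1 : rho (tau *: gpt v) = 1 + tau ^+ 2 by rewrite /rho nsq_gpt.
set w := tau *: gpt v in n1 *.
have ww : \sum_p w 0 p * w 0 p = tau ^+ 2.
  by rewrite -(nsq_gpt v); apply: eq_bigr => p _; rewrite expr2.
transitivity (\sum_q (w 0 q / (1 + tau ^+ 2) - tau ^+ 2 * w 0 q / (1 + tau ^+ 2) ^+ 2) * w 0 q).
  apply: eq_bigr => q _; rewrite [w^T q 0]mxE; congr (_ * _); rewrite [LHS]mxE.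
  transitivity (\sum_p ((q == p)%:R * (w 0 p / (1 + tau ^+ 2)) - w 0 p * w 0 p * (w 0 q / (1 +
    tau ^+ 2) ^+ 2))).
    by apply: eq_bigr => p _; rewrite [fsm _ _ _ p q]mxE proj_real n1 (eq_sym q); ring.
  rewrite sumrB (sum_delta (fun p => w 0 p / (1 + tau ^+ 2))) -mulr_suml ww; ring.
transitivity ((1 / (1 + tau ^+ 2) - tau ^+ 2 / (1 + tau ^+ 2) ^+ 2) * \sum_q w 0 q * w 0 q).
  by rewrite mulr_sumr; apply: eq_bigr => q _; ring.
by rewrite ww; field; exact: tau1_neq0.
Qed.

(** sigma is the round metric times one vector and the induced metric is [gkap] times the round one,
    so the two traces give k / gkap^2 times the squared length in [gloc_normal]. *)
Lemma sff_normsq_gloc v : sff_normsq (hmetric Q) gloc v = k%:R / tau ^+ 2.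
Proof.
rewrite /sff_normsq pullback_gloc.
set h := invmx _.
have hg i b : \sum_j h i j * ground v j b = gkap^-1 * (i == b)%:R.
  have /matrixP/(_ i b) : h *m fsm (JR k) gkap v = 1%:M.
    by rewrite mulVmx//; have [] := mulmx1_unit (fsmV (hypercomplex_real k) gkap_neq0 v).
  rewrite !mxE => <-; rewrite mulr_sumr; apply: eq_bigr => j _.
  by rewrite [fsm _ _ _ j b]mxE proj_real /ground [RHS]mulrCA mulKf// gkap_neq0.
transitivity (\sum_i \sum_j \sum_a \sum_b h i a * h j b * ground v i j * ground v a b *
    (tau ^+ 2 / (1 + tau ^+ 2) ^+ 2)).
  apply: eq_bigr => i _; apply: eq_bigr => j _; apply: eq_bigr => a _; apply: eq_bigr => b _.
  rewrite -(gloc_normal v) mulr_sumr; apply: eq_bigr => c _; rewrite mulr_sumr.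
  by apply: eq_bigr => e _; rewrite !sff_gloc; ring.
have gsym i j : ground v i j = ground v j i by rewrite /ground (eq_sym i) mulrC; ring.
transitivity (\sum_i \sum_j \sum_a (h i a * ground v i j * (gkap^-1 * (j == a)%:R) *
   (tau ^+ 2 / (1 + tau ^+ 2) ^+ 2))).
  apply: eq_bigr => i _; apply: eq_bigr => j _; apply: eq_bigr => a _.
  rewrite -hg mulr_sumr mulr_suml; apply: eq_bigr => b _; rewrite (gsym a b); ring.
transitivity (\sum_i (gkap^-1 * (tau ^+ 2 / (1 + tau ^+ 2) ^+ 2)) * \sum_j h i j * ground v j i).
  apply: eq_bigr => i _; rewrite mulr_sumr; apply: eq_bigr => j _.
  transitivity (\sum_a (j == a)%:R * (h i a * ground v i j * gkap^-1 * (tau ^+ 2 / (1 +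
    tau ^+ 2) ^+ 2))).
    by apply: eq_bigr => a _; ring.
  by rewrite (sum_delta (fun a => h i a * ground v i j * gkap^-1 * (tau ^+ 2 / (1 +
    tau ^+ 2) ^+ 2))) (gsym i j); ring.
under eq_bigr => i _ do rewrite hg eqxx mulr1.
rewrite sumr_const card_ord -mulr_natr /gkap; field.
by rewrite t0 tau1_neq0.
Qed.

Lemma Lop_gloc f v mu : Cr 2 setT f ->
  laplacian (pullback (hmetric Q) gloc) f v
    + (sff_normsq (hmetric Q) gloc v + k%:R) * f v + mu * f v =
  gkap^-1 * (fslap (JR k) f v + (k%:R + gkap * mu) * f v).
Proof.
move=> fC; rewrite sff_normsq_gloc.
have -> : pullback (hmetric Q) gloc = fsm (JR k) gkap by apply/funext => w; exact: pullback_gloc.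
rewrite (laplacian_fsm (hypercomplex_real k) gkap_neq0)// /gkap; field.
by rewrite t0 tau1_neq0.
Qed.

End GeodesicSphere.

(** * The spectrum of the projective spaces *)

Section Generic.
Context {R : realType}.

(** The list consists of the constant 1 and u1. The points x0 and x1 show their independence, and an
    eigenfunction with eigenvalue below c, being constant, lies in the span. *)
Lemma is_lambda2 m k (S : immersion R m k) (c lam0 : R) (u1 : src S -> R) x0 x1 :
  eigenfunction lam0 (fun _ : src S => 1) -> eigenfunction c u1 -> lam0 <= c ->
  u1 x0 = 0 -> u1 x1 != 0 ->
  (forall mu u, eigenfunction mu u -> mu < c -> exists C, forall x : src S, u x = C) ->
  is_lambda S 2 c.
Proof.
move=> e0 e1 le u0 u10 gap.
exists (fun i => if i == 0%N then lam0 else c), (fun i => if i == 0%N then (fun _ => 1) else u1).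
split=> //=.
- by move=> [|i] [|[|j]] //=.
- by move=> [|[|i]].
- move=> b Hb.
  have b0 : b 0%N = 0 by have := Hb x0; rewrite !big_ord_recl big_ord0 /= u0 mulr1 mulr0 !addr0.
  have b1 : b 1%N = 0.
    by have := Hb x1; rewrite !big_ord_recl big_ord0 /= b0 mul0r add0r addr0 => /eqP;
      rewrite mulf_eq0 (negbTE u10) orbF => /eqP.
  by move=> [|[|i]].
move=> mu u eu; have [cm|mc] := leP c mu; first by right.
left; have [C uC] := gap mu u eu mc.
exists (fun i => if i == 0%N then C else 0) => x.
by rewrite !big_ord_recl big_ord0 /= uC; ring.
Qed.

(** The rows of O are chosen preimages of the [L (X e_i)], orthonormal because X and L are
    isometric. Applied to multiplication by an adapted frame Q, it turns Q into a rotation of the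
    cone. *)
Lemma orth_ext p a b (X : {linear 'rV[R]_p -> 'M[R]_(a, b)}) (L : {linear 'M[R]_(a,
  b) -> 'M[R]_(a, b)}) :
  (forall z w, dotm (X z) (X w) = \sum_i z 0 i * w 0 i) ->
  (forall A B, dotm (L A) (L B) = dotm A B) ->
  (forall z, exists w, L (X z) = X w) ->
  exists O : 'M[R]_p, O^T *m O = 1%:M /\ forall z, L (X z) = X (z *m O).
Proof.
move=> Xi Li LX; have [w Hw] := choice (fun i => LX (delta_mx 0 i)).
pose O := \matrix_i w i; exists O.
have OE z : L (X z) = X (z *m O).
  rewrite {1}(row_sum_delta z) !linear_sum mulmx_sum_row linear_sum; apply: eq_bigr => i _.
  by rewrite !linearZ /= Hw rowK.
split=> //; apply: mulmx1C; apply/matrixP => i j; rewrite mxE.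
transitivity (dotm (X (w i)) (X (w j))).
  by rewrite Xi; apply: eq_bigr => s _; rewrite !mxE.
rewrite -!Hw Li Xi -[RHS]/((1%:M : 'M[R]_p) i j) mxE.
transitivity (\sum_s (i == s)%:R * (s == j)%:R : R); last by rewrite sum_delta.
by apply: eq_bigr => s _; rewrite !mxE !eqxx /= (eq_sym s i).
Qed.

Lemma fslap_cst d k (J : 'I_d.+1 -> 'M[R]_k) (c : R) v : fslap J (fun=> c) v = 0.
Proof.
have D1 a : dp (fun _ : 'rV[R]_k => c) a = fun=> 0 by apply/funext => y; exact: pd_cst.
rewrite /fslap big1 => [|a _]; last first.
  by rewrite big1// => b _; rewrite D1 pd_cst mulr0.
rewrite big1 => [|a _]; first by rewrite !mulr0 addr0 mulr0.
by rewrite D1 mulr0.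
Qed.

Lemma smooth_cst k (c : R) : smooth (fun _ : 'rV[R]_k => c).
Proof. by apply: Cr_smooth => n; exact: Cr_cst. Qed.

Lemma hline_unitize_rscale n (M : 'M[R]_(n, 4)) q : q != 0 ->
  hline (unitize (rscale M q)) = hline (unitize M).
Proof.
move=> q0; suff -> : unitize (rscale M q) = rscale (unitize M) (unitize q).
  by rewrite hline_rscale// unitize_norm.
rewrite /unitize rscale_norm sqrtrM ?dotm_ge0// invfM rscaleZ rscaleZr scalerA.
by [].
Qed.

Lemma hline_self n (M : 'M[R]_(n, 4)) : hline M M.
Proof. by exists (qe 0); [exact: dotm_qe0|rewrite rscalex1]. Qed.

(* [xget] picks an arbitrary element of the orbit; by [rowprod_hline] the choice
   is immaterial. *)
Definition rowprod n (i j : 'I_n) (A : set 'M[R]_(n, 4)) : R :=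
  dotm (row i (xget 0 A)) (row j (xget 0 A)).

Lemma dotm_qmulr (p q r : 'rV[R]_4) : dotm (qmul p r) (qmul q r) = dotm p q * dotm r r.
Proof. by rewrite !dotm4 !qmulEs; ring. Qed.

Lemma rowprod_hline n (i j : 'I_n) (M : 'M[R]_(n, 4)) :
  rowprod i j (hline M) = dotm (row i M) (row j M).
Proof.
have [q q1 E] : hline M (xget 0 (hline M)) by apply: (@xgetPex _ 0); exists M; exact: hline_self.
by rewrite /rowprod E !row_rscale dotm_qmulr q1 mulr1.
Qed.

Lemma dotm_row_unitize n q (i j : 'I_n) (M : 'M[R]_(n, q)) :
  dotm (row i (unitize M)) (row j (unitize M)) = (dotm M M)^-1 * dotm (row i M) (row j M).
Proof.
rewrite /unitize !linearZ /= dotmZl dotmZr mulrA -invfM -expr2 sqr_sqrtr// dotm_ge0//.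
Qed.

End Generic.

(** * Lifting eigenfunctions of a projective space to the cone *)

Section Projective.
Context {R : realType} {m n k d : nat}.
Variables (B : 'M[R]_(d.+1, 4)) (C : {linear 'rV[R]_k -> 'M[R]_(n, 4)}).
Hypotheses (B1 : (qe 0 <= B)%MS)
  (Bdiv : forall p q : 'rV[R]_4, (p <= B)%MS -> (q <= B)%MS -> (qmul p (qconj q) <= B)%MS)
  (CB : forall v, (C v <= B)%MS)
  (Csurj : forall y : 'M[R]_(n, 4), (y <= B)%MS -> exists v, C v = y).
Variables (J : 'I_d.+1 -> 'M[R]_k) (kappa : 'I_4 -> 'I_d.+1 -> R).
Hypothesis nm : (n <= m)%N.
Hypothesis n_gt0 : (0 < n)%N.
Hypothesis dim4 : (4 < d.+1 + k)%N.
Hypothesis hJ : hypercomplex J.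
Hypothesis C_isom : forall v w, dotm (C v) (C w) = \sum_i v 0 i * w 0 i.
Hypothesis C_mul : forall v t, \sum_s kappa s t *: rscale (C v) (qe (s : 'I_4)) = C (v *m J t).
Hypothesis C_orth : forall v w s,
  dotm (rscale (C v) (qe (s : 'I_4))) (C w) = \sum_t kappa s t * dotm (C (v *m J t)) (C w).
Hypothesis B_row : forall t, row t B = \sum_s kappa s t *: qe (s : 'I_4).
Hypothesis B_row0 : row 0 B = qe 0.
Hypothesis B_orth : forall s t, dotm (row s B) (row t B) = (s == t)%:R.

Local Notation S := (@proj_immersion R m d.+1 B n k C B1 Bdiv CB Csurj).
Local Notation V := 'rV[R]_(d.+1 + k).

(** Homogeneous coordinates: for z = (a, v), the first entry is a, an element of K in the basis B,
    and the next n entries are [C v]. *)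
Definition hom (z : V) : 'M[R]_(m.+1, 4) :=
  col_mx (lsubmx z *m B) (pad m (C (rsubmx z))).

Lemma emb_neq0 v : emb v != 0 :> V.
Proof.
apply/eqP => e; have := @delta_neq0 R d.+1 0.
by rewrite -(lsub_emb v) e linear0 eqxx.
Qed.

Lemma hom_linear : linear hom.
Proof.
move=> a u v; rewrite /hom !linearP /= mulmxDl -scalemxAl padD padZ.
by rewrite (@scale_col_mx _ 1 m) (@add_col_mx _ 1 m).
Qed.

HB.instance Definition _ := GRing.isLinear.Build _ _ _ _ hom hom_linear.

Lemma row_sum_mul (u : 'rV[R]_d.+1) : u *m B = \sum_t u 0 t *: row t B.
Proof. by rewrite mulmx_sum_row. Qed.

Lemma dotm_uB (u w : 'rV[R]_d.+1) : dotm (u *m B) (w *m B) = \sum_t u 0 t * w 0 t.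
Proof.
rewrite !row_sum_mul dotm_sumr; apply: eq_bigr => t _.
rewrite dotmC dotm_sumr -[RHS](sum_delta (fun s => u 0 s * w 0 s)); apply: eq_bigr => s _.
rewrite dotmZl dotmZr B_orth; have [->|] := eqVneq s t; first by rewrite mul1r mulr1 mulrC.
by rewrite mul0r !mulr0.
Qed.

Lemma hom_isom z w : dotm (hom z) (hom w) = \sum_i z 0 i * w 0 i.
Proof.
rewrite dotm_col dotm_padl// C_isom dotm_uB big_split_ord /=.
by congr (_ + _); apply: eq_bigr => i _; rewrite !mxE.
Qed.

Lemma nsq_hom z : dotm (hom z) (hom z) = nsq z.
Proof. by rewrite hom_isom; apply: eq_bigr => i _; rewrite expr2. Qed.

Lemma hom_neq0 z : z != 0 -> hom z != 0.
Proof. by rewrite -nsq_gt0 -nsq_hom => h; rewrite -dotm_eq0 gt_eqF. Qed.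

Lemma hom_image (M : 'M[R]_(m.+1, 4)) : (M <= B)%MS ->
  (forall i : 'I_m.+1, (n < i)%N -> row i M = 0) -> exists z, hom z = M.
Proof.
move=> MB Ms; pose M0 := usubmx (M : 'M[R]_(1 + m, 4)); pose M1 := dsubmx (M : 'M[R]_(1 + m, 4)).
have /submxP[u Mu] : (M0 <= B)%MS.
  apply/row_subP => i; have -> : row i M0 = row (lshift m i) (M : 'M[R]_(1 + m, 4)).
    by apply/rowP => c; rewrite !mxE.
  exact: submx_trans (row_sub _ _) MB.
have rM1 i : row i M1 = row (rshift 1 i) (M : 'M[R]_(1 + m, 4)).
  by apply/rowP => c; rewrite !mxE.
have M1B : (M1 <= B)%MS.
  by apply/row_subP => i; rewrite rM1; exact: submx_trans (row_sub _ _) MB.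
have [v Cv] := Csurj (pad_sub n M1B).
exists (row_mx u v); rewrite /hom row_mxKl row_mxKr Cv -Mu padK; last first.
  move=> i ni; rewrite rM1; apply: Ms; rewrite /= add1n ltnS //.
exact: (@vsubmxK _ 1 m).
Qed.

Lemma hom_sub z : (hom z <= B)%MS.
Proof. by rewrite (@col_mx_sub _ 1 m) submxMl pad_sub. Qed.

Lemma hom_supp z (i : 'I_m.+1) : (n < i)%N -> row i (hom z) = 0.
Proof. exact: supp_col_mx. Qed.

Lemma hom_orth (Q : 'M[R]_m.+1) : adapted n Q ->
  exists O : 'M[R]_(d.+1 + k), O^T *m O = 1%:M /\ forall z, Q *m hom z = hom (z *m O).
Proof.
move=> hQ; have QQ : Q^T *m Q = 1%:M by have [] := hQ.
apply: (orth_ext (X := hom) (L := mulmx Q)) => [|A A'|z].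
- exact: hom_isom.
- exact: dotm_orth.
have [||w hw] := @hom_image (Q *m hom z).
- exact: mulmx_sub (hom_sub z).
- by move=> i ni; apply: (adapted_supp hQ) => // j nj; exact: hom_supp.
by exists w.
Qed.

Lemma hom_emb v : hom (emb v) = haff (mxvec (pad m (C v))).
Proof. by rewrite /hom /emb row_mxKl row_mxKr -rowE B_row0 /haff mxvecK. Qed.

Lemma rscale_lin q (x : 'M[R]_(q, 4)) (p p' : 'rV[R]_4) : rscale x (p + p') = rscale x p +
  rscale x p'.
Proof.
apply/row_matrixP => i; rewrite linearD /= !row_rscale.
by apply: quatP; rewrite [RHS]mxE !qmulEs ![(p + p') _ _]mxE; ring.
Qed.

Lemma rscale0 q (x : 'M[R]_(q, 4)) : rscale x 0 = 0.
Proof. by rewrite -[0](scale0r (qe 0)) rscaleZr scale0r. Qed.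

Lemma rscale_sum q (x : 'M[R]_(q, 4)) (I : Type) (r : seq I) (P : pred I) (F : I -> 'rV[R]_4) :
  rscale x (\sum_(i <- r | P i) F i) = \sum_(i <- r | P i) rscale x (F i).
Proof.
elim/big_rec2 : _ => [|i a b _ <-]; first exact: rscale0.
by rewrite rscale_lin.
Qed.

(** The vectors (a, v) and (1, v a^-1) differ by right multiplication by a, so they represent the
    same point. *)
Lemma hom_aff z : lsubmx z != 0 ->
  hom z = rscale (hom (emb (affrow J z))) (lsubmx z *m B).
Proof.
move=> u0; set u := lsubmx z.
rewrite hom_emb /haff mxvecK rscaleE (@mul_col_mx _ 1 m) -!rscaleE rscale_pad [LHS]/hom.
apply: (congr2 (@col_mx R 1 m 4)); last congr (pad m _).
  by rewrite -[RHS](row_id 0) row_rscale row_id qmul1p.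
rewrite -(affrow_mul hJ u0) -/u /Amx mulmx_sumr linear_sum row_sum_mul rscale_sum.
apply: eq_bigr => t _; rewrite -scalemxAr linearZ /= rscaleZr B_row rscale_sum -C_mul.
by congr (_ *: _); apply: eq_bigr => s _; rewrite rscaleZr.
Qed.

Lemma hpar_hom (Q : 'M[R]_m.+1) v :
  hpar Q (mxvec (pad m (C v))) = hline (unitize (Q *m hom (emb v))).
Proof. by rewrite hom_emb. Qed.

Lemma uB_neq0 (u : 'rV[R]_d.+1) : u != 0 -> u *m B != 0.
Proof.
rewrite -nsq_gt0 => u0; rewrite -dotm_eq0 dotm_uB gt_eqF//.
Qed.

Lemma cls_proj z : z != 0 -> proj_subspace B n (hline (unitize (hom z))).
Proof.
move=> z0; exists (unitize (hom z)); split => //.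
- by rewrite unitize_norm// hom_neq0.
- by apply: unitize_sub; exact: hom_sub.
by move=> i ni; rewrite /unitize linearZ /= hom_supp// scaler0.
Qed.

(** Evaluates u at a set without carrying a membership proof; 0 is a default value taken only off
    the submanifold. *)
Definition ext (u : src S -> R) (A : set 'M[R]_(m.+1, 4)) : R :=
  if pselect (proj_subspace B n A) is left h then u (exist _ A h) else 0.

Lemma ext_sval u (s : src S) : ext u (sval s) = u s.
Proof.
case: s => A hA; rewrite /ext /=; case: pselect => // h.
by congr (u (exist _ A _)); exact: Prop_irrelevance.
Qed.

Lemma Lop_proj (i : idx S) f v : Cr 2 setT f -> Lop i f v = fslap J f v + k%:R * f v.
Proof.
move=> fC; have QQ : (sval i)^T *m sval i = 1%:M by have [] := svalP i.
exact: (Lop_linloc QQ nm hJ C_isom C_mul C_orth v fC).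
Qed.

Definition hom_frame (i : idx S) : 'M[R]_(d.+1 + k) := sval (cid (hom_orth (svalP i))).

Lemma hom_frameP i : (hom_frame i)^T *m hom_frame i = 1%:M.
Proof. by rewrite /hom_frame; case: cid => O []. Qed.

Lemma mul_hom_frame i z : sval i *m hom z = hom (z *m hom_frame i).
Proof. by rewrite /hom_frame; case: cid => O []. Qed.

Lemma chart_dom_sym (z : V) : chart_dom z -> chart_dom (- z).
Proof. by rewrite /chart_dom /= linearN /= oppr_eq0. Qed.

Lemma chart_dom_cone (a : R) (z : V) : 0 < a -> chart_dom z -> chart_dom (a *: z).
Proof. by move=> a0; rewrite /chart_dom /= linearZ /= scaler_eq0 negb_or gt_eqF. Qed.

Lemma hom_frame_mulT i (x : V) : x *m (hom_frame i)^T *m hom_frame i = x.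
Proof. by rewrite -mulmxA hom_frameP mulmx1. Qed.

(** The lift has Laplace eigenvalue k + mu, and mu < k + 2 (d + 1) means k + mu < 2 p with p = d + 1
    + k. *)
Lemma proj_gap mu u : eigenfunction (S := S) mu u -> mu < k%:R + 2 * d.+1%:R ->
  exists c, forall x, u x = c.
Proof.
move=> [_ ue] muc.
pose g (z : V) := ext u (hline (unitize (hom z))).
pose f (i : idx S) v := u (par i v).
pose P i := (hom_frame i)^T.
have PP i : (P i)^T *m P i = 1%:M by rewrite trmxK; exact: (mulmx1C (hom_frameP i)).
have fs i : smooth (f i) by have [] := ue i.
have fe i v : fslap J (f i) v + (k%:R + mu) * f i v = 0.
  have [_ /(_ v)] := ue i; rewrite Lop_proj; last exact: (smooth_Cr 2 (fs i)).
  by rewrite mulrDl addrA.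
have gl i x : chart_dom (x *m P i) -> g x = f i (affrow J (x *m P i)).
  move=> xD; rewrite /g -[in LHS](hom_frame_mulT i x) -mul_hom_frame.
  rewrite (hom_aff xD) -rscaleMl hline_unitize_rscale ?uB_neq0//.
  by rewrite -hpar_hom /f -ext_sval.
(* Take a frame Q whose affine chart contains the class of x. If the first entry were zero there, so
   would be row 0 of Q^T times the unit representative, which is a positive multiple of a unit
   quaternion q. *)
have cover x : x != 0 -> exists i, chart_dom (x *m P i).
  move=> x0; have [Q hQ [y yB E]] := proj_cover_subproof Bdiv (cls_proj x0).
  have [v Cv] := Csurj yB; exists (exist _ Q hQ); rewrite /chart_dom /=; apply/eqP => l0.
  have QQ : Q^T *m Q = 1%:M by have [] := hQ.
  have [q q1 Eq] : hpar Q (mxvec (pad m y)) (unitize (hom x)) by rewrite -E; exact: hline_self.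
  have R0 : row 0 (Q^T *m unitize (hom x)) = 0.
    rewrite -[x in hom x](hom_frame_mulT (exist _ Q hQ)) -mul_hom_frame /=.
    rewrite /unitize -scalemxAr mulmxA QQ mul1mx linearZ /= /hom row0_col_mx.
    by rewrite l0 mul0mx scaler0.
  move: R0; rewrite Eq hlift_rho// rscaleZ rscaleMl -scalemxAr mulmxA QQ mul1mx.
  rewrite linearZ /= row_rscale /haff row0_col_mx qmul1p => /eqP.
  rewrite scaler_eq0 gt_eqF ?powR_gt0 ?rho_gt0//= -dotm_eq0 q1.
  by rewrite oner_eq0.
have gu c : (forall z, z != 0 -> g z = c) -> forall s, u s = c.
  move=> gc s; have [x [x1 xB xs As]] := svalP s; have [z zx] := hom_image xB xs.
  have z0 : z != 0 by rewrite -nsq_gt0 -nsq_hom zx x1.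
  by rewrite -(gc z z0) /g zx unitize_id// -As ext_sval.
have [l0|l0] := ltP (k%:R + mu) 0.
  by exists 0; apply: gu; exact: (chart_neg hJ (@open_chart_dom R d k) (@subset_refl _ _)
    chart_dom_cone PP fs fe gl cover l0).
have [c gc] : const_on_punct g.
  apply: (chart_gap2 hJ (@open_chart_dom R d k) (@subset_refl _ _) chart_dom_cone PP fs fe gl
    cover dim4 chart_dom_sym).
  by rewrite l0 natrD /=; lra.
by exists c; apply: gu.
Qed.

Lemma proj_cst_eigen (x : src S) : eigenfunction (S := S) (- k%:R) (fun=> 1).
Proof.
split; first by exists x; exact: oner_neq0.
move=> i; split; first exact: smooth_cst.
move=> v; rewrite Lop_proj; last exact: Cr_cst.
by rewrite fslap_cst /= !mulr1 add0r addrN.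
Qed.

(** On unit representatives this is the real part of the first homogeneous coordinate times the
    conjugate of the second. *)
Definition proj_eigen (s : src S) : R := rowprod 0 (inord 1) (sval s).

Definition hommx : 'M[R]_(d.+1 + k, m.+1 * 4) := lin1_mx (mxvec \o hom).

Lemma hommxE z i c : hom z i c = (z *m hommx) 0 (mxvec_index i c).
Proof. by rewrite mul_rV_lin1 /= mxvecE. Qed.

Lemma ord1_shift : (inord 1 : 'I_m.+1) = lift 0 (Ordinal (leq_trans n_gt0 nm)).
Proof. by apply: val_inj; rewrite /= inordK// ltnS (leq_trans n_gt0 nm). Qed.

Lemma hom_row1 z : row (inord 1) (hom z) = row (Ordinal n_gt0) (C (rsubmx z)).
Proof.
have -> : (inord 1 : 'I_m.+1) = rshift 1 (Ordinal (leq_trans n_gt0 nm)).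
  by rewrite ord1_shift; apply: val_inj.
apply: etrans (@rowKd _ 1 m 4 _ (lsubmx z *m B) (pad m (C (rsubmx z)))) _.
by rewrite row_pad insubT.
Qed.

Lemma hom_row0 z : row 0 (hom z) = lsubmx z *m B.
Proof. exact: row0_col_mx. Qed.

(** The first two homogeneous coordinates depend on disjoint sets of real coordinates of z, so their
    pairing is a quadratic form without diagonal terms, hence harmonic. *)
Lemma hommx_disjoint c : \sum_i hommx i (mxvec_index 0 c) * hommx i (mxvec_index (inord 1) c) = 0.
Proof.
have E i j : hommx i (mxvec_index j c) = row j (hom (delta_mx 0 i)) 0 c.
  by rewrite [RHS]mxE hommxE -rowE [RHS]mxE.
rewrite big1// => i _; rewrite !E hom_row0 hom_row1.
have delta_l t : rsubmx (delta_mx 0 (lshift k t) : V) = 0.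
  by apply/rowP => j; rewrite !mxE eqxx /= eq_sym lr_eq.
have delta_r j : lsubmx (delta_mx 0 (rshift d.+1 j) : V) = 0.
  by apply/rowP => t; rewrite !mxE eqxx /= lr_eq.
case: (split_ordP i) => j ->; first by rewrite delta_l linear0 linear0 [X in _ * X]mxE mulr0.
by rewrite delta_r mul0mx [X in X * _]mxE mul0r.
Qed.

Lemma proj_eigen_eigen : eigenfunction (S := S) (k%:R + 2 * d.+1%:R) proj_eigen.
Proof.
split.
  (* The function is nonzero at the point [1 : 1 : 0 : ...]. *)
  have sub : ((delta_mx (Ordinal n_gt0) 0 : 'cV[R]_n) *m qe 0 <= B)%MS by exact: mulmx_sub B1.
  have [v Cv] := Csurj sub.
  have z0 : emb v != 0 :> V by exact: emb_neq0.
  exists (exist _ _ (cls_proj z0)); rewrite /proj_eigen /= rowprod_hline dotm_row_unitize.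
  rewrite nsq_hom (nsq_emb hJ) hom_row0 hom_row1 lsub_emb -rowE B_row0 /emb row_mxKr Cv.
  have -> : row (Ordinal n_gt0) ((delta_mx (Ordinal n_gt0) 0 : 'cV[R]_n) *m qe 0) = qe 0.
    rewrite row_mul; have -> : row (Ordinal n_gt0) (delta_mx (Ordinal n_gt0) 0 : 'cV[R]_n) = 1%:M.
      by apply/rowP => j; rewrite !mxE !ord1 !eqxx.
    by rewrite mul1mx.
  by rewrite dotm_qe0 mulr1 invr_eq0 rho_neq0.
move=> i.
pose N := hom_frame i *m hommx.
(* In each frame the eigenfunction comes from a quadratic form h, so s = 2. Its Laplacian involves
   only N^T N, from which the orthogonal frame disappears. *)
pose h (z : V) : R := \sum_c (z *m N) 0 (mxvec_index 0 c) * (z *m N) 0 (mxvec_index (inord 1) c).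
have hE z : h z = dotm (row 0 (hom (z *m hom_frame i))) (row (inord 1) (hom (z *m hom_frame i))).
  rewrite dotmE big_ord1; apply: eq_bigr => c _.
  by rewrite [row 0 _ _ _]mxE [row (inord 1) _ _ _]mxE !hommxE -!mulmxA.
have hC p : Cr p setT h.
  by apply: Cr_sum => [|c _]; [exact: openT|apply: CrM; [exact: openT| |]; exact: Cr_lin openT].
have hlap z : lap h z = 0.
  have d1 j : dp h j = fun z => \sum_c (N j (mxvec_index 0 c) * (z *m N) 0 (mxvec_index (inord 1) c)
      + (z *m N) 0 (mxvec_index 0 c) * N j (mxvec_index (inord 1) c)).
    apply/funext => y; apply: (proj2 (_ : hasdp h j y _)).
    by apply: hasdp_sum => c _; apply: hasdpM; exact: hasdp_lin.
  have d2 j : dp (dp h j) j z = \sum_c 2 * (N j (mxvec_index 0 c) * N j (mxvec_index (inord 1) c)).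
    rewrite d1; apply: (proj2 (_ : hasdp _ j z _)); apply: hasdp_eq.
      apply: hasdp_sum => c _; apply: hasdpD; apply: hasdpM; try exact: hasdp_lin; exact: hasdp_cst.
    by apply: eq_bigr => c _ /=; ring.
  rewrite /lap; under eq_bigr do rewrite d2.
  rewrite exchange_big big1// => c _ /=; rewrite -mulr_sumr.
  have -> : \sum_j N j (mxvec_index 0 c) * N j (mxvec_index (inord 1) c) =
      (N^T *m N) (mxvec_index 0 c) (mxvec_index (inord 1) c).
    by rewrite [RHS]mxE; apply: eq_bigr => j _; rewrite [N^T _ _]mxE.
  have -> : N^T *m N = hommx^T *m hommx.
    by rewrite /N trmx_mul mulmxA -(mulmxA _ (hom_frame i)^T) hom_frameP mulmx1.
  rewrite [X in 2 * X]mxE; under eq_bigr do rewrite [hommx^T _ _]mxE.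
  by rewrite hommx_disjoint mulr0.
have haff z : chart_dom z -> h z = nsq (lsubmx z) `^ (2 / 2) * h (emb (affrow J z)).
  move=> zD; rewrite !hE -!mul_hom_frame (hom_aff zD) -rscaleMl !row_rscale dotm_qmulr dotm_uB.
  rewrite divff ?pnatr_eq0// powRr1 ?nsq_ge0// [LHS]mulrC; congr (_ * _).
have E : proj_eigen \o par i = fun v => rho v `^ (- (2 / 2)) * h (emb v).
  apply/funext => v; rewrite /proj_eigen /= hpar_hom rowprod_hline dotm_row_unitize.
  have QQ : (sval i)^T *m sval i = 1%:M by have [] := svalP i.
  rewrite dotm_orth// nsq_hom (nsq_emb hJ) hE mul_hom_frame; congr (_ * _).
  by rewrite divff ?pnatr_eq0// powR_inv1// ltW// rho_gt0.
have sm : smooth (proj_eigen \o par i) by rewrite E; exact: (chart_smooth 2 hC).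
split=> // v; rewrite Lop_proj; last exact: (smooth_Cr 2 sm).
have := chart_eigen hJ (@open_chart_dom R d k) (@subset_refl _ _) hC hlap haff (@emb_dom R d k) v.
rewrite -E natrD => e.
have Ev : rho v `^ (- (2 / 2)) * h (emb v) = proj_eigen (par i v) := esym (congr1 (@^~ v) E).
by rewrite -[RHS]e Ev /=; ring.
Qed.

Lemma proj_lambda2 : is_lambda S 2 (k%:R + 2 * d.+1%:R).
Proof.
have z0 : emb 0 != 0 :> V by exact: emb_neq0.
(* The point [1 : 0 : ...], where the second homogeneous coordinate and hence the eigenfunction
   vanish. *)
pose x0 : src S := exist _ _ (cls_proj z0).
have [[x1 u1] _] := proj_eigen_eigen.
apply: (@is_lambda2 _ _ _ S _ (- k%:R) proj_eigen x0 x1) => //.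
- exact: proj_cst_eigen x0.
- exact: proj_eigen_eigen.
- have k0 : 0 <= k%:R :> R by exact: ler0n.
  have d0 : 0 <= d.+1%:R :> R by exact: ler0n.
  lra.
- rewrite /proj_eigen /= rowprod_hline dotm_row_unitize hom_row1 /emb row_mxKr linear0 linear0.
  by rewrite dotmC dotm0l mulr0.
exact: proj_gap.
Qed.

End Projective.

(** * The spectrum of the spheres *)

Section RoundSphere.
Context {R : realType} {m k : nat}.
Local Notation V := 'rV[R]_(0.+1 + k).
Local Notation JR := (fun _ : 'I_1 => 1%:M : 'M[R]_k).
Variable S : immersion R m k.
Variables (pt : V -> src S) (O : idx S -> 'M[R]_(0.+1 + k)) (kap : R).
Hypothesis k_gt3 : (3 < k)%N.
Hypothesis kap_gt0 : 0 < kap.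
Hypothesis O_orth : forall i, (O i)^T *m O i = 1%:M.
Hypothesis ptZ : forall (a : R) (z : V), 0 < a -> z != 0 -> pt (a *: z) = pt z.
Hypothesis pt_par : forall i v, par i v = pt (emb v *m O i).
Hypothesis pt_inj : forall z z' : V, z != 0 -> z' != 0 -> pt z = pt z' ->
  exists2 a : R, 0 < a & z = a *: z'.
Hypothesis pt_surj : forall s, exists2 z : V, z != 0 & pt z = s.
Hypothesis pt_cover : forall z : V, z != 0 -> exists i, 0 < lsubmx (z *m (O i)^T) 0 0.
Hypothesis Lop_round : forall i f v mu, Cr 2 setT f ->
  Lop (S := S) i f v + mu * f v = kap^-1 * (fslap JR f v + (k%:R + kap * mu) * f v).

(** The cone over one open hemisphere: the points of a sphere are rays, not lines, so the sign of
    the first coordinate must be kept. *)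
Definition half : set V := [set z | 0 < lsubmx z 0 0].

Lemma open_half : open half.
Proof.
have -> : half = (fun z : V => z 0 (lshift k 0)) @^-1` [set x | 0 < x].
  by apply/seteqP; split=> z; rewrite /half /= mxE.
apply: open_comp => [z _|]; last exact: open_gt.
exact: coord_continuous.
Qed.

Lemma half_dom : half `<=` @chart_dom R 0 k.
Proof. by move=> z z0; apply/eqP => l0; move: z0; rewrite /half /= l0 mxE ltxx. Qed.

Lemma half_cone (a : R) (z : V) : 0 < a -> half z -> half (a *: z).
Proof. by move=> a0 z0; rewrite /half /= linearZ /= mxE mulr_gt0. Qed.

Lemma half_emb (v : 'rV[R]_k) : half (emb v).
Proof. by rewrite /half /= lsub_emb mxE !eqxx ltr01. Qed.

Lemma half_affrow (z : V) : half z -> z = lsubmx z 0 0 *: emb (affrow JR z).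
Proof.
move=> z0; have zD := half_dom z0.
have := affrow_mul (hypercomplex_real k) zD.
rewrite /Amx big_ord1 -scalemxAr mulmx1 => E.
rewrite -[LHS]hsubmxK /emb scale_row_mx E; congr row_mx.
by apply/rowP => j; rewrite ord1 !mxE !eqxx mulr1.
Qed.

Lemma half_neq0 (z : V) : half z -> z != 0.
Proof. by move=> /half_dom; apply: contraNneq => ->; rewrite linear0. Qed.

Lemma nsq_frame i (z : V) : nsq (z *m O i) = nsq z.
Proof. by rewrite !nsq_dot trmx_mul mulmxA -(mulmxA z) (mulmx1C (O_orth i)) mulmx1. Qed.

Lemma frame_neq0 i (z : V) : z != 0 -> z *m O i != 0.
Proof. by rewrite -!nsq_gt0 nsq_frame. Qed.

Lemma mulmx_frameK i (z : V) : z *m (O i)^T *m O i = z.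
Proof. by rewrite -mulmxA O_orth mulmx1. Qed.

(** The lift has Laplace eigenvalue k + kap mu, which is below k = p - 1 when mu < 0. *)
Lemma round_gap mu u : eigenfunction (S := S) mu u -> mu < 0 ->
  exists c, forall x, u x = c.
Proof.
move=> [_ ue] mu0.
pose g z := u (pt z).
pose f i v := u (par i v).
pose P i := (O i)^T.
have PP i : (P i)^T *m P i = 1%:M by rewrite trmxK; exact: (mulmx1C (O_orth i)).
have fs i : smooth (f i) by have [] := ue i.
have fe i v : fslap JR (f i) v + (k%:R + kap * mu) * f i v = 0.
  have [_ /(_ v)] := ue i; rewrite (Lop_round _ _ _ (smooth_Cr 2 (fs i))) => /eqP.
  by rewrite mulf_eq0 invr_eq0 gt_eqF//= => /eqP.
have gl i x : half (x *m P i) -> g x = f i (affrow JR (x *m P i)).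
  move=> xD; rewrite /g /f pt_par -[in LHS](mulmx_frameK i x).
  rewrite {1}(half_affrow xD) -scalemxAl ptZ//.
  by apply: frame_neq0; exact: half_neq0 (half_emb _).
have gu c : (forall z, z != 0 -> g z = c) -> forall s, u s = c.
  by move=> gc s; have [z z0 <-] := pt_surj s; exact: gc.
have [l0|l0] := ltP (k%:R + kap * mu) 0.
  by exists 0; apply: gu; exact: (chart_neg (hypercomplex_real k) open_half half_dom half_cone
    PP fs fe gl pt_cover l0).
have [c gc] : const_on_punct g.
  apply: (chart_gap1 (hypercomplex_real k) open_half half_dom half_cone PP fs fe gl pt_cover).
    by rewrite add1n ltnS.
  by rewrite l0 natrD /= addrAC subrr add0r gtrDl pmulr_rlt0.
by exists c; apply: gu.
Qed.

Lemma round_cst_eigen (x : src S) : eigenfunction (S := S) (- (k%:R / kap)) (fun=> 1).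
Proof.
split; first by exists x; exact: oner_neq0.
move=> i; split; first exact: smooth_cst.
move=> v; rewrite (@Lop_round i (fun=> 1) v); last exact: Cr_cst.
by rewrite fslap_cst mulrN mulrCA divff ?gt_eqF// !mulr1 subrr ?mul0r addr0 mulr0.
Qed.

Definition height (z : V) : R := lsubmx z 0 0 / Num.sqrt (nsq z).

Lemma heightZ (a : R) (z : V) : 0 < a -> height (a *: z) = height z.
Proof.
move=> a0; rewrite /height nsqZ sqrtrM ?sqr_ge0// sqrtr_sqr gtr0_norm//.
rewrite linearZ /= mxE invfM; move: (Num.sqrt _)^-1 => t.
by rewrite mulrACA divff ?mul1r// gt_eqF.
Qed.

(** The representative is an arbitrary choice; two of them differ by a positive factor, under which
    [height] is invariant. *)
Definition round_eigen (s : src S) : R := height (sval (cid2 (pt_surj s))).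

Lemma round_eigenE (z : V) : z != 0 -> round_eigen (pt z) = height z.
Proof.
move=> z0; rewrite /round_eigen; case: cid2 => z' z'0 /= E.
by have [a a0 ->] := pt_inj z'0 z0 E; exact: heightZ.
Qed.

Lemma round_eigen_eigen : eigenfunction (S := S) 0 round_eigen.
Proof.
split.
  have e0 : half (emb 0) := half_emb 0; exists (pt (emb 0)).
  rewrite round_eigenE ?half_neq0// mulf_neq0 ?gt_eqF// invr_gt0 sqrtr_gt0.
  by rewrite nsq_gt0 half_neq0.
move=> i; pose h (z : V) : R := (z *m O i) 0 (lshift k 0).
have hC p : Cr p setT h by exact: (Cr_lin _ _ _ openT).
have hlap z : lap h z = 0.
  rewrite /lap big1// => j _.
  have -> : dp h j = fun=> O i j (lshift k 0) by apply/funext => y;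
    have [_ ->] := hasdp_lin (O i) (lshift k 0) j y.
  exact: pd_cst.
have haff z : half z -> h z = nsq (lsubmx z) `^ (1 / 2) * h (emb (affrow JR z)).
  move=> z0; rewrite {1}(half_affrow z0) /h -scalemxAl mxE; congr (_ * _).
  rewrite mul1r powR12_sqrt ?nsq_ge0// /nsq big_ord1 sqrtr_sqr gtr0_norm//.
have E : round_eigen \o par i = fun v => rho v `^ (- (1 / 2)) * h (emb v).
  apply/funext => v; rewrite /= pt_par round_eigenE; last first.
    by apply: frame_neq0; exact: half_neq0 (half_emb _).
  rewrite /height nsq_frame (nsq_emb (hypercomplex_real k)) [lsubmx _ _ _]mxE mulrC.
  by rewrite powRN mul1r powR12_sqrt// ltW// rho_gt0.
have sm : smooth (round_eigen \o par i) by rewrite E; exact: (chart_smooth 1 hC).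
split=> // v; rewrite -[round_eigen (par i v)]/((round_eigen \o par i) v).
rewrite (Lop_round _ _ _ (smooth_Cr 2 sm)).
have := chart_eigen (hypercomplex_real k) open_half half_dom hC hlap haff half_emb v.
rewrite -E natrD => e.
have Ev : rho v `^ (- (1 / 2)) * h (emb v) = (round_eigen \o par i) v := esym (congr1 (@^~ v) E).
(* For s = 1 the eigenvalue s (s + p - 2) is k, which cancels the zeroth-order term of L. *)
have ek : 1 * (1 + (0.+1%:R + k%:R) - 2) = k%:R :> R by rewrite mul1r; lra.
by move: e; rewrite Ev ek mulr0 addr0 => ->; rewrite mulr0.
Qed.

Lemma round_lambda2 : is_lambda S 2 0.
Proof.
have k0 : (0 < k)%N by apply: leq_trans k_gt3.
pose z0 : V := delta_mx 0 (rshift 1 (Ordinal k0)).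
have [[x1 u1] _] := round_eigen_eigen.
apply: (@is_lambda2 _ _ _ S _ (- (k%:R / kap)) round_eigen (pt z0) x1) => //.
- exact: round_cst_eigen x1.
- exact: round_eigen_eigen.
- by rewrite oppr_le0 divr_ge0// ltW.
- rewrite round_eigenE ?delta_neq0// /height.
  by rewrite [lsubmx _ _ _]mxE mxE eqxx lr_eq mul0r.
exact: round_gap.
Qed.

End RoundSphere.

Section Unitize.
Context {R : realType}.

Lemma nsq_dotm p (z : 'rV[R]_p) : dotm z z = nsq z.
Proof. by rewrite dotmE big_ord1; apply: eq_bigr => i _; rewrite expr2. Qed.

Lemma sum_dotm p (z w : 'rV[R]_p) : \sum_i z 0 i * w 0 i = dotm z w.
Proof. by rewrite dotmE big_ord1. Qed.

Lemma unitize_orthr p (z : 'rV[R]_p) (O : 'M[R]_p) :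
  O^T *m O = 1%:M -> unitize (z *m O) = unitize z *m O.
Proof.
move=> OO; rewrite /unitize -scalemxAl; congr ((Num.sqrt _)^-1 *: _).
by rewrite !nsq_dotm !nsq_dot trmx_mul mulmxA -(mulmxA z) (mulmx1C OO) mulmx1.
Qed.

Lemma unitize_eq p (z z' : 'rV[R]_p) : z != 0 -> z' != 0 ->
  unitize z = unitize z' -> exists2 a : R, 0 < a & z = a *: z'.
Proof.
move=> z0 z'0 E.
have s0 y : y != 0 -> 0 < Num.sqrt (dotm y y) by move=> y0; rewrite sqrtr_gt0 dotm_gt0.
exists (Num.sqrt (dotm z z) / Num.sqrt (dotm z' z')); first by rewrite divr_gt0 ?s0.
by rewrite -scalerA -/(unitize z') -E scalerA divff ?scale1r// gt_eqF ?s0.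
Qed.

Lemma unitizeN q n (e : R) (x : 'M[R]_(q, n)) : e * e = 1 -> unitize (e *: x) = e *: unitize x.
Proof. by move=> ee; rewrite /unitize dotmZl dotmZr mulrA ee mul1r !scalerA mulrC. Qed.

Section Isometry.
Context {p a b : nat} (X : {linear 'rV[R]_p -> 'M[R]_(a, b)}).
Hypothesis X_isom : forall z w, dotm (X z) (X w) = \sum_i z 0 i * w 0 i.

Lemma unitize_isom z : unitize (X z) = X (unitize z).
Proof. by rewrite /unitize X_isom sum_dotm linearZ. Qed.

Lemma isom_inj : injective X.
Proof.
move=> z w E; apply/eqP; rewrite -subr_eq0 -dotm_eq0 -sum_dotm -X_isom linearB /= E subrr.
by rewrite /dotm mul0mx mxtrace0.
Qed.

End Isometry.

Lemma hline_real_inj n (a b : 'cV[R]_n) : dotm a a = 1 -> dotm b b = 1 ->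
  hline (a *m qe 0) = hline (b *m qe 0) -> exists2 e : R, e * e = 1 & a = e *: b.
Proof.
move=> a1 b1 E.
have [q q1] : hline (b *m qe 0) (a *m qe 0) by rewrite -E; exact: hline_self.
rewrite rscale_real => H.
have aq : a = q 0 (inord 0) *: b.
  apply/colP => i; move/matrixP/(_ i (inord 0)): H.
  by rewrite !mxE !big_ord1 qeE//= mulr1 mulrC => ->.
exists (q 0 (inord 0)) => //.
by rewrite -[RHS]a1 aq dotmZl dotmZr b1 mulr1.
Qed.

Lemma hline_signed n (e : R) (a : 'cV[R]_n) : e * e = 1 ->
  hline ((e *: a) *m qe 0) = hline (a *m qe 0).
Proof.
move=> ee; have -> : (e *: a) *m qe 0 = rscale (a *m qe 0) (e *: qe 0).
  by rewrite rscale_real -scalemxAr scalemxAl.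
by rewrite hline_rscale// dotmZl dotmZr dotm_qe0 mulr1.
Qed.

Lemma sval_injective (T : Type) (P : T -> Prop) : injective (@sval T P).
Proof. by move=> [x hx] [y hy] /= E; exact: eq_exist. Qed.

Lemma unitize_tr p (z : 'rV[R]_p) : unitize z^T = (unitize z)^T.
Proof. by rewrite /unitize dotm_tr sum_dotm linearZ. Qed.

End Unitize.

Section RoundClass.
Context {R : realType} {m k : nat}.
Local Notation V := 'rV[R]_(0.+1 + k).
Variables (S : immersion R m k) (X : Type) (cls : src S -> X) (F : V -> X).
Variables (O : idx S -> 'M[R]_(0.+1 + k)) (kap : R).
Hypothesis k_gt3 : (3 < k)%N.
Hypothesis kap_gt0 : 0 < kap.
Hypothesis O_orth : forall i, (O i)^T *m O i = 1%:M.
Hypothesis cls_inj : injective cls.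
Hypothesis FZ : forall (a : R) (z : V), 0 < a -> F (a *: z) = F z.
Hypothesis cls_par : forall i v, cls (par i v) = F (emb v *m O i).
Hypothesis F_inj : forall z z' : V, z != 0 -> z' != 0 -> F z = F z' ->
  exists2 a : R, 0 < a & z = a *: z'.
Hypothesis F_cover : forall z : V, z != 0 -> exists i, 0 < lsubmx (z *m (O i)^T) 0 0.
Hypothesis Lop_round : forall i f v mu, Cr 2 setT f ->
  Lop (S := S) i f v + mu * f v =
  kap^-1 * (fslap (fun _ : 'I_1 => 1%:M) f v + (k%:R + kap * mu) * f v).

(** Equalities between points are tested through the injective [cls], computed on the cone by F. The
    map [pt] from the cone to the manifold is then obtained by choice. *)
Lemma round_class_lambda2 : is_lambda S 2 0.
Proof.
have e0 : emb 0 != 0 :> V := half_neq0 (half_emb 0).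
have mkO i (z : V) : z *m (O i)^T *m O i = z by rewrite -mulmxA O_orth mulmx1.
(* At z = 0 any point will do; it is supplied only because the choice must be total. *)
have ex (z : V) : exists s, z != 0 -> cls s = F z.
  have [->|z0] := eqVneq z 0.
    by have [i _] := F_cover e0; exists (par i 0).
  have [i zi] := F_cover z0; have zh : half (z *m (O i)^T) := zi.
  exists (par i (affrow (fun=> 1%:M) (z *m (O i)^T))) => _.
  by rewrite cls_par -[in RHS](mkO i z) [in RHS](half_affrow zh) -scalemxAl FZ.
have [pt ptE] := choice ex.
have eO i v : emb v *m O i != 0 by exact: (frame_neq0 O_orth i (half_neq0 (half_emb v))).
apply: (@round_lambda2 _ _ _ S pt O kap) => //.
- move=> a z a0 z0; apply: cls_inj; rewrite !ptE ?FZ//.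
  by rewrite scaler_eq0 negb_or gt_eqF.
- by move=> i v; apply: cls_inj; rewrite ptE// cls_par.
- by move=> z z' z0 z'0 /(congr1 cls); rewrite !ptE//; exact: F_inj.
move=> s; have [i [v <-]] := par_cover s.
by exists (emb v *m O i) => //; apply: cls_inj; rewrite ptE// cls_par.
Qed.

End RoundClass.

(** * The double covering by the unit sphere *)

Section Sphere.
Context {R : realType} {m k : nat}.
Hypothesis km : (k <= m)%N.
Hypothesis k_gt3 : (3 < k)%N.
Local Notation V := 'rV[R]_(0.+1 + k).

Definition sph (z : V) : 'cV[R]_m.+1 := col_mx (lsubmx z) (pad m (rsubmx z)^T).

Lemma sph_linear : linear sph.
Proof.
move=> a u v; rewrite /sph !linearP /= padD padZ.
by rewrite (@scale_col_mx _ 1 m) (@add_col_mx _ 1 m).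
Qed.

HB.instance Definition _ := GRing.isLinear.Build _ _ _ _ sph sph_linear.

Lemma sph_isom z w : dotm (sph z) (sph w) = \sum_i z 0 i * w 0 i.
Proof.
rewrite dotm_col dotm_padl// dotm_tr -sum_dotm big_split_ord /=.
by congr (_ + _); apply: eq_bigr => i _; rewrite !mxE.
Qed.

Lemma sph_emb v : sph (emb v) = raff (pad m v^T).
Proof.
rewrite /sph /emb row_mxKl row_mxKr /raff; apply: (congr2 (@col_mx R 1 m 1)) => //.
by apply/matrixP => i j; rewrite !ord1 !mxE.
Qed.

Lemma sph_image (x : 'cV[R]_m.+1) :
  (forall i : 'I_m.+1, (k < i)%N -> row i x = 0) -> exists z, sph z = x.
Proof.
move=> xs; pose x0 := usubmx (x : 'M[R]_(1 + m, 1)); pose x1 := dsubmx (x : 'M[R]_(1 + m, 1)).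
have rx i : row i x1 = row (rshift 1 i) (x : 'M[R]_(1 + m, 1)).
  by apply/rowP => c; rewrite !mxE.
exists (row_mx x0 (pad k x1)^T); rewrite /sph row_mxKl row_mxKr trmxK padK; last first.
  by move=> i ki; rewrite rx; apply: xs; rewrite /= add1n ltnS.
exact: (@vsubmxK _ 1 m).
Qed.

Lemma sph_orth (Q : 'M[R]_m.+1) : adapted k Q ->
  exists O : 'M[R]_(0.+1 + k), O^T *m O = 1%:M /\ forall z, Q *m sph z = sph (z *m O).
Proof.
move=> hQ; have QQ : Q^T *m Q = 1%:M by have [] := hQ.
apply: (orth_ext (X := sph) (L := mulmx Q)) => [|A A'|z].
- exact: sph_isom.
- exact: dotm_orth.
have [|w hw] := @sph_image (Q *m sph z); last by exists w.
by move=> i ni; apply: (adapted_supp hQ) => // j nj; exact: supp_col_mx.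
Qed.

Local Notation S := (S_immersion m k : immersion R m k).

Definition sph_frame (i : idx S) : 'M[R]_(0.+1 + k) := sval (cid (sph_orth (svalP i))).

Lemma sph_frameP i : (sph_frame i)^T *m sph_frame i = 1%:M.
Proof. by rewrite /sph_frame; case: cid => O []. Qed.

Lemma mul_sph_frame i z : sval i *m sph z = sph (z *m sph_frame i).
Proof. by rewrite /sph_frame; case: cid => O []. Qed.

Lemma sphere_lambda2 : is_lambda S 2 0.
Proof.
have QQ (i : idx S) : (sval i)^T *m sval i = 1%:M by have [] := svalP i.
apply: (@round_class_lambda2 R m k S 'cV[R]_m.+1 sval (fun z => sph (unitize z)) sph_frame 1) => //.
- exact: sph_frameP.
- exact: sval_injective.
- by move=> a z a0; rewrite unitizeZ.
- move=> i v; rewrite /= /sphere_lift -sph_emb mul_sph_frame.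
  by rewrite (unitize_isom sph_isom).
- by move=> z z' z0 z'0 /(isom_inj sph_isom); exact: unitize_eq.
- move=> z z0; have Xz0 : sph z != 0.
    by rewrite -dotm_eq0 sph_isom sum_dotm dotm_eq0.
  have Xs : sphere k (unitize (sph z)).
    split; first exact: unitize_norm.
    move=> i ki; rewrite mxE; have /rowP/(_ 0) := supp_col_mx (lsubmx z) (rsubmx z)^T ki.
    by rewrite !mxE => ->; rewrite mulr0.
  (* A frame centred at z / |z| takes z to a positive multiple of [emb 0], which lies in [half]. *)
  have [Q hQ] := sphere_cover_subproof Xs.
  rewrite /sphere_lift trmx0 pad0 raff0 => QE.
  have E : Q *m delta_mx 0 0 = unitize (sph z).
    by rewrite -QE unitize_id// dotm_orth ?dotm_delta ?eqxx//; have [] := hQ.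
  exists (exist _ Q hQ); set i : idx S := exist _ Q hQ.
  have -> : z *m (sph_frame i)^T = Num.sqrt (dotm (sph z) (sph z)) *: emb 0.
    apply: (isom_inj sph_isom); apply: (can_inj (mulKmx (mulmx1_unit (QQ i)).2)).
    rewrite mul_sph_frame -mulmxA sph_frameP mulmx1 linearZ /= sph_emb trmx0 pad0 raff0.
    by rewrite -scalemxAr E /unitize scalerA divff ?scale1r// gt_eqF// sqrtr_gt0 dotm_gt0.
  by apply: half_cone (half_emb 0); rewrite sqrtr_gt0 dotm_gt0.
move=> i f v mu fC; rewrite /Lop /=.
have := Lop_linloc (QQ i) km (hypercomplex_real k) (@real_loc_isom R k) (@real_loc_mul R k)
  (@real_loc_orth R k) v fC.
rewrite /linloc /real_loc => ->.
by rewrite invr1 mul1r; ring.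
Qed.

End Sphere.

(** * The geodesic spheres *)

Section GeodesicLambda.
Context {R : realType} {m k : nat}.
Variables (P : set 'M[R]_(m.+1, 4)) (r : R) (Q0 : 'M[R]_m.+1).
Hypotheses (hk : (k < m)%N) (hr : 0 < r < pi / 2) (hP : RPset k.+1 P).
Hypothesis k_gt3 : (3 < k)%N.
Hypotheses (Q0_sym : Q0^T = Q0) (Q0K : Q0 *m Q0 = 1%:M) (Q0_adapted : adapted k.+1 Q0).
Hypothesis PE : P = hline ((Q0 *m delta_mx 0 0) *m qe 0).
Local Notation V := 'rV[R]_(0.+1 + k).
Local Notation e0 := (delta_mx 0 0 : 'cV[R]_m.+1).
Local Notation S := (geodesic_sphere_immersion hk hr hP).

Definition geo (w : V) : 'cV[R]_m.+1 := col_mx (0 : 'M[R]_1) (pad m w^T).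

Lemma geo_linear : linear geo.
Proof.
move=> a u v; rewrite /geo !linearP /= padD padZ.
rewrite (@scale_col_mx _ 1 m) (@add_col_mx _ 1 m).
by rewrite scaler0 addr0.
Qed.

HB.instance Definition _ := GRing.isLinear.Build _ _ _ _ geo geo_linear.

Lemma geo_isom z w : dotm (geo z) (geo w) = \sum_i z 0 i * w 0 i.
Proof.
rewrite dotm_col dotm_padl// dotm_tr.
by rewrite dotm0l add0r.
Qed.

Lemma raffD (c : 'cV[R]_m) : raff c = e0 + col_mx (0 : 'M[R]_1) c.
Proof.
rewrite -(@raff0 R m) /raff (@add_col_mx _ 1 m).
by rewrite addr0 add0r.
Qed.

Lemma dotm_e0 (x : 'cV[R]_m.+1) : dotm e0 x = x 0 0.
Proof.
rewrite dotmE (bigD1 0)//= big_ord1 mxE !eqxx mul1r big1 ?addr0// => i i0.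
by rewrite big_ord1 mxE (negbTE i0) mul0r.
Qed.

Lemma geo_e0 z : dotm e0 (geo z) = 0.
Proof.
have -> : e0 = col_mx (1%:M : 'M[R]_1) 0 by rewrite -[LHS](@raff0 R m).
by rewrite dotm_col dotm0l (dotmC 1%:M) dotm0l addr0.
Qed.

Lemma geo_supp z (i : 'I_m.+1) : (k.+1 < i)%N -> row i (geo z) = 0.
Proof. exact: (@supp_col_mx R m k.+1). Qed.

Lemma geo_image (x : 'cV[R]_m.+1) : dotm e0 x = 0 ->
  (forall i : 'I_m.+1, (k.+1 < i)%N -> row i x = 0) -> exists z, geo z = x.
Proof.
rewrite dotm_e0 => x00 xs; pose x1 := dsubmx (x : 'M[R]_(1 + m, 1)).
have rx i : row i x1 = row (rshift 1 i) (x : 'M[R]_(1 + m, 1)).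
  by apply/rowP => c; rewrite !mxE.
exists (pad k.+1 x1)^T; rewrite /geo trmxK padK; last first.
  by move=> i ki; rewrite rx; apply: xs; rewrite /= add1n ltnS.
rewrite -[RHS](@vsubmxK _ 1 m); congr (@col_mx _ 1 m _ _ _).
apply/matrixP => i j; rewrite !ord1 !mxE -[LHS]x00; congr (x _ _); exact: val_inj.
Qed.

(** An unnormalised representative (1, tan r w) in coordinates centred at e_0. The reflection Q0,
    which takes e_0 to a unit vector representing the centre P, carries it to its place. *)
Definition geo_pt (z : V) : 'cV[R]_m.+1 := e0 + tan r *: geo (unitize z).

Lemma geo_pt_norm z : z != 0 -> dotm (geo_pt z) (geo_pt z) = 1 + tan r ^+ 2.
Proof.
move=> z0; rewrite dotmDl !dotmDr !dotmZl !dotmZr geo_e0 (dotmC _ e0) geo_e0.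
by rewrite geo_isom sum_dotm unitize_norm// dotm_e0 mxE !eqxx /=; ring.
Qed.

(** P determines its real unit representative only up to a sign e, so a frame Q centred at P agrees
    with Q0 on e_0 up to e. Then e Q0 Q fixes e_0 and rotates the orthogonal space that contains the
    directions [geo z]. *)
Lemma geodesic_orth (Q : 'M[R]_m.+1) : adapted k.+1 Q -> hpar Q 0 = P ->
  exists (eO : R * 'M[R]_(0.+1 + k)), let e := eO.1 in let O := eO.2 in
  [/\ e * e = 1, O^T *m O = 1%:M, Q *m e0 = e *: (Q0 *m e0) &
    forall z, Q *m geo z = e *: (Q0 *m geo (z *m O))].
Proof.
move=> hQ; have QQ : Q^T *m Q = 1%:M by have [] := hQ.
have e01 : dotm e0 e0 = 1 by rewrite dotm_e0 mxE !eqxx.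
have Q0Q0 : Q0^T *m Q0 = 1%:M by rewrite Q0_sym.
rewrite hline_real0// PE => /hline_real_inj [||e ee Qe]; rewrite ?dotm_orth//.
pose G := e *: (Q0 *m Q).
have GG : G^T *m G = 1%:M.
  have -> : G^T = e *: (Q0 *m Q)^T by rewrite /G linearZ.
  rewrite /G -scalemxAl -scalemxAr scalerA ee scale1r trmx_mul.
  by rewrite mulmxA -(mulmxA Q^T) Q0Q0 mulmx1.
have Ge : G *m e0 = e0.
  rewrite /G -scalemxAl -mulmxA Qe -scalemxAr scalerA ee scale1r mulmxA Q0K.
  by rewrite mul1mx.
have [A A'|z|O [OO GO]] := @orth_ext R _ _ _ geo (mulmx G) geo_isom.
- exact: dotm_orth.
- have [||w hw] := @geo_image (G *m geo z); last by exists w.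
    by rewrite -{1}Ge dotm_orth// geo_e0.
  move=> i ki; rewrite /G -scalemxAl -mulmxA linearZ /=.
  rewrite (adapted_supp Q0_adapted) ?scaler0// => j kj.
  by apply: (adapted_supp hQ) => // l; exact: geo_supp.
exists (e, O); split => //= z.
rewrite -GO /= /G -scalemxAl -scalemxAr scalerA ee scale1r !mulmxA Q0K.
by rewrite mul1mx.
Qed.

Definition geo_frame (i : idx S) : R * 'M[R]_(0.+1 + k) :=
  sval (cid (geodesic_orth (proj1 (svalP i)) (proj2 (svalP i)))).

Lemma geo_frameP (i : idx S) (e := (geo_frame i).1) (O := (geo_frame i).2) :
  [/\ e * e = 1, O^T *m O = 1%:M, sval i *m e0 = e *: (Q0 *m e0) &
    forall z, sval i *m geo z = e *: (Q0 *m geo (z *m O))].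
Proof. by rewrite /e /O /geo_frame; case: cid. Qed.

Lemma geodesic_sphere_lambda2_frame : is_lambda S 2 0.
Proof.
have [r0 rpi] := andP hr.
have cr : 0 < cos r.
  by rewrite cos_gt0_pihalf// rpi andbT (lt_trans _ r0)// oppr_lt0 divr_gt0// pi_gt0.
have t0 : 0 < tan r by rewrite /tan divr_gt0// sin_gt0_pihalf// r0.
have tn : tan r != 0 by rewrite gt_eqF.
have gk0 : 0 < gkap r by rewrite /gkap divr_gt0 ?exprn_gt0// ltr_pwDl// sqr_ge0.
have e01 : dotm e0 e0 = 1 by rewrite dotm_e0 mxE !eqxx.
have Q0Q0 : Q0^T *m Q0 = 1%:M by rewrite Q0_sym.
have Q0inj n : injective (mulmx Q0 : 'M[R]_(_, n) -> _).
  by move=> x y /(congr1 (mulmx Q0)); rewrite !mulmxA Q0K !mul1mx.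
apply: (@round_class_lambda2 R m k S _ sval
  (fun z => hline (unitize (Q0 *m geo_pt z) *m qe 0)) (fun i => (geo_frame i).2) (gkap r)).
- exact: k_gt3.
- exact: gk0.
- by move=> i; have [] := geo_frameP i.
- exact: sval_injective.
- by move=> a z a0; rewrite /geo_pt unitizeZ.
- move=> i v; have [ee OO Qe QO] := geo_frameP i.
  rewrite /= /geodesic_loc padM /hpar hlift_real.
  have -> : raff (pad m (tan r *: unitize (raff v^T))) = geo_pt (emb v).
    rewrite raffD /geo_pt /geo (@scale_col_mx _ 1 m) scaler0 -padZ; congr (_ + _).
    apply: (congr2 (@col_mx R 1 m 1)) => //; congr (pad m (_ *: _)).
    rewrite -unitize_tr; congr unitize.
    rewrite /raff /emb (@tr_row_mx _ 1 1 k); congr (@col_mx _ 1 k _ _ _).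
    by apply/matrixP => a b; rewrite !ord1 !mxE.
  have -> : sval i *m geo_pt (emb v) = (geo_frame i).1 *: (Q0 *m geo_pt (emb v *m (geo_frame i).2)).
    rewrite /geo_pt (unitize_orthr _ OO) !mulmxDr scalerDr Qe; congr (_ + _).
    by rewrite -!scalemxAr QO !scalerA mulrC.
  by rewrite unitizeN// hline_signed.
- move=> z z' z0 z'0.
  have n0 y : y != 0 -> Q0 *m geo_pt y != 0.
    by move=> y0; rewrite -dotm_eq0 dotm_orth// geo_pt_norm// gt_eqF// ltr_pwDl// sqr_ge0.
  move=> /hline_real_inj [||e ee]; try by apply: unitize_norm; exact: n0.
  rewrite !unitize_orth// scalemxAr => /Q0inj.
  rewrite /unitize !geo_pt_norm// scalerA mulrC -scalerA => /scalerI E.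
  have {}E : geo_pt z = e *: geo_pt z'.
    by apply: E; rewrite invr_eq0 gt_eqF// sqrtr_gt0 ltr_pwDl// sqr_ge0.
  (* Both representatives have component 1 along e_0, so the sign is +: antipodal directions give
     distinct points of the projective space. *)
  have e1 : e = 1.
    have := congr1 (dotm e0) E.
    by rewrite dotmZr !dotmDr !dotmZr !geo_e0 e01 mulr0 addr0 mulr1.
  move: E; rewrite e1 scale1r => /addrI /(scalerI tn) /(isom_inj geo_isom).
  exact: unitize_eq.
- move=> z z0; have Xz0 : geo z != 0 by rewrite -dotm_eq0 geo_isom sum_dotm dotm_eq0.
  pose w1 : V := emb 0.
  have w11 : dotm (geo w1) (geo w1) = 1.
    rewrite geo_isom sum_dotm nsq_dotm (nsq_emb (hypercomplex_real k)) /rho /nsq.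
    by rewrite big1 ?addr0// => j _; rewrite mxE expr0n.
  (* The reflection takes the direction of [emb 0] to that of z. Both are orthogonal to e_0, so H
     fixes e_0 and Q0 H is again a frame centred at P. *)
  have [//||H [HT HH He Hf H0]] := @householder R _ (geo w1) (unitize (geo z)).
    exact: unitize_norm.
  have us : unitize (geo z) = geo (unitize z) by exact: (unitize_isom geo_isom).
  have sup y (i : 'I_m.+1) : (k.+1 < i)%N -> geo y i 0 = 0.
    by move=> ki; move/rowP/(_ 0): (geo_supp y ki); rewrite mxE [RHS]mxE.
  have hH : adapted k.+1 H.
    by apply: (householder_adapted H0) => // i ki; rewrite ?us sup.
  have He0 : H *m e0 = e0 by apply: Hf; rewrite us !geo_e0.
  have hQ : adapted k.+1 (Q0 *m H) by exact: adaptedM.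
  have hQP : hpar (Q0 *m H) 0 = P.
    rewrite hline_real0; last by have [] := hQ.
    by rewrite PE -(mulmxA Q0) He0.
  pose i : idx S := exist _ (Q0 *m H) (conj hQ hQP); exists i.
  have [ee OO Qe QO] := geo_frameP i.
  have e1 : (geo_frame i).1 = 1.
    move: Qe; rewrite /= -mulmxA He0 => /(congr1 (dotm (Q0 *m e0))).
    by rewrite dotmZr dotm_orth// e01 mulr1.
  have -> : z *m (geo_frame i).2^T = Num.sqrt (dotm (geo z) (geo z)) *: emb 0.
    apply: (isom_inj geo_isom).
    have := QO (z *m (geo_frame i).2^T).
    rewrite e1 scale1r /= -(mulmxA z) OO mulmx1 -mulmxA => /Q0inj /(congr1 (mulmx H)).
    rewrite mulmxA HH mul1mx => ->; rewrite linearZ /= -[emb 0]/w1.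
    have -> : geo w1 = H *m unitize (geo z) by rewrite -He mulmxA HH mul1mx.
    rewrite scalemxAr /unitize scalerA divff ?scale1r// gt_eqF// sqrtr_gt0.
    by rewrite dotm_gt0.
  by apply: half_cone (half_emb 0); rewrite sqrtr_gt0 dotm_gt0.
move=> i f v mu fC; have [[QQ _] _] := svalP i.
by rewrite -(Lop_gloc QQ hk tn).
Qed.

End GeodesicLambda.

(** A reflection taking e_0 to a real unit representative of P serves as Q0. *)
Lemma geodesic_sphere_lambda2 (R : realType) m k (P : set 'M[R]_(m.+1, 4)) (r : R)
    (hk : (k < m)%N) (hr : 0 < r < pi / 2) (hP : RPset k.+1 P) :
  (3 < k)%N -> is_lambda (geodesic_sphere_immersion hk hr hP) 2 0.
Proof.
move=> k3; have [p [p1 /sub_qe0[b eb] ps PE]] := hP; subst p.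
have b0 := real_supp ps.
have b1 : dotm b b = 1 by rewrite -p1 dotm_mul_qe0 dotm_qe0 mulr1.
have [||H [HT HH He _ H0]] := @householder R _ (delta_mx 0 0) b => //.
  by rewrite dotm_delta eqxx.
have A1 : adapted k.+1 H.
  by apply: (householder_adapted H0) => // i; apply: delta_supp.
by apply: (@geodesic_sphere_lambda2_frame _ _ _ _ _ H) => //; rewrite He.
Qed.

(** * The cases of HP, CP and RP *)

Section ProjectiveCases.
Context {R : realType} {m : nat}.

Lemma HP_lambda2 l : (l <= m)%N -> (4 < l * 4)%N ->
  is_lambda (HP_immersion m l : immersion R _ _) 2 ((l * 4)%:R + 2 * 4%:R).
Proof.
move=> lm l4; have l0 : (0 < l)%N by case: (l) l4.
apply: (@proj_lambda2 R m l (l * 4) 3 1%:M (@vec_mx R l 4) _ _ _ _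
  (fun s => blockJ l (unitH s)) quat_kappa lm l0).
- exact: ltn_addl.
- exact: hypercomplex_quat.
- exact: quat_loc_isom.
- exact: quat_loc_mul.
- exact: quat_loc_orth.
- move=> t; rewrite (bigD1 t)//= big1 => [|s st]; last by rewrite /quat_kappa (negbTE st) scale0r.
  by rewrite addr0 /quat_kappa eqxx scale1r rowE mulmx1 /qe inord_val.
- by rewrite rowE mulmx1 /qe; congr delta_mx; apply: val_inj; rewrite /= inordK.
move=> s t; have E i : row i 1%:M = qe (i : 'I_4) :> 'rV[R]_4.
  by rewrite rowE mulmx1 /qe inord_val.
by rewrite !E dotm_qe.
Qed.

Lemma CP_lambda2 l (u : 'rV[R]_4) (hu : imaginary_unit u) : (l <= m)%N -> (4 < l * 2)%N ->
  is_lambda (CP_immersion m l hu) 2 ((l * 2)%:R + 2 * 2%:R).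
Proof.
move=> lm l4; have l0 : (0 < l)%N by case: (l) l4.
have [u0 u1] := hu.
have r0 : row 0 (cplx_basis u) = qe 0 by exact: (@row0_col_mx R 1).
have r1 : row 1 (cplx_basis u) = u.
  have -> : (1 : 'I_2) = rshift 1 (0 : 'I_1) by apply: val_inj.
  by rewrite (@rowKd _ 1 1) row_id.
apply: (@proj_lambda2 R m l (l * 2) 1 (cplx_basis u) (@cplx_loc R u l) _ _ _ _
  (fun s => blockJ l (unitC s)) (cplx_kappa u) lm l0).
- exact: ltn_addl.
- exact: hypercomplex_cplx.
- exact: cplx_loc_isom.
- exact: cplx_loc_mul.
- exact: cplx_loc_orth.
- apply: ord2P; rewrite ?r0 ?r1 /cplx_kappa /=.
    rewrite (bigD1 0)//= big1 => [|s s0]; first by rewrite addr0 ?eqxx scale1r.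
    by rewrite (negbTE s0) scale0r.
  by rewrite {1}(row_sum_delta u); apply: eq_bigr => s _; rewrite /qe inord_val.
- exact: r0.
have qu : dotm (qe 0) u = 0.
  by rewrite dotm4 !qeE//= u0; ring.
apply: ord2P; apply: ord2P; rewrite ?r0 ?r1 ?dotm_qe0 ?u1//.
by rewrite dotmC.
Qed.

Lemma RP_lambda2 k : (k <= m)%N -> (3 < k)%N ->
  is_lambda (RP_immersion m k : immersion R _ _) 2 (k%:R + 2 * 1%:R).
Proof.
move=> km k3; have k0 : (0 < k)%N by exact: leq_trans k3.
have q0 t : row t (qe 0 : 'rV[R]_4) = qe 0 by rewrite ord1 row_id.
apply: (@proj_lambda2 R m k k 0 (qe 0) (@real_loc R k) _ _ _ _
  (fun=> 1%:M) real_kappa km k0).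
- by rewrite add1n ltnS.
- exact: hypercomplex_real.
- exact: real_loc_isom.
- exact: real_loc_mul.
- exact: real_loc_orth.
- move=> t; rewrite q0 (bigD1 0)//= big1 => [|s s0];
  last by rewrite /real_kappa (negbTE s0) scale0r.
  by rewrite addr0 /real_kappa eqxx scale1r.
- exact: q0.
by move=> s t; rewrite !q0 dotm_qe0 !ord1.
Qed.

End ProjectiveCases.

Theorem proposition5p4 (R : realType) (m k : nat) (k_gt4 : (4 < k)%N) :
  [/\ forall l : nat, (l <= m)%N -> k = (4 * l)%N ->
        is_lambda (HP_immersion m l : immersion R _ _) 2 (k%:R + 8),
      forall (l : nat) (u : 'rV[R]_4) (hu : imaginary_unit u),
        (l <= m)%N -> k = (2 * l)%N ->
        is_lambda (CP_immersion m l hu) 2 (k%:R + 4),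
      (k <= m)%N -> is_lambda (RP_immersion m k : immersion R _ _) 2 (k%:R + 2),
      (k <= m)%N -> is_lambda (S_immersion m k : immersion R _ _) 2 0
    & forall (P : set 'M[R]_(m.+1, 4)) (r : R) (hk : (k < m)%N)
        (hr : 0 < r < pi / 2) (hP : RPset k.+1 P),
        is_lambda (geodesic_sphere_immersion hk hr hP) 2 0].
Proof.
have k_gt3 : (3 < k)%N := ltnW k_gt4.
split=> [l lm kl|l u hu lm kl|km|km|P r hk hr hP].
(* Coordinates are l x 4 matrices, hence the order of the factors; the constants 8, 4 and 2 are 2 (d
   + 1) for H, C and R. *)
- have kl' : k = (l * 4)%N by rewrite mulnC.
  have -> : k%:R + 8 = (l * 4)%:R + 2 * 4%:R :> R by rewrite -kl'; ring.
  by apply: HP_lambda2; rewrite -?kl'.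
- have kl' : k = (l * 2)%N by rewrite mulnC.
  have -> : k%:R + 4 = (l * 2)%:R + 2 * 2%:R :> R by rewrite -kl'; ring.
  by apply: CP_lambda2; rewrite -?kl'.
- by have := @RP_lambda2 R m k km k_gt3; rewrite mulr1.
- exact: sphere_lambda2.
- exact: geodesic_sphere_lambda2.
Qed.
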